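(* Let $d\ge 1$ be an integer, let $s\in\overline{\mathbf R_\flat}$ satisfy $s<\frac12$, let $t_0\in\mathbf R^d$, $u=(u_1,\dots,u_d)\in(0,1)^d$ and $f\in\mathcal H_0'(\mathbf R^d)$. Put $$\Lambda_{t_0,u}=\{\,t_0+(k_1u_1,\dots,k_du_d)\,;\ k_j\in\mathbf Z,\ 0\le k_ju_j<2,\ j=1,\dots,d\,\}.$$ Then the following conditions are equivalent: (1) $f\in\mathcal H_s(\mathbf R^d)$; (2) for some $r>0$, $$\sup_{t\in\Lambda_{t_0,u}}\big\|(\mathscr F_tf)\cdot e^{\frac12|\cdot|^2}\,\omega_{d,r,s}\big\|_{L^\infty(\mathbf R^d)}<\infty;$$ (3) for some $r>0$, $$\sup_{t\in\mathbf R^d}\big\|(\mathscr F_tf)\cdot e^{\frac12|\cdot|^2}\,\omega_{d,r,s}\big\|_{L^\infty(\mathbf R^d)}<\infty.$$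
   Context: Index sets. $\mathbf R_\flat=\mathbf R_+\cup\{\flat_\sigma:\sigma>0\}$, where $\mathbf R_+=(0,\infty)$ and the $\flat_\sigma$ are formal symbols, and $\overline{\mathbf R_\flat}=\mathbf R_\flat\cup\{0\}$. The order extends the usual one on real numbers by $x_1<\flat_{\sigma_1}<\flat_{\sigma_2}<x_2$ whenever $0\le x_1<\frac12$, $x_2\ge\frac12$ and $0<\sigma_1<\sigma_2$. In particular $\flat_\sigma<\frac12$ for every $\sigma>0$. Hermite functions: for $\alpha\in\mathbf N^d$ (with $0\in\mathbf N$), $h_\alpha(x)=\pi^{-d/4}(-1)^{|\alpha|}(2^{|\alpha|}\alpha!)^{-1/2}e^{|x|^2/2}\,\partial^\alpha e^{-|x|^2}$, $x\in\mathbf R^d$. Spaces. $\mathcal H_0'(\mathbf R^d)$ is the space of all formal Hermite series $f=\sum_{\alpha\in\mathbf N^d}c(f,\alpha)h_\alpha$ with arbitrary complex coefficients $c(f,\alpha)$. $\mathcal H_0(\mathbf R^d)$ consists of those $f$ with $c(f,\alpha)\ne0$ for at most finitely many $\alpha$. For $s\in\mathbf R_\flat$ and $r>0$ let $\vartheta_{r,s}(\alpha)=e^{r|\alpha|^{1/(2s)}}$ if $s\in\mathbf R_+$, and $\vartheta_{r,s}(\alpha)=r^{|\alpha|}(\alpha!)^{1/(2\sigma)}$ if $s=\flat_\sigma$. For $s\in\mathbf R_\flat$, the Pilipović space $\mathcal H_s(\mathbf R^d)$ (of Roumieu type) consists of all $f\in\mathcal H_0'(\mathbf R^d)$ such that $\sup_\alpha|c(f,\alpha)|\vartheta_{r,s}(\alpha)<\infty$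 for some $r>0$. Functions as elements of $\mathcal H_0'$: a measurable function $g$ on $\mathbf R^d$ such that $g h_\alpha$ is integrable for every $\alpha$ is identified with $\sum_\alpha\big(\int g\,h_\alpha\,dx\big)h_\alpha$. For $g\in\mathcal H_0'(\mathbf R^d)$, finiteness of a weighted $L^\infty$ norm of $g$ means that $g$ is given by such a measurable function whose weighted essential supremum is finite. (Partial) fractional Fourier transform of order $t\in\mathbf R^d$: $\mathscr F_t:\mathcal H_0'(\mathbf R^d)\to\mathcal H_0'(\mathbf R^d)$ is given by $\mathscr F_t\big(\sum_\alpha c(\alpha)h_\alpha\big)=\sum_\alpha e^{-i\frac\pi2(t_1\alpha_1+\cdots+t_d\alpha_d)}c(\alpha)h_\alpha$. (For $t=(1,\dots,1)$ it is the Fourier transform $\widehat f(\xi)=(2\pi)^{-d/2}\int f(x)e^{-i\langle x,\xi\rangle}dx$.) Weights: with $\langle z\rangle=(1+|z|^2)^{1/2}$, for $z\in\mathbf C^d$ (in particular for $z\in\mathbf R^d$) and $s<\frac12$, $$\omega_{d,r,s}(z)=\begin{cases}e^{-r(\log\langle z\rangle)^{1/(1-2s)}},& s\in\mathbf R,\ 0\le s<\frac12,\\ e^{-r|z|^{2\sigma/(\sigma+1)}},& s=\flat_\sigma.\end{cases}$$ *)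

(* Defs.v *)
From HB Require Import structures.
From mathcomp Require Import all_boot all_order all_algebra.
From mathcomp Require Import all_classical all_reals all_analysis.
From mathcomp Require Import complex.

Set Implicit Arguments.
Unset Strict Implicit.
Unset Printing Implicit Defensive.

Import Order.TTheory GRing.Theory Num.Theory.
Import numFieldNormedType.Exports.
Import ComplexField.Normc.

Local Open Scope classical_set_scope.
Local Open Scope ring_scope.

Definition tuple_cons (R : realType) n (z : measurableTypeR R * n.-tuple R) :
  n.+1.-tuple R := [tuple of z.1 :: z.2].

Lemma measurable_tuple_cons (R : realType) n :
  measurable_fun setT (@tuple_cons R n).
Proof. exact: measurable_cons. Qed.

Section LebesgueStep.
Variables (R : realType) (n : nat).
Variable m : {sigma_finite_measure set (n.-tuple R) -> \bar R}.

Definition lebesgue_step : set (n.+1.-tuple R) -> \bar R :=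
  pushforward (@lebesgue_measure R \x m)%E (@tuple_cons R n).

Let step0 : lebesgue_step set0 = 0%E.
Proof. by rewrite /lebesgue_step /pushforward preimage_set0 measure0. Qed.

Let step_ge0 A : (0 <= lebesgue_step A)%E.
Proof. by apply: integral_ge0 => *; exact: measure_ge0. Qed.

Let step_sigma_additive : semi_sigma_additive lebesgue_step.
Proof.
move=> F mF tF mUF; rewrite /lebesgue_step /pushforward preimage_bigcup.
have mc A : measurable A -> measurable (@tuple_cons R n @^-1` A).
  by move=> mA; rewrite -[X in measurable X]setTI; exact: measurable_tuple_cons.
apply: measure_semi_sigma_additive.
- by move=> k; apply: mc; exact: mF.
- apply/trivIsetP => i j _ _ ij; rewrite -preimage_setI.
  by move/trivIsetP : tF => /(_ _ _ I I ij) ->; rewrite preimage_set0.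
- by rewrite -preimage_bigcup; exact: mc.
Qed.

HB.instance Definition _ := isMeasure.Build _ _ _ lebesgue_step
  step0 step_ge0 step_sigma_additive.

Let step_sigma_finite : sigma_finite setT lebesgue_step.
Proof.
have /sigma_finiteP[F [FT ndF mF]] := sigma_finiteT (@lebesgue_measure R).
have /sigma_finiteP[G [GT ndG mG]] := sigma_finiteT m.
pose uncons (t : n.+1.-tuple R) : measurableTypeR R * n.-tuple R :=
  (thead t, [tuple of behead t]).
have consK : cancel (@tuple_cons R n) uncons.
  by case=> x t; congr pair; apply: val_inj.
have unconsK : cancel uncons (@tuple_cons R n).
  by move=> t; rewrite [RHS]tuple_eta; apply: val_inj.
have muncons : measurable_fun setT uncons.
  apply: measurable_fun_pair; first exact: measurable_tnth.
  exact: measurable_behead.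
exists (fun k => uncons @^-1` (F k `*` G k)).
  apply/seteqP; split=> // t _.
  have [i _ Fi] : (\bigcup_i F i) (uncons t).1 by rewrite -FT.
  have [j _ Gj] : (\bigcup_i G i) (uncons t).2 by rewrite -GT.
  exists (maxn i j) => //; split.
    by apply: (subsetPset _ _ (ndF i _ _)) Fi; exact: leq_maxl.
  by apply: (subsetPset _ _ (ndG j _ _)) Gj; exact: leq_maxr.
move=> k; have [mFk Fkoo] := mF k; have [mGk Gkoo] := mG k.
have mFG : measurable (F k `*` G k) by exact: measurableX.
split; first by rewrite -[X in measurable X]setTI; exact: muncons.
rewrite /lebesgue_step /pushforward -comp_preimage.
rewrite (_ : uncons \o _ = id) ?preimage_id; last exact/funext.
by rewrite product_measure1E// lte_mul_pinfty// ge0_fin_numE.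
Qed.

HB.instance Definition _ := Measure_isSigmaFinite.Build _ _ _ lebesgue_step
  step_sigma_finite.

End LebesgueStep.

Fixpoint lebesgue_tuple (R : realType) (n : nat) :
    {sigma_finite_measure set (n.-tuple R) -> \bar R} :=
  match n with
  | 0 => \d_ ([tuple] : 0.-tuple R)
  | n'.+1 => lebesgue_step (lebesgue_tuple R n')
  end.

Lemma lebesgue_tuple_box (R : realType) n (A : 'I_n -> set R) :
    (forall i, measurable (A i)) ->
  lebesgue_tuple R n [set x | forall i, A i (tnth x i)] =
  (\prod_(i < n) @lebesgue_measure R (A i))%E.
Proof.
elim: n A => [|n IH] A mA.
  rewrite big_ord0 /= diracE mem_set//; first by case.
rewrite big_ord_recl /= /lebesgue_step /pushforward.
rewrite (_ : _ @^-1` _ =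
  A ord0 `*` [set x | forall i, A (lift ord0 i) (tnth x i)]); last first.
  apply/seteqP; split => -[x t] /= Axt.
    by split => [|i]; [have := Axt ord0|have := Axt (lift ord0 i); rewrite tnthS].
  move=> i; case: (unliftP ord0 i) => [j|] ->; last exact: Axt.1.
  by rewrite tnthS; exact: Axt.2.
rewrite product_measure1E.
- by congr (_ * _)%E; apply: (IH (fun i => A (lift ord0 i))).
- exact: mA.
rewrite (_ : mkset _ =
    \bigcap_(i in setT) ((fun x : n.-tuple R => tnth x i) @^-1`
      A (lift ord0 i))).
  apply: fin_bigcap_measurable => // i _; rewrite -[X in measurable X]setTI.
  exact: measurable_tnth.
by apply/seteqP; split => x /= Ax i; [move=> _|]; exact: Ax.
Qed.

(* The index set: [Exponent s] is the real number s >= 0 and [Flat sigma] is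
   the formal symbol flat_sigma. *)
Inductive flat_index (R : realType) :=
  | Exponent of {nonneg R}
  | Flat of {posnum R}.

Definition flat_lt (R : realType) (s1 s2 : flat_index R) : bool :=
  match s1, s2 with
  | Exponent x1, Exponent x2 => x1%:num < x2%:num
  | Exponent x1, Flat _ => x1%:num < 1 / 2
  | Flat _, Exponent x2 => 1 / 2 <= x2%:num
  | Flat sigma1, Flat sigma2 => sigma1%:num < sigma2%:num
  end.

Definition is_zero_index (R : realType) (s : flat_index R) : bool :=
  if s is Exponent x then x%:num == 0 else false.

Section Hermite.
Variables (R : realType) (d : nat).
Implicit Types (x t u : d.-tuple R) (alpha : d.-tuple nat) (s : flat_index R).

Local Notation mu := (lebesgue_tuple R d).

Definition enorm x : R := Num.sqrt (\sum_(j < d) tnth x j ^+ 2).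

Definition bracket x : R := Num.sqrt (1 + enorm x ^+ 2).

Definition mdegree alpha : nat := (\sum_(j < d) tnth alpha j)%N.

Definition mfact alpha : nat := (\prod_(j < d) (tnth alpha j)`!)%N.

Definition partial (j : 'I_d) (F : d.-tuple R -> R) x : R :=
  derive1 (fun y : R => F [tuple if k == j then y else tnth x k | k < d])
    (tnth x j).

Definition mpartial alpha (F : d.-tuple R -> R) : d.-tuple R -> R :=
  foldr (fun j => iter (tnth alpha j) (partial j)) F (enum 'I_d).

Definition hermite alpha x : R :=
  pi `^ (- (d%:R / 4)) * (-1) ^+ mdegree alpha *
  (2 ^+ mdegree alpha * (mfact alpha)%:R) `^ (- (1 / 2)) *
  expR (enorm x ^+ 2 / 2) *
  mpartial alpha (fun y => expR (- enorm y ^+ 2)) x.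

(* A formal Hermite series is given by its family of coefficients. *)
Definition hermite_series := d.-tuple nat -> R[i].

Implicit Type f : hermite_series.

(* Only meaningful when [s] is not the index 0. *)
Definition vartheta (r : R) s alpha : R :=
  match s with
  | Exponent x => expR (r * (mdegree alpha)%:R `^ (1 / (2 * x%:num)))
  | Flat sigma =>
      r ^+ mdegree alpha * (mfact alpha)%:R `^ (1 / (2 * sigma%:num))
  end.

Definition pilipovic_space s : set hermite_series :=
  [set f | if is_zero_index s then finite_set [set alpha | f alpha != 0]
           else exists2 r : R, 0 < r &
             (ereal_sup (range (fun alpha =>
               (normc (f alpha) * vartheta r s alpha)%:E)) < +oo)%E].

(* The function [g] is identified with the formal series [f]. Measurability is
   Borel measurability: a Lebesgue measurable function is a.e. equal to a Borel
   one, and everything here only depends on [g] up to null sets. *)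
Definition represents (g : d.-tuple R -> R[i]) f : Prop :=
  [/\ measurable_fun setT (fun x => complex.Re (g x)),
      measurable_fun setT (fun x => complex.Im (g x)) &
      forall alpha,
        [/\ mu.-integrable setT
              (fun x => (complex.Re (g x) * hermite alpha x)%:E),
            mu.-integrable setT
              (fun x => (complex.Im (g x) * hermite alpha x)%:E) &
            f alpha =
              Complex (\int[mu]_x (complex.Re (g x) * hermite alpha x))
                      (\int[mu]_x (complex.Im (g x) * hermite alpha x))]].

(* Finite exactly when the series is given by some function whose weighted
   essential supremum is finite; +oo when it is not given by any function. *)
Definition weighted_Linfty_norm (W : d.-tuple R -> R) f : \bar R :=
  ereal_inf [set 'N[mu]_+oo[(fun x => (normc (g x) * W x)%:E)]%E
            | g in [set g | represents g f]].

Definition frac_fourier t f : hermite_series := fun alpha =>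
  let theta := pi / 2 * \sum_(j < d) tnth t j * (tnth alpha j)%:R in
  Complex (cos theta) (- sin theta) * f alpha.

(* Only meaningful when [s] is smaller than 1/2. *)
Definition omega (r : R) s x : R :=
  match s with
  | Exponent y => expR (- r * ln (bracket x) `^ (1 / (1 - 2 * y%:num)))
  | Flat sigma =>
      expR (- r * enorm x `^ (2 * sigma%:num / (sigma%:num + 1)))
  end.

Definition Lambda t u : set (d.-tuple R) :=
  [set [tuple tnth t j + (tnth k j)%:~R * tnth u j | j < d]
  | k in [set k : d.-tuple int |
          forall j, 0 <= (tnth k j)%:~R * tnth u j < 2]].

End Hermite.

(* Main.v *)
Require Import Defs.
From mathcomp Require Import all_boot all_order all_algebra.
From mathcomp Require Import all_classical all_reals all_analysis.
From mathcomp Require Import measurable_realfun ess_sup_inf complex ring lra.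

(** Let h_n(y) = p_n(y) exp(-y^2/2) be the Hermite functions of one variable;
    the functions of the statement are their tensor products. The weight is
    also, up to the value of r, a tensor product: its inverse at x is the
    product of the numbers v(x_j) = exp(r phi(x_j)), where phi is a power of
    log <y> or a power of |y|. So both implications come down to estimates in
    one variable.

    _From coefficients to functions._ The three-term recurrence gives
    |p_n(y)| <= K^n (1 + |y|^n / sqrt(n!)) ([hp_bound]). Hence, when gam_n
    decays like the coefficients of an element of H_s, the sum of the
    gam_n |h_n(y)| is at most a multiple of exp(-y^2/2) v(y)
    ([hermite_weight_finite], [hermite_weight_exp], [hermite_weight_fact]).
    A fractional Fourier transform only multiplies the coefficients by phases,
    so all the transforms of f are given by absolutely convergent series and
    satisfy the weighted bound with the same constant
    ([hermite_synthesis_complex], [weighted_norm_of_coef]).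

    _From functions on the lattice to coefficients._ For a function g bounded
    by exp(-y^2/2) v(y), consider the entire function F(z) of power series
    sum_n <g, h_n> z^n / sqrt(n!), the Bargmann transform of g. At a real point
    x it is the pairing of g with the kernel sum_n h_n(y) x^n / sqrt(n!), a
    Gaussian ([hermite_generating]), so a bound v(y) (1 + y^2) <= Y exp(b y^2)
    gives |F(x)| <= Y exp(b x^2) up to a constant ([wbound_bargmann]).
    Replacing f by its transform of order t rotates the variable z by the angle
    - pi t / 2. The hypothesis on the lattice therefore controls F on a finite
    set of lines through the origin, and two consecutive ones form an angle
    at most pi u / 2 < pi / 2. As F is of order two, the theorem of Phragmen
    and Lindeloef extends the bound to the sectors between the lines, and
    Cauchy's inequality on the circle of radius S gives
    |<g, h_n>| <= sqrt(n!) Y exp(kappa b S^2) / S^n, where kappa depends only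
    on u ([sector_bound], [coef_bound_of_lattice]). For every large S the
    weight admits such Y and b with b S^2 at most of the order of log Y
    ([log_gauss_growth], [pow_gauss_growth]). Choosing S according to n gives
    back the decay of the coefficients ([cauchy_factor_large],
    [cauchy_factor_exp], [cauchy_factor_fact]).

    In several variables the argument is repeated one coordinate at a time
    ([pairing_coord_bound]): the coordinates that have been treated carry
    Hermite functions and the others carry Bargmann kernels at real points,
    and a change of the order of the transform in the current coordinate is
    a rotation of the variable in that coordinate ([pairing_phase]). *)

Set Implicit Arguments.
Unset Strict Implicit.
Unset Printing Implicit Defensive.

Import Order.TTheory GRing.Theory Num.Theory.
Import numFieldNormedType.Exports.
Import ComplexField.Normc.

Local Open Scope classical_set_scope.
Local Open Scope ring_scope.
Local Open Scope complex_scope.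

(** * Modulus and polar form of complex numbers *)

Section ComplexNorm.
Variable R : realType.
Implicit Types (x y : R[i]).

Lemma normc_ReIm x : normc x = Num.sqrt (complex.Re x ^+ 2 + complex.Im x ^+ 2).
Proof. by case: x. Qed.

Lemma sqr_normcE x : normc x ^+ 2 = complex.Re x ^+ 2 + complex.Im x ^+ 2.
Proof. by rewrite normc_ReIm sqr_sqrtr// addr_ge0// sqr_ge0. Qed.

Lemma normc_ge0 x : 0 <= normc x.
Proof. by rewrite normc_ReIm sqrtr_ge0. Qed.

Lemma normcD_le x y : normc (x + y) <= normc x + normc y.
Proof. exact: le_normcD. Qed.

Lemma normc_opp x : normc (- x) = normc x.
Proof. exact: normcN. Qed.

Lemma normcX x n : normc (x ^+ n) = normc x ^+ n.
Proof. by elim: n => [|n IH]; rewrite ?expr0 ?normc1// !exprS normcM IH. Qed.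

Lemma normc_real (r : R) : normc r%:C = `|r|.
Proof. by rewrite normc_ReIm /= expr0n/= addr0 sqrtr_sqr. Qed.

Lemma normc_sum (I : Type) (s : seq I) (P : pred I) (F : I -> R[i]) :
  normc (\sum_(i <- s | P i) F i) <= \sum_(i <- s | P i) normc (F i).
Proof.
elim/big_ind2 : _ => [|x a y b xa yb|//]; first by rewrite normc0.
by rewrite (le_trans (normcD_le _ _))// lerD.
Qed.

Lemma ler_Re_normc x : `|complex.Re x| <= normc x.
Proof. by rewrite normc_ReIm -sqrtr_sqr ler_wsqrtr// lerDl sqr_ge0. Qed.

Lemma ler_Im_normc x : `|complex.Im x| <= normc x.
Proof. by rewrite normc_ReIm -[leLHS]sqrtr_sqr ler_wsqrtr// lerDr sqr_ge0. Qed.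

Lemma normc_eq0 x : (normc x == 0) = (x == 0).
Proof. by apply/eqP/eqP => [/eq0_normc//|->]; rewrite normc0. Qed.

Lemma normc_gt0 x : (0 < normc x) = (x != 0).
Proof. by rewrite lt_def normc_eq0 normc_ge0 andbT. Qed.

Definition cis (t : R) : R[i] := Complex (cos t) (sin t).

Lemma cisD s t : cis (s + t) = cis s * cis t.
Proof. by rewrite /cis cosD sinD; congr Complex; ring. Qed.

Lemma cis0 : cis 0 = 1.
Proof. by rewrite /cis cos0 sin0. Qed.

Lemma cisX t n : cis t ^+ n = cis (t * n%:R).
Proof.
elim: n => [|n IH]; first by rewrite expr0 mulr0 cis0.
by rewrite exprS IH -cisD -[in RHS]natr1 mulrDr mulr1 addrC.
Qed.

Lemma normc_cis t : normc (cis t) = 1.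
Proof. by rewrite normc_ReIm /= cos2Dsin2 sqrtr1. Qed.

Lemma normc_polar (r t : R) : 0 <= r -> normc (r%:C * cis t) = r.
Proof. by move=> r0; rewrite normcM normc_real normc_cis mulr1 ger0_norm. Qed.

Lemma cis_pi : cis pi = - 1.
Proof. by rewrite /cis cospi sinpi /= -oppr0. Qed.

End ComplexNorm.

(** * The maximum principle for quotients of polynomials *)

Section MaximumPrinciple.
Variable R : realType.
Implicit Types (P Q : {poly R[i]}).

(** A bridge between R x R, where compactness is used, and R[i], where
    polynomials are evaluated. *)
Definition pairC (x : R * R) : R[i] := Complex x.1 x.2.

Lemma continuous_horner_complex P :
  continuous (fun x : R * R => complex.Re P.[pairC x]) /\
  continuous (fun x : R * R => complex.Im P.[pairC x]).
Proof.
elim/poly_ind : P => [|p c [IHr IHi]].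
  by split => x; rewrite (_ : (fun _ => _) = cst 0);
    [exact: cvg_cst|apply/funext => ?; rewrite horner0
    |exact: cvg_cst|apply/funext => ?; rewrite horner0].
split => x.
- rewrite (_ : (fun _ => _) = (fun x => complex.Re p.[pairC x] * x.1 -
     complex.Im p.[pairC x] * x.2 + complex.Re c)); last first.
    apply/funext => y; rewrite hornerMXaddC.
    by case: (p.[_]) => a b; case: c.
  apply: cvgD; last exact: cvg_cst.
  by apply: cvgB; apply: cvgM => //; [exact: IHr|exact: cvg_fst|exact: IHi|exact: cvg_snd].
- rewrite (_ : (fun _ => _) = (fun x => complex.Re p.[pairC x] * x.2 +
     complex.Im p.[pairC x] * x.1 + complex.Im c)); last first.
    apply/funext => y; rewrite hornerMXaddC.
    by case: (p.[_]) => a b; case: c.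
  apply: cvgD; last exact: cvg_cst.
  by apply: cvgD; apply: cvgM => //; [exact: IHr|exact: cvg_snd|exact: IHi|exact: cvg_fst].
Qed.

Lemma continuous_normc_horner P : continuous (fun x : R * R => normc P.[pairC x]).
Proof.
move=> x; rewrite (_ : (fun _ => _) = fun x => Num.sqrt
  (complex.Re P.[pairC x] ^+ 2 + complex.Im P.[pairC x] ^+ 2)); last first.
  by apply/funext => y; rewrite normc_ReIm.
have [cr ci] := continuous_horner_complex P.
apply: (continuous_comp (f := fun y : R * R => complex.Re P.[pairC y] ^+ 2 +
  complex.Im P.[pairC y] ^+ 2)); last exact: sqrt_continuous.
by apply: cvgD; rewrite !expr2; apply: cvgM; do ?[exact: cr|exact: ci].
Qed.

(** Used to choose a direction in which a leading term is a positive multiple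
    of a given number. *)
Lemma exists_root (n : nat) (z : R[i]) : (0 < n)%N -> exists y, y ^+ n = z.
Proof.
case: n => // n _.
have : size (('X^(n.+1) - z%:P)%R : {poly R[i]}) != 1%N by rewrite size_XnsubC.
by move/closed_rootP => [y]; rewrite rootE !hornerE subr_eq0 => /eqP; exists y.
Qed.

Definition line (z zeta : R[i]) (r : R) : R * R :=
  (complex.Re z + r * complex.Re zeta, complex.Im z + r * complex.Im zeta).

Lemma pairC_line z zeta r : pairC (line z zeta r) = z + r%:C * zeta.
Proof. by case: z zeta => a b [a' b']; congr Complex => /=; ring. Qed.

Lemma continuous_line z zeta : continuous (line z zeta).
Proof.
move=> r; apply: (@cvg_pair _ _ _ _ (nbhs _) (nbhs _)); apply: cvgD;
  by [exact: cvg_cst|apply: cvgMl; exact: cvg_id].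
Qed.

(** At a zero z of P - c Q of order m one has, with E(z) <> 0,
    P = c Q + (X - z)^m E. Along a direction zeta for which zeta^m E(z) is
    c Q(z), the perturbation points in the direction of c Q(z) and increases
    the modulus. *)
Lemma horner_local_increase P Q (z c : R[i]) : P != c *: Q ->
  P.[z] = c * Q.[z] -> c * Q.[z] != 0 ->
  exists zeta : R[i],
   \forall r \near 0^'+, normc (c * Q.[z + r%:C * zeta]) <
                         normc P.[z + r%:C * zeta].
Proof.
move=> PQ Pz cQ0.
have [m [E /implyP Ez DE]] := multiplicity_XsubC (P - c *: Q) z.
have {}Ez := Ez (ltac:(by rewrite subr_eq0)).
rewrite rootE in Ez.
have m0 : (0 < m)%N.
  case: m DE => // DE; move: Ez; rewrite -[E]mulr1 -[1]/(('X - z%:P) ^+ 0) -DE.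
  by rewrite !hornerE Pz subrr eqxx.
have [zeta zetaE] := exists_root (c * Q.[z] / E.[z]) m0.
exists zeta.
pose g (r : R) := complex.Re (conjc (c * Q.[z + r%:C * zeta]) *
    (zeta ^+ m * E.[z + r%:C * zeta])).
have Pzr r : P.[z + r%:C * zeta] = c * Q.[z + r%:C * zeta] +
    (r ^+ m)%:C * (zeta ^+ m * E.[z + r%:C * zeta]).
  have -> : P = c *: Q + (P - c *: Q) by rewrite addrC subrK.
  rewrite DE !hornerE; congr (_ + _).
  rewrite (_ : z + r%:C * zeta - z = r%:C * zeta); last by rewrite addrAC subrr add0r.
  by rewrite exprMn rmorphXn [LHS]mulrC.
have g0 : 0 < g 0.
  rewrite /g !rmorph0 mul0r addr0 zetaE divfK//.
  move: cQ0; rewrite -normc_gt0 => /(exprn_gt0 2).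
  by rewrite sqr_normcE; case: (c * Q.[z]) => a b /=; rewrite mulNr opprK -!expr2.
have cg : {for 0, continuous g}.
  have [cr ci] := continuous_horner_complex (c *: Q).
  have [er ei] := continuous_horner_complex (zeta ^+ m *: E).
  rewrite (_ : g = fun r =>
    complex.Re (c *: Q).[pairC (line z zeta r)] * complex.Re (zeta ^+ m *: E).[pairC (line z zeta r)] +
    complex.Im (c *: Q).[pairC (line z zeta r)] * complex.Im (zeta ^+ m *: E).[pairC (line z zeta r)]).
    have cl (h : R * R -> R) : continuous h ->
        h (line z zeta r) @[r --> 0] --> h (line z zeta 0).
      by move=> ch; apply: continuous_comp; [exact: continuous_line|exact: ch].
    by apply: cvgD; apply: cvgM;
      [exact: (cl _ cr)|exact: (cl _ er)|exact: (cl _ ci)|exact: (cl _ ei)].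
  apply/funext => r; rewrite /g pairC_line !hornerZ.
  by case: (c * _) => a b; case: (zeta ^+ m * _) => a' b' /=; ring.
near=> r.
rewrite -(@ltr_pXn2r _ 2)// ?nnegrE ?normc_ge0// Pzr !sqr_normcE.
have gr : 0 < g r.
  by near: r; exact: (cvgr_gt _ (cvg_at_right_filter cg)).
have rm : 0 < r ^+ m by rewrite exprn_gt0.
move: gr; rewrite /g.
case: (c * Q.[_]) => a b; case: (zeta ^+ m * _) => a' b' /=.
move: (r ^+ m) rm => s s0 gr.
have : 0 < s * (a * a' - - b * b') by rewrite mulr_gt0.
have := sqr_ge0 (s * a'); have := sqr_ge0 (s * b').
nra.
Unshelve. all: by end_near.
Qed.

(** If |P / Q| had a maximum larger than 1 at a point y, then y would have a
    neighbourhood contained in K, and for c = P(y) / Q(y) the modulus of P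
    would exceed that of c Q, hence the maximum, at a point close to y. *)
Lemma poly_maximum_principle (K : set (R * R)) P Q : compact K ->
  (forall x, K x -> Q.[pairC x] != 0) ->
  (exists2 x, K x & normc P.[pairC x] <= normc Q.[pairC x]) ->
  (forall x, K x -> nbhs x K \/ normc P.[pairC x] <= normc Q.[pairC x]) ->
  forall x, K x -> normc P.[pairC x] <= normc Q.[pairC x].
Proof.
move=> cK Q0 [x1 Kx1 Px1] bd x Kx.
pose f (x : R * R) := normc P.[pairC x] / normc Q.[pairC x].
have cf : {within K, continuous f}.
  apply/continuous_in_subspaceT => y /set_mem Ky.
  apply: cvgM; first exact: continuous_normc_horner.
  apply: cvgV; last exact: continuous_normc_horner.
  by rewrite normc_eq0 Q0.
have [y /set_mem Ky fy] := compact_EVT_max (ex_intro _ _ Kx) cK cf.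
have nQ z : K z -> 0 < normc Q.[pairC z] by move=> /Q0; rewrite normc_gt0.
have [fy1|fy1] := leP (f y) 1.
  have := le_trans (fy x (mem_set Kx)) fy1.
  by rewrite /f ler_pdivrMr ?mul1r ?nQ.
have nKy : nbhs y K.
  case: (bd y Ky) => //.
  by move: fy1; rewrite /f ltr_pdivlMr ?mul1r ?nQ// ltNge => /negP.
pose c := P.[pairC y] / Q.[pairC y].
have nc : normc c = f y by rewrite /c normcM normcV.
have Py : P.[pairC y] = c * Q.[pairC y] by rewrite /c divfK// Q0.
have PcQ : P != c *: Q.
  apply/eqP => PcQ; move: Px1; rewrite PcQ hornerZ normcM nc.
  by rewrite leNgt => /negP; apply; rewrite ltr_pMl// nQ.
have cQ0 : c * Q.[pairC y] != 0.
  rewrite mulf_neq0 ?Q0// -normc_gt0 nc; exact: lt_trans fy1.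
have [zeta Hz] := horner_local_increase PcQ Py cQ0.
have cp : line (pairC y) zeta r @[r --> 0^'+] --> y.
  rewrite [in X in _ --> X](_ : y = line (pairC y) zeta 0); last first.
    by rewrite /line !mul0r !addr0; case: y {Ky fy fy1 nKy c nc Py PcQ cQ0 Hz}.
  apply: cvg_at_right_filter; exact: continuous_line.
exfalso.
have [r [Kr Hr]] : exists r, K (line (pairC y) zeta r) /\ normc (c * Q.[pairC (line (pairC y) zeta r)]) < normc P.[pairC (line (pairC y) zeta r)].
  near (0 : R)^'+ => r; exists r; split; near: r.
    exact: cp nKy.
  by apply: filterS Hz => r; rewrite pairC_line.
have := fy (line (pairC y) zeta r) (mem_set Kr); rewrite {1}/f ler_pdivrMr ?nQ// -nc -normcM.
by rewrite leNgt Hr.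
Unshelve. all: by end_near.
Qed.

End MaximumPrinciple.

(** * A Phragmen-Lindeloef theorem in a sector *)

Section Sector.
Variable R : realType.

Lemma cis_tan (t : R) : cos t != 0 -> Complex 1 (tan t) = ((cos t)^-1)%:C * cis t.
Proof.
move=> c0; rewrite /tan /cis.
rewrite (_ : _ * _ = Complex ((cos t)^-1 * cos t) ((cos t)^-1 * sin t)); last first.
  by congr Complex; rewrite mul0r ?subr0 ?addr0.
by rewrite mulVf// mulrC.
Qed.

(** In polar coordinates a point of the plane region below is a point of a
    sector of half-opening phi, and it lies on the boundary rays exactly in the
    case of equality. *)
Lemma cone_polar (phi a b : R) : 0 < phi < pi / 2 -> `|b| <= tan phi * a ->
  exists rho eta, [/\ 0 <= rho, `|eta| <= phi, Complex a b = rho%:C * cis eta &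
    `|b| = tan phi * a -> eta = phi \/ eta = - phi].
Proof.
move=> /andP[phi0 phi2] ba.
have cphi : 0 < cos phi by apply: cos_gt0_pihalf; rewrite phi2 andbT; lra.
have tphi : 0 < tan phi.
  by rewrite divr_gt0// sin_gt0_pihalf// phi0.
have a0 : 0 <= a by rewrite -(pmulr_rge0 _ tphi) (le_trans _ ba).
have [a0'|an0] := eqVneq a 0.
  exists 0, phi; split => //; first by rewrite gtr0_norm.
    by move: ba; rewrite a0' mulr0 normr_le0 => /eqP ->; rewrite mul0r.
  by left.
have {}a0 : 0 < a by rewrite lt_def an0.
pose eta := atan (b / a).
have ceta : 0 < cos eta by apply: cos_gt0_pihalf; rewrite atan_gtNpi2 atan_ltpi2.
have teta : tan eta = b / a by rewrite atanK.
have phiK : atan (tan phi) = phi.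
  by rewrite tanK// in_itv/= phi2 andbT; lra.
exists (a / cos eta), eta; split.
- by rewrite divr_ge0// ltW.
- have : `|b / a| <= tan phi by rewrite normrM normfV (gtr0_norm a0) ler_pdivrMr.
  rewrite !ler_norml => /andP[h1 h2].
  by rewrite -{1}phiK -atanN -{2}phiK /eta !le_atan.
- rewrite rmorphM/= -mulrA -cis_tan ?gt_eqF// teta.
  by congr Complex => /=; rewrite ?mul0r ?subr0 ?addr0 ?mulr1// mulrC divfK ?gt_eqF.
- move=> bE.
  have : `|b / a| == tan phi by rewrite normrM normfV (gtr0_norm a0) bE mulfK.
  rewrite eqr_norml => /andP[/orP[|] /eqP h _]; rewrite /eta h ?atanN phiK; [left|right] => //.
Qed.

(** A sector truncated by a vertical segment, with m the tangent of its half
    opening. This shape is the image of a rectangle, which makes it compact. *)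
Definition cone (m rho : R) : set (R * R) := [set x | `|x.2| <= m * x.1 /\ x.1 <= rho].

Lemma compact_cone m rho : 0 < m -> 0 < rho -> compact (cone m rho).
Proof.
move=> m0 rho0.
have -> : cone m rho = (fun x : R * R => (x.1, x.2 * (m * x.1))) @`
    (`[0, rho] `*` `[-1, 1])%classic.
  apply/seteqP; split => [[a b]/= [/= ba ar]|_ [[a t]/= [+ +] <-]]; last first.
    rewrite !in_itv/= => /andP[a0 ar] t1; split => //=.
    rewrite normrM (ger0_norm (mulr_ge0 (ltW m0) a0)) ler_piMl ?mulr_ge0// ?(ltW m0)//.
    by rewrite ler_norml.
  have a0 : 0 <= a by rewrite -(pmulr_rge0 _ m0) (le_trans _ ba).
  exists (a, b / (m * a)); rewrite /= ?in_itv/=.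
    split; first by rewrite a0 ar.
    have [->|an0] := eqVneq a 0; first by rewrite mulr0 invr0 mulr0 lerN10 ler01.
    have ma : 0 < m * a by rewrite mulr_gt0// lt_def an0.
    by rewrite -ler_norml normrM normfV (gtr0_norm ma) ler_pdivrMr// mul1r.
  congr pair; have [a0'|an0] := eqVneq a 0.
    by move: ba; rewrite a0' !mulr0 normr_le0 => /eqP ->.
  by rewrite divfK// mulf_neq0// gt_eqF.
apply: continuous_compact; last by apply: compact_setX; exact: segment_compact.
apply: continuous_subspaceT => x.
have c1 : (fun y : R * R => y.1) @ x --> x.1 by exact: cvg_fst.
have c2 : (fun y : R * R => y.2) @ x --> x.2 by exact: cvg_snd.
have c3 : (fun y : R * R => y.2 * (m * y.1)) @ x --> x.2 * (m * x.1).
  by apply: (cvgM c2); exact: (cvgM (cvg_cst m) c1).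
exact: (cvg_pair c1 c3).
Qed.

Lemma cone_interior (m rho : R) (x : R * R) : `|x.2| < m * x.1 -> x.1 < rho ->
  nbhs x (cone m rho).
Proof.
move=> xm xr.
have c1 : (fun y : R * R => y.1) @ x --> x.1 by exact: cvg_fst.
have c2 : (fun y : R * R => y.2) @ x --> x.2 by exact: cvg_snd.
have c3 : (fun y : R * R => m * y.1 - `|y.2|) @ x --> m * x.1 - `|x.2|.
  by apply: cvgB; [exact: (cvgM (cvg_cst m) c1)|exact: cvg_norm].
have h1 : \forall y \near x, 0 < m * y.1 - `|y.2|.
  by apply: (cvgr_gt _ c3); rewrite subr_gt0.
have h2 : \forall y \near x, y.1 < rho by exact: (cvgr_lt _ c1).
near=> y; split; last by apply/ltW; near: y.
by rewrite -subr_ge0; apply/ltW; near: y.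
Unshelve. all: by end_near.
Qed.

(** With [pow_le_expR], this says that the polynomial (1 + x / L)^L is
    comparable with an exponential on [0, L]: it replaces exponentials in the
    comparison function of [sector_bound], which has to be a polynomial. *)
Lemma expR_half_le_pow (L : nat) (x : R) : (0 < L)%N -> 0 <= x <= L%:R ->
  expR (x / 2) <= (1 + x / L%:R) ^+ L.
Proof.
move=> L0 /andP[x0 xL].
have L0' : 0 < L%:R :> R by rewrite ltr0n.
pose y := x / L%:R.
have y0 : 0 <= y by rewrite divr_ge0// ltW.
have y1 : y <= 1 by rewrite ler_pdivrMr// mul1r.
have -> : x / 2 = (y / 2) * L%:R by rewrite /y; field; rewrite gt_eqF.
rewrite expRM_natr lerXn2r ?nnegrE ?expR_ge0 ?addr_ge0//.
(* e^{y/2} <= 1/(1-y/2) <= 1+y *)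
have h := expR_ge1Dx (- (y / 2)).
have e0 := expR_gt0 (y / 2).
have : expR (y / 2) * (1 - y / 2) <= 1.
  by rewrite -[leRHS](expRxMexpNx_1 (y / 2)) ler_wpM2l// ltW.
rewrite -/y; nra.
Qed.

Lemma pow_le_expR (L : nat) (x : R) : (0 < L)%N -> 0 <= x ->
  (1 + x / L%:R) ^+ L <= expR x.
Proof.
move=> L0 x0; have L0' : 0 < L%:R :> R by rewrite ltr0n.
rewrite -{2}(divfK (lt0r_neq0 L0') x) expRM_natr lerXn2r ?nnegrE ?expR_ge0//.
  by rewrite addr_ge0// divr_ge0// ltW.
exact: expR_ge1Dx.
Qed.

Lemma exists_small_eps (Y U V delta : R) : 0 < delta ->
  exists2 eps : R, 0 < eps & (Y + eps) * expR (U + eps * V) <= Y * expR U + delta.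
Proof.
move=> d0.
have c : (Y + e) * expR (U + e * V) @[e --> (0:R)] --> (Y + 0) * expR (U + 0 * V).
  apply: cvgM; first by apply: cvgD; [exact: cvg_cst|exact: cvg_id].
  apply: continuous_cvg; first exact: continuous_expR.
  by apply: cvgD; [exact: cvg_cst|apply: cvgMl; exact: cvg_id].
have h : \forall e \near (0:R)^'+, (Y + e) * expR (U + e * V) < Y * expR U + delta.
  apply: (cvgr_lt _ (cvg_at_right_filter c)).
  by rewrite addr0 mul0r addr0 ltrDl.
near (0:R)^'+ => e; exists e => //; apply/ltW; near: e; exact: h.
Unshelve. all: by end_near.
Qed.

(** The exponential of a power of degree 2q + 1 dominates the exponential of a
    power of degree 2q at a large radius. *)
Lemma exists_large_radius (A B eps c s : R) (q : nat) : 0 <= A -> 0 <= B ->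
  0 < eps -> 0 < c ->
  exists rho, [/\ 1 <= rho, s < rho &
    A * expR (B * (2 * rho) ^+ (q.*2)) <= eps * expR (eps * c * rho ^+ (q.*2.+1) / 2)].
Proof.
move=> A0 B0 e0 c0.
pose T := (B * 2 ^+ (q.*2) + A / eps) * 2 / (eps * c).
have T0 : 0 <= T.
  by rewrite divr_ge0// ?mulr_ge0// ?addr_ge0// ?mulr_ge0// ?exprn_ge0// ?invr_ge0// ltW// ?mulr_gt0.
pose rho := 1 + `|s| + T; exists rho.
have r1 : 1 <= rho by rewrite /rho -addrA lerDl addr_ge0.
split => //.
  by rewrite (le_lt_trans (ler_norm s))// /rho -addrA ltr_pwDl// lerDl.
have rT : T <= rho by rewrite /rho lerDr addr_ge0.
have rq : 1 <= rho ^+ q.*2 by rewrite exprn_ege1.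
have AE : A <= eps * expR (A / eps).
  rewrite -{1}(divfK (lt0r_neq0 e0) A) mulrC ler_pM2l// (le_trans _ (expR_ge1Dx _))//.
  by rewrite lerDr.
apply: (le_trans (ler_wpM2r (expR_ge0 _) AE)).
rewrite -[leLHS]mulrA -expRD ler_pM2l// ler_expR.
have ec : 0 < eps * c by rewrite mulr_gt0.
have h : (B * 2 ^+ q.*2 + A / eps) * 2 <= eps * c * rho.
  by move: rT; rewrite /T ler_pdivrMr// [leRHS]mulrC.
have h2 : (B * 2 ^+ q.*2 + A / eps) * 2 * rho ^+ q.*2 <= eps * c * rho * rho ^+ q.*2.
  by rewrite ler_wpM2r// (le_trans ler01).
rewrite exprS exprMn.
have : A / eps <= A / eps * rho ^+ q.*2 by rewrite ler_peMr// divr_ge0// ltW.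
move: h2; rewrite -/T; move: (A / eps) (rho ^+ _) (2 ^+ _) => a x y.
nra.
Qed.

Lemma cos_ge_of_le (a x : R) : 0 <= a <= pi -> `|x| <= a -> cos a <= cos x.
Proof.
move=> /andP[a0 api] xa; rewrite -(cos_norm x) leNgt; apply/negP => h.
have xpi := le_trans xa api.
move: h; rewrite ltr_cos ?in_itv/= ?a0 ?api ?normr_ge0 ?xpi//.
by rewrite ltNge xa.
Qed.

(** After the substitution z = w^q the sector becomes narrow and P is of order
    2q in w. It is compared with Q(w) = (Y + eps) (1 + G(w) / L)^L, an
    approximation of (Y + eps) exp G(w), where
    G(w) = kappa b w^(2q) + eps w^(2q+1). In the sector
    the real part of G is at least c times the sum of the moduli of its two
    terms: the first term takes care of the two sides and the
    second one, of higher order, of the points far from the origin. The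
    parameter N accounts for the truncation of a power series, which
    perturbs the bound on the sides by a tail of size 2^-N. *)
Lemma sector_bound (phimax : R) : 0 < phimax < pi / 4 ->
  exists2 kappa : R, 0 < kappa & forall A B Y b S delta : R,
  0 <= A -> 0 <= B -> 0 <= Y -> 0 <= b -> 0 < S -> 0 < delta ->
  exists N0, forall N, (N0 <= N)%N -> forall (P : {poly R[i]}) (phi : R),
  0 < phi <= phimax ->
  (forall z, normc P.[z] <= A * expR (B * normc z ^+ 2)) ->
  (forall x, 0 <= x -> normc P.[x%:C * cis phi] <=
      Y * expR (b * x ^+ 2) + 2 ^- N * (A * expR (B * x ^+ 2))) ->
  (forall x, 0 <= x -> normc P.[x%:C * cis (- phi)] <=
      Y * expR (b * x ^+ 2) + 2 ^- N * (A * expR (B * x ^+ 2))) ->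
  forall psi, `|psi| <= phi ->
    normc P.[S%:C * cis psi] <= Y * expR (kappa * b * S ^+ 2) + delta.
Proof.
move=> /andP[pm0 pm4].
(* As 2 phimax < pi/2, for large q the power w^(2q+1) maps the sector of half
   opening phimax / q into a sector where the real part is positive. *)
have [q q0 hq] : exists2 q : nat, (0 < q)%N & (2 + q%:R^-1) * phimax < pi / 2.
  have h : 0 < (pi / 2 - 2 * phimax) / phimax by rewrite divr_gt0//; lra.
  have [k hk] : exists k : nat, (k.+1%:R)^-1 < (pi / 2 - 2 * phimax) / phimax.
    exists (Num.truncn ((pi / 2 - 2 * phimax) / phimax)^-1).
    by rewrite invf_plt ?posrE// truncnS_gt.
  exists k.+1 => //.
  by move: hk; rewrite ltr_pdivlMr// ltrBrDl -mulrDl.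
set p := q.*2.+1.
have q0R : 0 < q%:R :> R by rewrite ltr0n.
have q1R : 1 <= q%:R :> R by rewrite ler1n.
pose th := p%:R * (phimax / q%:R).
have thE : th = (2 + q%:R^-1) * phimax.
  by rewrite /th /p -addn1 natrD -muln2 natrM; field; rewrite gt_eqF.
have th0 : 0 < th by rewrite thE mulr_gt0// addr_gt0// invr_gt0.
have th2 : th < pi / 2 by rewrite thE.
have pi0 := pi_gt0 R.
pose c := cos th.
have c0 : 0 < c by apply: cos_gt0_pihalf; rewrite th2 andbT; lra.
have c1 : c <= 1 := cos_le1 _.
have cE x : `|x| <= th -> c <= cos x by apply: cos_ge_of_le; apply/andP; split; lra.
(* The constant compensates the cosine c of the widest angle and the factor
   1/2 lost in [expR_half_le_pow]. *)
exists (2 / c); first by rewrite divr_gt0.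
set kappa := 2 / c.
have k0 : 0 < kappa by rewrite divr_gt0.
move=> A B Y b S delta A0 B0 Y0 b0 S0 d0.
pose s := S `^ (q%:R^-1).
have s0 : 0 < s by rewrite powR_gt0.
have sq : s ^+ q = S.
  by rewrite /s -powR_mulrn ?powR_ge0// -powRrM mulVf ?gt_eqF// powRr1// ltW.
have [eps e0 He] := exists_small_eps Y (kappa * b * S ^+ 2) (s ^+ p) d0.
have [rho [r1 sr Hr]] := exists_large_radius s q A0 B0 e0 c0.
have r0 : 0 < rho by rewrite (lt_le_trans ltr01).
pose M (x : R) := kappa * b * x ^+ q.*2 + eps * x ^+ p.
have kb : 0 <= kappa * b by rewrite mulr_ge0// ltW.
have M0 x : 0 <= x -> 0 <= M x.
  by move=> x0; apply: addr_ge0; rewrite mulr_ge0 ?exprn_ge0 ?(ltW e0).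
have Mmono x y : 0 <= x -> x <= y -> M x <= M y.
  move=> x0 xy; have y0 := le_trans x0 xy.
  by apply: lerD; rewrite ler_wpM2l ?(ltW e0)// lerXn2r.
(* The truncated sector is contained in the disc of radius 2 rho, as its half
   opening is at most pi/4. *)
pose Gmax := M (2 * rho).
have rho2 : 0 <= 2 * rho by rewrite mulr_ge0// ltW.
have Gmax0 : 0 <= Gmax by exact: M0.
pose L := (Num.truncn Gmax).+1.
have L0 : (0 < L)%N by [].
have LG : Gmax <= L%:R by rewrite ltW// truncnS_gt.
have L0R : 0 < L%:R :> R by rewrite ltr0n.
pose AB := A * expR (B * (2 * rho) ^+ q.*2).
have AB0 : 0 <= AB by rewrite mulr_ge0// expR_ge0.
exists (Num.truncn (AB / eps)).+1 => N HN P phi /andP[phi0 phim] HP H1 H2 psi psiphi.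
have N2 : 2 ^- N * AB <= eps.
  rewrite mulrC ler_pdivrMr ?exprn_gt0//.
  rewrite mulrC -ler_pdivrMr//.
  apply: (@le_trans _ _ N%:R); last by rewrite -natrX ler_nat ltnW// ltn_expl.
  by apply: ltW; apply: lt_le_trans (truncnS_gt _) _; rewrite ler_nat.
pose f0 := phi / q%:R.
have f00 : 0 < f0 by rewrite divr_gt0.
have f0m : f0 <= phimax / q%:R by rewrite ler_pM2r ?invr_gt0.
have f0p : f0 <= phi by rewrite ler_pdivrMr// ler_peMr// ltW.
have f04 : f0 < pi / 4 by lra.
pose m := tan f0.
have m0 : 0 < m.
  by rewrite divr_gt0 ?cos_gt0_pihalf ?sin_gt0_pihalf//; apply/andP; split; clear -pi0 f00 f04; lra.
have m1 : m <= 1.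
  by rewrite -(@tan_piquarter R) ltW// ltr_tan// in_itv/=; apply/andP; split; clear -pi0 f00 f04; lra.
pose GG : {poly R[i]} := (kappa * b)%:C *: 'X^(q.*2) + eps%:C *: 'X^p.
pose Q : {poly R[i]} := (Y + eps)%:C *: (1 + (L%:R^-1)%:C *: GG) ^+ L.
have GE x eta : GG.[x%:C * cis eta] = (kappa * b * x ^+ q.*2)%:C * cis (eta * (q.*2)%:R)
    + (eps * x ^+ p)%:C * cis (eta * p%:R).
  by rewrite /GG !hornerE !exprMn !cisX !rmorphM !rmorphXn !mulrA.
have QE z : normc Q.[z] = (Y + eps) * normc (1 + (L%:R^-1)%:C * GG.[z]) ^+ L.
  rewrite /Q hornerZ normcM normc_real gtr0_norm ?ltr_wpDl//; congr (_ * _).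
  by rewrite horner_exp normcX !hornerE.
have Ye : 0 < Y + eps by rewrite ltr_wpDl.
have Qlow x eta : 0 <= x -> x <= 2 * rho -> `|eta| <= f0 ->
    (Y + eps) * expR (c * M x / 2) <= normc Q.[x%:C * cis eta].
  move=> x0 xr etaf; rewrite QE ler_pM2l//.
  have McL : 0 <= c * M x <= L%:R.
    rewrite mulr_ge0 ?M0 ?(ltW c0)//= (le_trans _ LG)//.
    by rewrite (le_trans _ (Mmono _ _ x0 xr))// ler_piMl// M0.
  apply: (le_trans (expR_half_le_pow L0 McL)).
  have cM0 : 0 <= c * M x / L%:R.
    by case/andP : McL => h _; rewrite divr_ge0// ltW.
  rewrite lerXn2r ?nnegrE ?normc_ge0 ?addr_ge0//.
  apply: le_trans (ler_Re_normc _); apply: le_trans (ler_norm _).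
  rewrite GE.
  rewrite (_ : complex.Re _ = 1 + L%:R^-1 * (kappa * b * x ^+ q.*2 * cos (eta * (q.*2)%:R)
    + eps * x ^+ p * cos (eta * p%:R))); last by rewrite /=; ring.
  rewrite lerD2l mulrC ler_pM2l ?invr_gt0// /M mulrDr.
  (* Both powers of w have argument at most th in absolute value. *)
  have b1 k : (k <= p)%N -> c <= cos (eta * k%:R).
    move=> kp; apply: cE; rewrite normrM (ger0_norm (ler0n _ _)) mulrC /th.
    apply: ler_pM => //; first by rewrite ler_nat.
    exact: le_trans etaf f0m.
  apply: lerD; rewrite mulrC ler_wpM2l ?b1//.
    by rewrite mulr_ge0// exprn_ge0.
  by rewrite mulr_ge0 ?exprn_ge0 ?(ltW e0).
have Qup x eta : 0 <= x -> normc Q.[x%:C * cis eta] <= (Y + eps) * expR (M x).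
  move=> x0; rewrite QE ler_pM2l//.
  apply: le_trans (pow_le_expR L0 (M0 _ x0)).
  rewrite lerXn2r ?nnegrE ?normc_ge0 ?addr_ge0 ?divr_ge0 ?M0 ?(ltW L0R)//.
  apply: (le_trans (normcD_le _ _)).
  rewrite normc1 lerD2l normcM normc_real gtr0_norm ?invr_gt0// mulrC ler_pM2r ?invr_gt0//.
  rewrite GE (le_trans (normcD_le _ _))// !normc_polar//.
    by rewrite (mulr_ge0 kb)// exprn_ge0.
  by rewrite (mulr_ge0 (ltW e0))// exprn_ge0.
have QN x eta : 0 <= x -> x <= 2 * rho -> `|eta| <= f0 -> Q.[x%:C * cis eta] != 0.
  move=> x0 xr ef; rewrite -normc_gt0 (lt_le_trans _ (Qlow _ _ x0 xr ef))//.
  by rewrite mulr_gt0// expR_gt0.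
pose P' := P \Po 'X^q.
have P'E x eta : P'.[x%:C * cis eta] = P.[(x ^+ q)%:C * cis (eta * q%:R)].
  by rewrite horner_comp hornerXn exprMn cisX rmorphXn.
have f0q : f0 * q%:R = phi by rewrite divfK// gt_eqF.
have ray x : 0 <= x -> x <= 2 * rho -> forall eta, eta = f0 \/ eta = - f0 ->
    normc P'.[x%:C * cis eta] <= normc Q.[x%:C * cis eta].
  move=> x0 xr eta etaE.
  have ef : `|eta| <= f0 by case: etaE => ->; rewrite ?normrN gtr0_norm.
  apply: le_trans (Qlow _ _ x0 xr ef).
  have xq0 : 0 <= x ^+ q by rewrite exprn_ge0.
  have : normc P'.[x%:C * cis eta] <= Y * expR (b * (x ^+ q) ^+ 2) +
      2 ^- N * (A * expR (B * (x ^+ q) ^+ 2)).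
    rewrite P'E; case: etaE => ->; rewrite ?mulNr f0q; [exact: H1|exact: H2].
  move/le_trans; apply; rewrite -exprM muln2.
  have cM : b * x ^+ q.*2 <= c * M x / 2.
    rewrite /M mulrDr mulrDl.
    have -> : c * (kappa * b * x ^+ q.*2) / 2 = b * x ^+ q.*2.
      by rewrite /kappa; field; rewrite gt_eqF.
    by rewrite lerDl !mulr_ge0// ?exprn_ge0// ?invr_ge0 ltW.
  have : (Y + eps) * expR (b * x ^+ q.*2) <= (Y + eps) * expR (c * M x / 2).
    by rewrite ler_pM2l// ler_expR.
  apply: le_trans; rewrite mulrDl lerD2l.
  have : 2 ^- N * (A * expR (B * x ^+ q.*2)) <= eps.
    apply: le_trans N2; rewrite ler_wpM2l ?invr_ge0 ?exprn_ge0//.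
    by rewrite ler_wpM2l// ler_expR ler_wpM2l// lerXn2r// nnegrE//.
  move/le_trans; apply; rewrite ler_peMr ?(ltW e0)// -expR0 ler_expR.
  by rewrite mulr_ge0// exprn_ge0.
have f0pi : 0 < f0 < pi / 2 by rewrite f00/=; lra.
have far (w : R[i]) x eta : 0 <= x -> x <= 2 * rho -> `|eta| <= f0 ->
    w = x%:C * cis eta -> rho <= x -> normc P'.[w] <= normc Q.[w].
  move=> x0 xr ef -> rx; apply: le_trans (Qlow _ _ x0 xr ef).
  rewrite P'E (le_trans (HP _))// normc_polar ?exprn_ge0// -exprM muln2.
  apply: (@le_trans _ _ AB).
    by rewrite /AB ler_wpM2l// ler_expR ler_wpM2l// lerXn2r// nnegrE//.
  apply: (le_trans Hr); apply: ler_pM; rewrite ?expR_ge0 ?(ltW e0)//.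
    by rewrite lerDr.
  rewrite ler_expR ler_pM2r ?invr_gt0// -mulrA.
  rewrite [leLHS]mulrCA ler_pM2l//.
  rewrite /M (le_trans (_ : _ <= eps * x ^+ p))//.
    by rewrite ler_pM2l// lerXn2r// nnegrE// ltW.
  by rewrite lerDr mulr_ge0// exprn_ge0.
have inK (w : R * R) : cone m rho w -> exists x eta, [/\ 0 <= x, x <= 2 * rho, `|eta| <= f0,
     pairC w = x%:C * cis eta & `|w.2| = m * w.1 -> eta = f0 \/ eta = - f0].
  move=> [w1 w2]; have [x [eta [x0 ef wE etaE]]] := cone_polar f0pi w1.
  exists x, eta; split => //.
  have a0 : 0 <= w.1 by rewrite -(pmulr_rge0 _ m0) (le_trans _ w1).
  have -> : x = normc (pairC w) by rewrite [pairC w]wE normc_polar.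
  rewrite -[leRHS]ger0_norm// -(sqrtr_sqr (2 * rho)) normc_ReIm ler_wsqrtr//=.
  have h2 : w.2 ^+ 2 <= w.1 ^+ 2.
    rewrite -(real_normK (num_real w.2)) lerXn2r ?nnegrE//.
    by rewrite (le_trans w1)// ler_piMl.
  have h1 : w.1 ^+ 2 <= rho ^+ 2 by rewrite lerXn2r ?nnegrE// ltW.
  have := sqr_ge0 rho; rewrite exprMn; lra.
have Ktarget : cone m rho (s * cos (psi / q%:R), s * sin (psi / q%:R)).
  set e := psi / q%:R.
  have : `|e| <= f0 by rewrite /e normrM normfV (gtr0_norm q0R) ler_pM2r ?invr_gt0.
  rewrite ler_norml => /andP[e1 e2].
  have cf0 : 0 < cos f0 by apply: cos_gt0_pihalf; apply/andP; split; clear -pi0 f00 f04; lra.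
  have s1 : 0 <= sin (f0 - e).
    by apply: sin_ge0_pi; apply/andP; split; clear -pi0 f00 f04 e1 e2; lra.
  have s2 : 0 <= sin (f0 + e).
    by apply: sin_ge0_pi; apply/andP; split; clear -pi0 f00 f04 e1 e2; lra.
  rewrite sinB in s1; rewrite sinD in s2.
  split => /=; last by rewrite (le_trans _ (ltW sr))// ler_piMr ?cos_le1// ltW.
  rewrite normrM (gtr0_norm s0) mulrCA ler_pM2l// /m /tan mulrAC ler_pdivlMr//.
  rewrite -{1}(gtr0_norm cf0) -normrM ler_norml.
  by apply/andP; split; clear -s1 s2; lra.
have main : forall w, cone m rho w -> normc P'.[pairC w] <= normc Q.[pairC w].
  apply: poly_maximum_principle => //; first exact: compact_cone.
  - by move=> w /inK[x [eta [x0 xr ef -> _]]]; exact: QN.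
  - exists (0, 0); first by split; rewrite /= ?normr0 ?mulr0 ?(ltW r0).
    have -> : pairC (0, 0) = 0%:C * cis f0 :> R[i] by rewrite rmorph0 mul0r.
    by apply: ray => //; left.
  - move=> w Kw; have [x [eta [x0 xr ef wE etaE]]] := inK w Kw.
    have [w2|w2] := eqVneq `|w.2| (m * w.1).
      by right; rewrite wE; apply: ray => //; exact: etaE.
    have [w1|w1] := eqVneq w.1 rho.
      right; apply: (far _ x eta) => //.
      have -> : x = normc (pairC w) by rewrite wE normc_polar.
      by rewrite -w1 (le_trans (ler_norm _))// -[w.1]/(complex.Re (pairC w)) ler_Re_normc.
    by left; case: Kw => h1 h2; apply: cone_interior; rewrite lt_neqAle ?w2 ?w1.
have := main _ Ktarget.
have -> : pairC (s * cos (psi / q%:R), s * sin (psi / q%:R)) = s%:C * cis (psi / q%:R).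
  by congr Complex => /=; ring.
rewrite P'E sq divfK ?gt_eqF// => /le_trans; apply.
apply: (le_trans (Qup _ _ (ltW s0))).
by rewrite /M -mul2n mulnC exprM sq.
Qed.

End Sector.

(** * Coefficients of an entire function bounded on a fan of lines *)

Section Coefficients.
Variable R : realType.

Lemma cis_eq1 (t : R) : `|t| < pi *+ 2 -> cis t = 1 -> t = 0.
Proof.
move=> t2 /(congr1 (@complex.Re R)) /=; set h := `|t| / 2.
rewrite -cos_norm (_ : `|t| = h *+ 2); last by rewrite /h -mulr_natr divfK.
rewrite cos_mulr2n cos2sin2 => /eqP; rewrite mulrnBl.
rewrite -subr_eq0 (_ : _ - 1 = - (sin h ^+ 2 *+ 2)); last by ring.
rewrite oppr_eq0 mulrn_eq0/= sqrf_eq0 => /eqP sh.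
apply/eqP; rewrite -normr_eq0; apply/negPn/negP => tn.
have : 0 < sin h.
  apply: sin_gt0_pi; rewrite divr_gt0 ?[0 < `|t|]lt_def ?tn//=.
  by rewrite ltr_pdivrMr// mulr_natr.
by rewrite sh ltxx.
Qed.

(** Cauchy's inequality for polynomials, with an average over roots of unity
    instead of an integral over the circle. *)
Lemma coef_le_sup_circle (P : {poly R[i]}) (S T : R) : 0 < S ->
  (forall psi, normc P.[S%:C * cis psi] <= T) ->
  forall n, normc P`_n * S ^+ n <= T.
Proof.
move=> S0 PT n.
pose N := (maxn (size P) n.+1).
have N0 : (0 < N)%N by rewrite leq_max orbT.
have N0R : 0 < N%:R :> R by rewrite ltr0n.
pose om (j : nat) : R[i] := cis (pi *+ 2 * j%:R / N%:R).
(* The n-th coefficient is a Fourier coefficient of P over the N-th roots of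
   unity, as N exceeds n and the degree of P. *)
have sumE : \sum_(k < N) P.[S%:C * om k] * cis (- (pi *+ 2 * (k * n)%:R / N%:R)) =
    N%:R * (P`_n * S%:C ^+ n).
  transitivity (\sum_(j < N) \sum_(k < N) P`_j * S%:C ^+ j *
     cis (pi *+ 2 * (j%:R - n%:R) / N%:R) ^+ k).
    rewrite exchange_big; apply: eq_bigr => k _ /=.
    rewrite (horner_coef_wide _ (leq_maxl _ n.+1)) mulr_suml.
    apply: eq_bigr => j _; rewrite exprMn /om !cisX -!mulrA; do 2 congr (_ * _).
    rewrite -cisD; congr cis; rewrite natrM; field.
    by rewrite gt_eqF.
  have nN : (n < N)%N by rewrite leq_max leqnn orbT.
  rewrite (bigD1 (Ordinal nN))//= [X in _ + X]big1 ?addr0 => [|j jn].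
    rewrite subrr mulr0 mul0r cis0 (eq_bigr (fun _ => P`_n * S%:C ^+ n)); last first.
      by move=> k _; rewrite expr1n mulr1.
    by rewrite sumr_const card_ord mulr_natl.
  rewrite -mulr_sumr; set x := cis _.
  have pi20 : 0 < pi *+ 2 :> R by rewrite pmulrn_lgt0// pi_gt0.
  have x1 : x != 1.
    apply/eqP => /cis_eq1 h; move: jn; rewrite -val_eqE/=.
    have : pi *+ 2 * (j%:R - n%:R) / N%:R = 0 :> R.
      apply: h; rewrite !normrM normfV (gtr0_norm N0R) ltr_pdivrMr//.
      rewrite (gtr0_norm pi20) ltr_pM2l//.
      have jN := ltn_ord j.
      rewrite ltr_norml -(ltr_nat R) in jN *; move: nN; rewrite -(ltr_nat R).
      have := ler0n R j; have := ler0n R n.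
      by move=> a b c; apply/andP; split; lra.
    move/eqP; rewrite !mulf_eq0 invr_eq0 (gt_eqF N0R) orbF (gt_eqF pi20)/=.
    by rewrite subr_eq0 eqr_nat => /eqP ->; rewrite eqxx.
  have : (x - 1) * \sum_(k < N) x ^+ k = 0.
    rewrite -subrX1 cisX divfK ?gt_eqF//.
    have -> : cis (pi *+ 2 * (j%:R - n%:R)) = (cis (pi *+ 2)) ^+ j * (cis (- (pi *+ 2))) ^+ n :> R[i].
      by rewrite !cisX -cisD; congr cis; ring.
    have -> : cis (pi *+ 2) = 1 :> R[i] by rewrite /cis cos2pi sin2pi.
    have -> : cis (- (pi *+ 2)) = 1 :> R[i] by rewrite /cis cosN sinN cos2pi sin2pi oppr0.
    by rewrite !expr1n mulr1 subrr.
  by move/eqP; rewrite mulf_eq0 subr_eq0 (negPf x1)/= => /eqP ->; rewrite mulr0.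
have : normc (N%:R * (P`_n * S%:C ^+ n)) <= N%:R * T.
  rewrite -sumE (le_trans (normc_sum _ _ _))//.
  rewrite (le_trans (ler_sum (G := fun _ => T) _ _))//; last first.
    by rewrite sumr_const card_ord mulr_natl.
  by move=> k _; rewrite normcM normc_cis mulr1; exact: PT.
rewrite !normcM normcX normc_real (gtr0_norm S0) (_ : normc N%:R = N%:R).
  by rewrite ler_pM2l.
by rewrite -[N%:R in LHS](rmorph_nat (real_complex R)) normc_real ger0_norm.
Qed.

(** The points k u with 0 <= k u < 2, translated by all even integers, leave
    no gap longer than u: the point following the last one is a translate of 0. *)
Lemma lattice_gap (u y : R) : 0 < u -> exists y1 y2,
  [/\ y1 < y2, y1 <= y <= y2, y2 - y1 <= u,
   exists k j : int, 0 <= k%:~R * u < 2 /\ y1 = k%:~R * u + 2 * j%:~R &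
   exists k j : int, 0 <= k%:~R * u < 2 /\ y2 = k%:~R * u + 2 * j%:~R].
Proof.
move=> u0; pose j := Num.floor (y / 2).
have /andP[j1 j2] := floor_itv (y / 2).
rewrite -/j intrD in j1 j2.
pose y' := y - 2 * j%:~R.
have y'0 : 0 <= y' by rewrite /y'; lra.
have y'2 : y' < 2 by rewrite /y'; lra.
pose k := Num.floor (y' / u).
have /andP[k1 k2] := floor_itv (y' / u).
rewrite -/k in k1 k2.
rewrite ler_pdivlMr// in k1; rewrite ltr_pdivrMr// in k2.
have k0 : 0 <= k%:~R * u.
  by rewrite mulr_ge0 ?(ltW u0)// ler0z floor_ge0 divr_ge0// ltW.
have k2' : k%:~R * u < 2 by exact: le_lt_trans y'2.
have kj1 : exists k0 j0 : int, 0 <= k0%:~R * u < 2 /\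
    k%:~R * u + 2 * j%:~R = k0%:~R * u + 2 * j0%:~R.
  by exists k, j; rewrite k0 k2'.
have kS : (k + 1)%:~R * u = k%:~R * u + u by rewrite intrD mulrDl mul1r.
rewrite kS in k2.
have [h|h] := ltP ((k + 1)%:~R * u) 2.
  exists (k%:~R * u + 2 * j%:~R), ((k + 1)%:~R * u + 2 * j%:~R).
  rewrite kS; split => //; [lra|rewrite /y' in k1 k2; lra|lra|].
  by exists (k + 1), j; rewrite h kS; split => //; rewrite andbT; lra.
rewrite kS in h.
exists (k%:~R * u + 2 * j%:~R), (2 * (j + 1)%:~R).
rewrite intrD; split => //; [lra|rewrite /y' in k1 y'2; lra|lra|].
by exists 0, (j + 1); rewrite intrD mul0r add0r; split => //; apply/andP; split; lra.
Qed.

(** Even translates of the order t correspond to the same line, possibly with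
    the opposite orientation. *)
Lemma cis_pi_int (j : int) : exists b : bool, cis (- (pi * j%:~R)) = ((-1) ^+ b)%:C :> R[i].
Proof.
have h (n : nat) : cis (pi * n%:R) = ((-1) ^+ odd n)%:C :> R[i].
  by rewrite -cisX cis_pi rmorphXn rmorphN1 signr_odd.
case: j => n.
  exists (odd n); have /(congr1 (@conjc R)) := h n.
  by rewrite conjc_real => <-; rewrite /cis cosN sinN.
exists (odd n.+1).
by rewrite NegzE rmorphN mulrN opprK h.
Qed.

(** The lines of directions exp(-i pi (t0 + k u) / 2) cut the plane into sectors
    of opening at most pi u / 2 < pi / 2. On each of them [sector_bound] applies
    to the partial sums of the entire function, so that a bound on these lines
    becomes a bound on the whole circle of radius S. *)
Lemma coef_bound_of_lattice (u : R) : 0 < u < 1 ->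
  exists2 kappa : R, 0 < kappa &
  forall (t0 : R) (a : nat -> R[i]) (A B Y b : R),
    0 <= A -> 0 <= B -> 0 <= Y -> 0 <= b ->
    (forall N z, normc (\sum_(n < N) a n * z ^+ n) <= A * expR (B * normc z ^+ 2)) ->
    (forall k : int, 0 <= k%:~R * u < 2 -> forall N x,
       normc (\sum_(n < N) a n * (x%:C * cis (- (pi / 2 * (t0 + k%:~R * u)))) ^+ n)
       <= Y * expR (b * x ^+ 2) + 2 ^- N * (A * expR (B * x ^+ 2))) ->
  forall n (S : R), 0 < S -> normc (a n) * S ^+ n <= Y * expR (kappa * b * S ^+ 2).
Proof.
move=> /andP[u0 u1].
have pi0 := pi_gt0 R.
have pm : 0 < pi / 4 * u < pi / 4.
  by rewrite mulr_gt0 ?divr_gt0//= gtr_pMr ?divr_gt0.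
have [kappa k0 Hk] := sector_bound pm.
exists kappa => // t0 a A B Y b A0 B0 Y0 b0 H1 H2 n S S0.
apply/ler_addgt0Pr => delta d0.
have [N0 HN0] := Hk A B Y b S delta A0 B0 Y0 b0 S0 d0.
pose N := maxn N0 n.+1.
pose F := \poly_(k < N) a k.
have FE z : F.[z] = \sum_(k < N) a k * z ^+ k by rewrite horner_poly.
have <- : F`_n = a n by rewrite coef_poly leq_max leqnn orbT.
apply: coef_le_sup_circle => // psi.
(* In the parametrization of the lines by orders, psi corresponds to t0 + y. *)
pose y := - (psi * 2 / pi) - t0.
have [y1 [y2 [y12 /andP[yy1 yy2] y21 g1 g2]]] := lattice_gap y u0.
have good z : (exists k j : int, 0 <= k%:~R * u < 2 /\ z = k%:~R * u + 2 * j%:~R) ->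
  forall x, normc F.[x%:C * cis (- (pi / 2 * (t0 + z)))] <=
      Y * expR (b * x ^+ 2) + 2 ^- N * (A * expR (B * x ^+ 2)).
  move=> [k [j [kj ->]]] x.
  have [bb Eb] := cis_pi_int j.
  rewrite (_ : cis _ = cis (- (pi / 2 * (t0 + k%:~R * u))) * cis (- (pi * j%:~R))); last first.
    by rewrite -cisD; congr cis; lra.
  rewrite Eb mulrA mulrAC -rmorphM/= FE.
  by have := H2 k kj N (x * (-1) ^+ bb); rewrite exprMn -[(_ ^+ bb) ^+ 2]exprM mulnC exprM sqrrN !expr1n mulr1.
(* The sector between the lines y1 and y2 is rotated so that its bisector
   becomes the positive real axis. *)
pose mu := - (pi / 2 * (t0 + (y1 + y2) / 2)).
pose P := F \Po (cis mu *: 'X).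
have PE z : P.[z] = F.[cis mu * z] by rewrite horner_comp !hornerE.
pose phi := pi / 4 * (y2 - y1).
have phiP : 0 < phi <= pi / 4 * u.
  by rewrite mulr_gt0 ?divr_gt0 ?subr_gt0//= ler_pM2l ?divr_gt0.
have := HN0 N (leq_maxl _ _) P phi phiP.
move=> /(_ _ _ _ (psi - mu)).
rewrite PE (_ : cis mu * _ = S%:C * cis psi); last first.
  by rewrite mulrCA -cisD addrC subrK.
apply.
- by move=> z; rewrite PE FE (le_trans (H1 _ _))// normcM normc_cis mul1r.
- move=> x x0; rewrite PE mulrCA -cisD (_ : mu + phi = - (pi / 2 * (t0 + y1))); last first.
    by rewrite /mu /phi; lra.
  exact: good.
- move=> x x0; rewrite PE mulrCA -cisD (_ : mu - phi = - (pi / 2 * (t0 + y2))); last first.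
    by rewrite /mu /phi; lra.
  exact: good.
- have yE p : 0 < p -> psi = - (p / 2 * (t0 + (- (psi * 2 / p) - t0))).
    by move=> p0; field; rewrite gt_eqF.
  have -> : psi = - (pi / 2 * (t0 + y)) by exact: yE.
  rewrite (_ : _ - mu = pi / 2 * ((y1 + y2) / 2 - y)); last by rewrite /mu; lra.
  rewrite normrM gtr0_norm ?divr_gt0// /phi.
  rewrite (_ : pi / 4 * (y2 - y1) = pi / 2 * ((y2 - y1) / 2)); last by lra.
  by rewrite ler_pM2l ?divr_gt0// ler_norml; apply/andP; split; lra.
Qed.

End Coefficients.

(** * Hermite polynomials *)

Section HermitePolynomials.
Variable R : realType.

(** Two consecutive polynomials are computed together, as the recurrence has
    two terms. *)
Fixpoint hpoly2 (n : nat) : {poly R} * {poly R} :=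
  if n is m.+1 then
    let: (p, q) := hpoly2 m in (q, 'X * q *+ 2 - p *+ (2 * m.+1))
  else (1, 'X *+ 2).

Definition hpoly n := (hpoly2 n).1.

Lemma hpoly0 : hpoly 0 = 1. Proof. by []. Qed.

Lemma hpoly1 : hpoly 1 = 'X *+ 2. Proof. by []. Qed.

Lemma hpolySS n : hpoly n.+2 = 'X * hpoly n.+1 *+ 2 - hpoly n *+ (2 * n.+1).
Proof. by rewrite /hpoly /=; case: (hpoly2 n). Qed.

Lemma deriv_hpoly n : (hpoly n.+1)^`() = hpoly n *+ (2 * n.+1).
Proof.
suff : (hpoly n.+1)^`() = hpoly n *+ (2 * n.+1) /\
       (hpoly n.+2)^`() = hpoly n.+1 *+ (2 * n.+2) by case.
elim: n => [|n [IH1 IH2]].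
  rewrite hpolySS hpoly1 hpoly0 !(derivB, derivMn, derivM, derivX, derivC).
  by split; [done|ring].
split=> //; rewrite [in LHS]hpolySS !(derivB, derivMn, derivM, derivX) IH1 IH2.
rewrite (hpolySS n); ring.
Qed.

Lemma hpolyS n : hpoly n.+1 = 'X * hpoly n *+ 2 - (hpoly n)^`().
Proof.
case: n => [|n]; first by rewrite hpoly1 hpoly0 derivC subr0 mulr1.
by rewrite deriv_hpoly hpolySS.
Qed.

(** The n-th derivative of exp(-x^2). *)
Definition gaussD n (x : R) : R := (-1) ^+ n * (hpoly n).[x] * expR (- x ^+ 2).

Lemma is_derive_gaussD n (x : R) : is_derive x (1 : R) (gaussD n) (gaussD n.+1 x).
Proof.
rewrite /gaussD; apply: is_derive_eq.
have -> : (hpoly n.+1).[x] = 2 * x * (hpoly n).[x] - (hpoly n)^`().[x].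
  by rewrite hpolyS !hornerE; ring.
rewrite [(-1) ^+ _.+1]exprS; set a := (hpoly n).[x]; set a' := (_^`()).[x]; set e := expR _.
change ((-1) ^+ n * a * (e * - (x * 1 + x * 1)) + e * ((-1) ^+ n * a') =
  -1 * (-1) ^+ n * (2 * x * a - a') * e); ring.
Qed.

(** The Hermite polynomials that are orthonormal for exp(-x^2) dx. *)
Definition hp n (x : R) : R :=
  pi `^ (- (1 / 4)) * (Num.sqrt (2 ^+ n * n`!%:R))^-1 * (hpoly n).[x].

Lemma hp0 x : hp 0 x = pi `^ (- (1 / 4)).
Proof. by rewrite /hp hpoly0 hornerC expr0 fact0 !mulr1 sqrtr1 invr1 mulr1. Qed.

Lemma sqrt_norm_succ n : Num.sqrt (2 ^+ n.+1 * n.+1`!%:R) =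
  Num.sqrt 2 * Num.sqrt n.+1%:R * Num.sqrt (2 ^+ n * n`!%:R) :> R.
Proof.
rewrite -!sqrtrM ?mulr_ge0 ?exprn_ge0//; congr Num.sqrt.
by rewrite exprS factS natrM; ring.
Qed.

Lemma sqrt_norm_gt0 n : 0 < Num.sqrt (2 ^+ n * n`!%:R) :> R.
Proof. by rewrite sqrtr_gt0 mulr_gt0 ?exprn_gt0// ltr0n fact_gt0. Qed.

Lemma hp1 x : hp 1 x = Num.sqrt 2 * x * hp 0 x.
Proof.
rewrite /hp sqrt_norm_succ sqrtr1 mulr1 hpoly1 hpoly0.
have s2 : Num.sqrt 2 != 0 :> R by rewrite gt_eqF// sqrtr_gt0.
have ss := sqrt_norm_gt0 0; set s := Num.sqrt (_ * _) in ss *.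
rewrite hornerMn hornerX hornerC.
have -> : x *+ 2 = Num.sqrt 2 ^+ 2 * x by rewrite sqr_sqrtr//; ring.
by field; rewrite s2 gt_eqF.
Qed.

Lemma hp_rec n x : Num.sqrt n.+2%:R * hp n.+2 x =
  Num.sqrt 2 * x * hp n.+1 x - Num.sqrt n.+1%:R * hp n x.
Proof.
rewrite /hp hpolySS !sqrt_norm_succ.
have s2 : Num.sqrt 2 != 0 :> R by rewrite gt_eqF// sqrtr_gt0.
have sn : Num.sqrt n.+2%:R != 0 :> R by rewrite gt_eqF// sqrtr_gt0.
have sm : Num.sqrt n.+1%:R != 0 :> R by rewrite gt_eqF// sqrtr_gt0.
have /lt0r_neq0 ss := sqrt_norm_gt0 n; set s := Num.sqrt (_ * _) in ss *.
have e2 : Num.sqrt 2 ^+ 2 = 2 :> R by rewrite sqr_sqrtr.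
have en : Num.sqrt n.+1%:R ^+ 2 = n.+1%:R :> R by rewrite sqr_sqrtr.
rewrite mulrnA hornerD hornerN !hornerMn hornerM hornerX.
set a := Num.sqrt 2 in s2 e2 *; set b := Num.sqrt n.+1%:R in sm en *.
set h := (hpoly n).[x]; set h' := (hpoly n.+1).[x].
rewrite (_ : x * h' *+ 2 = a ^+ 2 * (x * h')); last by rewrite e2; ring.
rewrite (_ : h *+ 2 *+ n.+1 = a ^+ 2 * b ^+ 2 * h); last first.
  by rewrite e2 en -[LHS]mulr_natr -[h *+ 2]mulr_natl mulrAC.
by field; rewrite s2 sn sm ss.
Qed.

(** If x <= sqrt n, each factor is at most exp(x / sqrt(k+1)) and the sum of the
    1 / sqrt(k+1) is at most 2 sqrt n, whence the bound exp(2n). Otherwise every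
    factor is at most 2 x / sqrt(k+1). *)
Lemma prod_bracket_sqrt_le n (x : R) : 0 <= x ->
  \prod_(k < n) (1 + x / Num.sqrt k.+1%:R) <=
  expR 2 ^+ n * (1 + x ^+ n / Num.sqrt n`!%:R).
Proof.
move=> x0.
have sgt k : 0 < Num.sqrt k.+1%:R :> R by rewrite sqrtr_gt0.
have fgt k : 0 < Num.sqrt k`!%:R :> R by rewrite sqrtr_gt0 ltr0n fact_gt0.
have [xn|xn] := leP x (Num.sqrt n%:R).
- have sumS : forall m, \sum_(k < m) (Num.sqrt k.+1%:R)^-1 <= 2 * Num.sqrt m%:R :> R.
    elim=> [|m IH]; first by rewrite big_ord0 mulr_ge0// sqrtr_ge0.
    rewrite big_ord_recr/= (le_trans (lerD IH (lexx _)))//.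
    set a := Num.sqrt m.+1%:R; set b := Num.sqrt m%:R.
    have a0 : 0 < a := sgt m.
    have b0 : 0 <= b by rewrite sqrtr_ge0.
    have ab : a ^+ 2 = b ^+ 2 + 1 by rewrite !sqr_sqrtr// -natr1.
    rewrite -lerBrDl -(ler_pM2r a0) mulVf ?gt_eqF//; nra.
  apply: (@le_trans _ _ (expR (\sum_(k < n) x / Num.sqrt k.+1%:R))).
    rewrite expR_sum; apply: ler_prod => k _.
    by rewrite expR_ge1Dx addr_ge0// divr_ge0// ltW.
  rewrite -mulr_sumr (@le_trans _ _ (expR 2 ^+ n))//; last first.
    by rewrite ler_peMr ?exprn_ge0 ?expR_ge0// lerDl divr_ge0 ?exprn_ge0// ltW.
  rewrite -expRM_natr ler_expR.
  have h := sumS n.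
  have n0 : 0 <= Num.sqrt n%:R :> R by rewrite sqrtr_ge0.
  have nE : Num.sqrt n%:R ^+ 2 = n%:R :> R by rewrite sqr_sqrtr.
  apply: (le_trans (ler_wpM2l x0 h)); rewrite -[in leRHS]nE expr2 mulrCA ler_pM2l//.
  by rewrite ler_wpM2r.
- have step : forall m, (m <= n)%N -> \prod_(k < m) (1 + x / Num.sqrt k.+1%:R) <=
     2 ^+ m * (x ^+ m / Num.sqrt m`!%:R).
    elim=> [|m IH] mn; first by rewrite big_ord0 !expr0 fact0 sqrtr1 invr1 !mulr1.
    rewrite big_ord_recr/=.
    rewrite (_ : 2 ^+ m.+1 * _ = 2 ^+ m * (x ^+ m / Num.sqrt m`!%:R) *
        (2 * (x / Num.sqrt m.+1%:R))); last first.
      rewrite factS natrM sqrtrM// !exprS; field.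
      by rewrite !gt_eqF.
    apply: ler_pM => //.
    + by apply: prodr_ge0 => k _; rewrite addr_ge0// divr_ge0// ltW.
    + by rewrite addr_ge0// divr_ge0// ltW.
    + exact: IH (ltnW mn).
    + rewrite mulr2n mulrDl mul1r lerD2r ler_pdivlMr// mul1r.
      by rewrite (le_trans _ (ltW xn))// ler_wsqrtr// ler_nat.
  apply: (le_trans (step n (leqnn n))); apply: ler_pM.
  + by rewrite exprn_ge0.
  + by rewrite divr_ge0 ?exprn_ge0// ltW.
  + rewrite lerXn2r ?nnegrE ?expR_ge0//.
    by apply: le_trans (expR_ge1Dx _); rewrite lerDr.
  + by rewrite lerDr.
Qed.

Lemma pi_powR_le1 : pi `^ (- (1 / 4)) <= 1 :> R.
Proof.
rewrite powRN invf_le1 ?powR_gt0 ?pi_gt0//.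
rewrite -[leLHS](powRr0 pi) ler_powR ?divr_ge0//.
by rewrite (le_trans _ (pi_ge2 R))// ler1n.
Qed.

(** The geometric rate in the bounds for the Hermite polynomials. *)
Definition Kh : R := 2 * expR 2.

Lemma Kh_ge1 : 1 <= Kh.
Proof.
rewrite /Kh; have := expR_ge1Dx (2 : R); lra.
Qed.

(** The recurrence propagates the bound by the product of the factors
    2 (1 + |x| / sqrt k), which is then simplified by [prod_bracket_sqrt_le]. *)
Lemma hp_bound n x : `|hp n x| <= Kh ^+ n * (1 + `|x| ^+ n / Num.sqrt n`!%:R).
Proof.
apply: (@le_trans _ _ (2 ^+ n * \prod_(k < n) (1 + `|x| / Num.sqrt k.+1%:R))); last first.
  by rewrite exprMn -mulrA ler_pM2l ?exprn_gt0// prod_bracket_sqrt_le.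
have sgt k : 0 < Num.sqrt k.+1%:R :> R by rewrite sqrtr_gt0.
have f1 (k : nat) : 1 <= 1 + `|x| / Num.sqrt k.+1%:R.
  by rewrite lerDl divr_ge0// ltW.
pose b n := 2 ^+ n * \prod_(k < n) (1 + `|x| / Num.sqrt k.+1%:R).
rewrite -/(b n).
have b0 m : 0 <= b m.
  by rewrite mulr_ge0 ?exprn_ge0// prodr_ge0// => k _; rewrite (le_trans _ (f1 _)).
have bS m : b m.+1 = 2 * (1 + `|x| / Num.sqrt m.+1%:R) * b m.
  by rewrite /b big_ord_recr exprS/=; ring.
have s2 : Num.sqrt 2 <= 2 :> R.
  by rewrite -[leRHS]ger0_norm// -sqrtr_sqr ler_wsqrtr// expr2; lra.
have s20 : 0 <= Num.sqrt 2 :> R by rewrite sqrtr_ge0.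
suff : `|hp n x| <= b n /\ `|hp n.+1 x| <= b n.+1 by case.
elim: n => [|n [IH1 IH2]]; last split=> //.
  have h0 : `|hp 0 x| <= b 0.
    by rewrite hp0 /b big_ord0 expr0 mulr1 ger0_norm ?powR_ge0// pi_powR_le1.
  split=> //; rewrite hp1 bS normrM sqrtr1 divr1.
  apply: ler_pM => //; rewrite normrM (ger0_norm s20).
  have := normr_ge0 x; nra.
have sn := sgt n.+1.
rewrite -(ler_pM2l sn) -{1}(gtr0_norm sn) -normrM hp_rec.
move: (hp n.+1 x) (hp n x) IH2 IH1 => h2 h1 IH2 IH1.
rewrite (le_trans (ler_normB _ _))//.
rewrite !normrM (ger0_norm s20) (gtr0_norm (sgt n)).
have sn1 : Num.sqrt n.+1%:R <= Num.sqrt n.+2%:R :> R by rewrite ler_wsqrtr// ler_nat.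
have bb : 2 * b n <= b n.+1.
  by rewrite bS ler_wpM2r// ler_peMr.
rewrite (bS n.+1).
have -> : Num.sqrt n.+2%:R * (2 * (1 + `|x| / Num.sqrt n.+2%:R) * b n.+1) =
   2 * (Num.sqrt n.+2%:R + `|x|) * b n.+1 by field; rewrite gt_eqF.
apply: (@le_trans _ _ (2 * `|x| * b n.+1 + Num.sqrt n.+2%:R * b n.+1)).
  apply: lerD; apply: ler_pM => //; rewrite ?mulr_ge0 ?sqrtr_ge0//.
    by rewrite ler_wpM2r.
  by rewrite (le_trans IH1)// (le_trans _ bb)// ler_peMl// ler1n.
rewrite -mulrDl ler_wpM2r// mulrDr addrC lerD2r ler_peMl ?ler1n// ltW.
Qed.

End HermitePolynomials.

(** * Power series of infinite radius of convergence *)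

Section PowerSeries.
Variable R : realType.
Implicit Types (c : R ^nat) (x y : R).

Lemma pow_fact_le_expR (t : R) n : 0 <= t -> t ^+ n / n`!%:R <= expR t.
Proof.
case: n => [|n] t0; first by rewrite expr0 fact0 divr1 -expR0 ler_expR.
by apply: le_trans (expR_ge1Dxn n t0); rewrite lerDr.
Qed.

Lemma sqrt_fact_gt0 n : 0 < Num.sqrt n`!%:R :> R.
Proof. by rewrite sqrtr_gt0 ltr0n fact_gt0. Qed.

Lemma pow_sqrt_fact_le_expR (t : R) n : 0 <= t ->
  t ^+ n / Num.sqrt n`!%:R <= expR (t ^+ 2 / 2).
Proof.
move=> t0; rewrite -(@ler_pXn2r _ 2)// ?nnegrE ?expR_ge0//; last first.
  by rewrite divr_ge0 ?exprn_ge0// ltW// sqrt_fact_gt0.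
rewrite -expRM_natr divfK// exprMn exprVn sqr_sqrtr// -exprM mulnC exprM.
by rewrite pow_fact_le_expR// sqr_ge0.
Qed.

(** The factor 2^-n, obtained by doubling t, makes the sums over n and their
    tails explicit. *)
Lemma pow_sqrt_fact_geom (t : R) n : 0 <= t ->
  t ^+ n / Num.sqrt n`!%:R <= 2 ^- n * expR (2 * t ^+ 2).
Proof.
move=> t0; have := @pow_sqrt_fact_le_expR (2 * t) n.
rewrite mulr_ge0// => /(_ isT); rewrite exprMn -mulrA mulrC -ler_pdivlMr ?exprn_gt0//.
move=> /le_trans; apply; rewrite mulrC ler_pM2l ?invr_gt0 ?exprn_gt0// ler_expR.
by rewrite exprMn; lra.
Qed.

Lemma sum_geom_half (N M : nat) : \sum_(N <= n < M) 2 ^- n <= 2 * 2 ^- N :> R.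
Proof.
have [MN|/ltnW NM] := leqP M N.
  by rewrite big_geq// mulr_ge0// invr_ge0 exprn_ge0.
have -> : \sum_(N <= n < M) 2 ^- n = 2 * 2 ^- N - 2 * 2 ^- M :> R.
  elim: M NM => [|M IH]; first by rewrite leqn0 => /eqP ->; rewrite big_geq// subrr.
  rewrite leq_eqVlt => /predU1P[->|]; first by rewrite big_geq// subrr.
  rewrite ltnS => NM; rewrite big_nat_recr//= IH// exprS.
  by field; rewrite ?expf_neq0 ?pnatr_eq0.
by rewrite gerBl mulr_ge0// invr_ge0 exprn_ge0.
Qed.

(** An infinite radius of convergence, in a form that gives at once absolute
    convergence with geometric tails. *)
Definition entire c := forall x, exists C, forall n, `|c n * x ^+ n| <= C * 2 ^- n.

Lemma entire_cvg c x : entire c -> cvgn (pseries c x).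
Proof.
move=> /(_ x)[C HC]; apply: normed_cvg.
have C0 : 0 <= C.
  by have := le_trans (normr_ge0 _) (HC 0); rewrite [2 ^+ 0]expr0 invr1 mulr1.
apply: (@series_le_cvg _ _ (geometric C 2^-1)) => [n|n|n|].
- exact: normr_ge0.
- by rewrite /= mulr_ge0// exprn_ge0.
- by rewrite /= exprVn HC.
- by apply: is_cvg_geometric_series; rewrite ger0_norm//; lra.
Qed.

Lemma entire_diffs c : entire c -> entire (pseries_diffs c).
Proof.
move=> ec x; pose X := 1 + `|x|.
have X1 : 1 <= X by rewrite lerDl.
have [C HC] := ec (2 * X).
have C0 : 0 <= C.
  by have := le_trans (normr_ge0 _) (HC 0); rewrite [2 ^+ 0]expr0 invr1 mulr1.
exists C => n; rewrite /pseries_diffs normrM normrX.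
have xX : `|x| ^+ n <= X ^+ n.+1.
  apply: (@le_trans _ _ (X ^+ n)); first by rewrite lerXn2r ?nnegrE ?lerDr// (le_trans _ X1).
  by rewrite ler_weXn2l.
apply: le_trans (ler_wpM2l (normr_ge0 _) xX) _.
have := HC n.+1; rewrite normrM normrX (ger0_norm (mulr_ge0 _ (le_trans ler01 X1)))// exprMn.
rewrite normrM normr_nat => h.
have n2 : n.+1%:R <= 2 ^+ n.+1 :> R by rewrite -natrX ler_nat ltnW// ltn_expl.
have p2 : 0 < 2 ^+ n.+1 :> R by rewrite exprn_gt0.
apply: (@le_trans _ _ (2 ^+ n.+1 * `|c n.+1| * X ^+ n.+1)).
  by rewrite ler_wpM2r ?exprn_ge0 ?(le_trans ler01 X1)// ler_wpM2r.
rewrite [_ * `|c _|]mulrC -mulrA; apply: (le_trans h).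
by rewrite ler_wpM2l// lef_pV2 ?posrE ?exprn_gt0// ler_weXn2l// ler1n.
Qed.

Lemma entire_is_derive c x : entire c ->
  is_derive x (1 : R) (fun x => limn (pseries c x)) (limn (pseries (pseries_diffs c) x)).
Proof.
move=> ec; apply: (@pseries_snd_diffs _ c (`|x| + 1)).
- exact: entire_cvg.
- exact/entire_cvg/entire_diffs.
- exact/entire_cvg/entire_diffs/entire_diffs.
- by rewrite [ltRHS]ger0_norm ?addr_ge0// ltrDl.
Qed.

Lemma limn_pseries0 c : limn (pseries c 0) = c 0.
Proof.
apply: lim_near_cst => //; near=> n.
rewrite /pseries/= /series/= -(@prednK n); last by near: n; exact: nbhs_infty_gt.
rewrite big_nat_recl// expr0 mulr1 big1_seq ?addr0// => i _.
by rewrite exprS mul0r mulr0.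
Unshelve. all: by end_near.
Qed.

End PowerSeries.

(** * The Bargmann kernel *)

Section GeneratingFunction.
Variable R : realType.
Implicit Types x y : R.

(** The coefficients in x of the Bargmann kernel. *)
Definition hb y n : R := hp n y / Num.sqrt n`!%:R.

Lemma hb_term_bound x y n : `|hb y n * x ^+ n| <=
  (expR (2 * (@Kh R * `|x|) ^+ 2) + expR (2 * (Kh R * `|x| * `|y|))) * 2 ^- n.
Proof.
have K0 : 0 <= Kh R by rewrite (le_trans _ (@Kh_ge1 R)).
have s0 := sqrt_fact_gt0 R n.
rewrite /hb 2!normrM normfV (gtr0_norm s0) normrX.
apply: (@le_trans _ _ (Kh R ^+ n * (1 + `|y| ^+ n / Num.sqrt n`!%:R) / Num.sqrt n`!%:R * `|x| ^+ n)).
  by rewrite ler_wpM2r ?exprn_ge0// ler_wpM2r ?invr_ge0 ?(ltW s0)// hp_bound.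
rewrite (_ : _ * _ = (Kh R * `|x|) ^+ n / Num.sqrt n`!%:R + (Kh R * `|x| * `|y|) ^+ n / n`!%:R); last first.
  have : Num.sqrt n`!%:R ^+ 2 = n`!%:R :> R by rewrite sqr_sqrtr.
  move: (Num.sqrt _) s0 => s s0 <-; rewrite !exprMn; field.
  by rewrite gt_eqF.
rewrite mulrDl; apply: lerD.
  by rewrite [leRHS]mulrC pow_sqrt_fact_geom// mulr_ge0.
have := @pow_fact_le_expR R (2 * (Kh R * `|x| * `|y|)) n.
rewrite !mulr_ge0// => /(_ isT).
by rewrite exprMn; move: (Kh R * _ * _) => t; rewrite -mulrA [leLHS]mulrC -ler_pdivlMr ?exprn_gt0.
Qed.

Lemma entire_hb y : entire (hb y).
Proof. by move=> x; eexists => n; exact: hb_term_bound. Qed.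

Lemma hb_rec y n : n.+2%:R * hb y n.+2 = Num.sqrt 2 * y * hb y n.+1 - hb y n.
Proof.
have := hp_rec n y; rewrite /hb factS natrM sqrtrM// factS natrM sqrtrM//.
have s0 := sqrt_fact_gt0 R n.
have : 0 < Num.sqrt n.+2%:R :> R by rewrite sqrtr_gt0.
have : 0 < Num.sqrt n.+1%:R :> R by rewrite sqrtr_gt0.
have : Num.sqrt n.+2%:R ^+ 2 = n.+2%:R :> R by rewrite sqr_sqrtr.
move: (Num.sqrt n.+2%:R) (Num.sqrt n.+1%:R) (Num.sqrt n`!%:R) s0 => a b s s0 <- b0 a0 h.
transitivity ((a * hp n.+2 y) / (b * s)); first by field; rewrite !gt_eqF.
by rewrite h; field; rewrite !gt_eqF.
Qed.

Lemma hb1 y : hb y 1 = Num.sqrt 2 * y * hb y 0.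
Proof. by rewrite /hb hp1 !fact0 factS fact0 sqrtr1 !divr1. Qed.

Definition bargmann x y : R := pi `^ (- (1 / 4)) * expR (Num.sqrt 2 * y * x - x ^+ 2 / 2).

(** By the recurrence, both sides solve G' = (sqrt 2 y - x) G in the variable
    x, and they agree at x = 0. *)
Lemma hermite_generating x y : limn (pseries (hb y) x) = bargmann x y.
Proof.
pose G x := limn (pseries (hb y) x).
have eb := entire_hb y.
have dG z : limn (pseries (pseries_diffs (hb y)) z) = (Num.sqrt 2 * y - z) * G z.
  have c1 : cvgn (pseries (hb y) z) by exact: entire_cvg.
  have cG : pseries (hb y) z @ \oo --> G z by [].
  apply/cvg_lim => //; rewrite -(cvg_shiftS _).
  have -> : [sequence pseries (pseries_diffs (hb y)) z n.+1]_n =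
      fun n => Num.sqrt 2 * y * pseries (hb y) z n.+1 - z * pseries (hb y) z n.
    apply/funext => n; rewrite /pseries/= /series/=.
    elim: n => [|n IH].
      rewrite !big_nat1 big_geq// mulr0 subr0 /pseries_diffs hb1 !expr0; ring.
    rewrite big_nat_recr//= IH [in RHS]big_nat_recr//= [in X in _ = _ - X]big_nat_recr//=.
    by rewrite /pseries_diffs hb_rec exprS; ring.
  have cS : pseries (hb y) z n.+1 @[n --> \oo] --> G z.
    by rewrite (cvg_shiftS (pseries (hb y) z)).
  rewrite mulrBl; exact: (cvgB (cvgM (cvg_cst _) cS) (cvgM (cvg_cst _) cG)).
pose F z := G z * expR (z ^+ 2 / 2 - Num.sqrt 2 * y * z).
have dF (z : R) : is_derive z (1 : R) F 0.
  have dGz : is_derive z (1 : R) G ((Num.sqrt 2 * y - z) * G z).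
    by rewrite -dG; exact: entire_is_derive.
  apply: is_derive_eq; set e := expR _; set a := Num.sqrt 2.
  change (G z * (e * (z ^+ 2 * (- 2 ^- 2 * 0) + 2^-1 * (z * 1 + z * 1) - a * y * 1)) +
    e * ((a * y - z) * G z) = 0).
  by field.
have := is_derive_0_is_cst x 0 dF.
rewrite /F expr0n/= mul0r mulr0 subrr expR0 mulr1 /G limn_pseries0.
rewrite {2}/hb hp0 fact0 sqrtr1 divr1 /bargmann => <-.
by rewrite -mulrA -expRD -opprB addNr expR0 mulr1.
Qed.

(** The factor exp(-y^2/2) absorbs |y|^n / sqrt(n!). *)
Lemma expR_gauss_hp_bound n y : expR (- y ^+ 2 / 2) * `|hp n y| <= 2 * Kh R ^+ n.
Proof.
have K0 : 0 <= Kh R by rewrite (le_trans _ (@Kh_ge1 R)).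
apply: le_trans (ler_wpM2l (expR_ge0 _) (hp_bound n y)) _.
rewrite mulrCA mulrC ler_wpM2r ?exprn_ge0// mulrDr mulr1.
rewrite mulNr expRN.
have e1 : 1 <= expR (y ^+ 2 / 2) by rewrite -expR0 ler_expR divr_ge0// sqr_ge0.
have e0 := expR_gt0 (y ^+ 2 / 2).
have -> : 2 = 1 + 1 :> R by [].
apply: lerD; first by rewrite invf_le1.
rewrite mulrC ler_pdivrMr// mul1r.
by rewrite -(real_normK (num_real y)) pow_sqrt_fact_le_expR.
Qed.

Lemma bargmann_remainder x y N :
  expR (- y ^+ 2 / 2) * `|bargmann x y - \sum_(n < N) hp n y * (x ^+ n / Num.sqrt n`!%:R)|
  <= 4 * 2 ^- N * expR (2 * (Kh R * `|x|) ^+ 2).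
Proof.
have K0 : 0 <= Kh R by rewrite (le_trans _ (@Kh_ge1 R)).
pose s n := hp n y * (x ^+ n / Num.sqrt n`!%:R).
have cs : series s @ \oo --> bargmann x y.
  rewrite -hermite_generating.
  have -> : series s = pseries (hb y) x; last exact/entire_cvg/entire_hb.
  by apply/funext => n; apply: eq_bigr => i _; rewrite /s /hb mulrA mulrAC.
rewrite -(big_mkord xpredT s) -/(series s N).
have : expR (- y ^+ 2 / 2) * `|series s n - series s N| @[n --> \oo] -->
       expR (- y ^+ 2 / 2) * `|bargmann x y - series s N|.
  by apply: (cvgM (cvg_cst _)); apply: cvg_norm; apply: cvgB => //; exact: cvg_cst.
move/cvgr_to_le; apply; near=> n.
have Nn : (N <= n)%N by near: n; exact: nbhs_infty_ge.
rewrite sub_series_geq// (le_trans (ler_wpM2l (expR_ge0 _) (ler_norm_sum _ _ _)))//.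
rewrite mulr_sumr.
apply: (@le_trans _ _ (\sum_(N <= k < n) 2 ^- k * (2 * expR (2 * (Kh R * `|x|) ^+ 2)))).
  apply: ler_sum => k _; rewrite /s normrM mulrA.
  apply: le_trans (ler_wpM2r (normr_ge0 _) (expR_gauss_hp_bound k y)) _.
  have sk := sqrt_fact_gt0 R k.
  rewrite normrM normfV (gtr0_norm sk) normrX -mulrA [leRHS]mulrCA ler_pM2l//.
  rewrite mulrA -exprMn pow_sqrt_fact_geom// mulr_ge0//.
rewrite -mulr_suml mulrA -mulrA.
rewrite (_ : 4 * 2 ^- N = 2 * 2 ^- N * 2); last by ring.
rewrite -mulrA ler_wpM2r ?mulr_ge0 ?expR_ge0// sum_geom_half//.
Unshelve. all: by end_near.
Qed.

End GeneratingFunction.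

(** * Integrals of tensor products *)

Section ProductIntegrals.
Variable R : realType.
Local Notation leb := (@lebesgue_measure R).

Lemma measurable_tuple_prod n (psi : 'I_n -> R -> R) :
  (forall i, measurable_fun setT (psi i)) ->
  measurable_fun setT (fun x : n.-tuple R => \prod_(i < n) psi i (tnth x i)).
Proof.
move=> mpsi; apply: measurable_prod => i _.
apply: (measurableT_comp (mpsi i)); exact: measurable_tnth.
Qed.

Lemma prod_tuple_cons n (psi : 'I_n.+1 -> R -> R) (z : measurableTypeR R * n.-tuple R) :
  \prod_(i < n.+1) psi i (tnth (tuple_cons z) i) =
  psi ord0 z.1 * \prod_(i < n) psi (lift ord0 i) (tnth z.2 i).
Proof.
rewrite big_ord_recl; congr (_ * _).
by apply: eq_bigr => i _; rewrite /tuple_cons tnthS.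
Qed.

(** Fubini's theorem, by induction on the number of variables: Lebesgue measure
    on tuples is the image of a product measure. *)
Lemma lebesgue_tuple_prod n (psi : 'I_n -> R -> R) :
  (forall i, measurable_fun setT (psi i)) ->
  (forall i, leb.-integrable setT (EFin \o psi i)) ->
  (lebesgue_tuple R n).-integrable setT
    (fun x => (\prod_(i < n) psi i (tnth x i))%:E) /\
  (\int[lebesgue_tuple R n]_x (\prod_(i < n) psi i (tnth x i))%:E =
   (\prod_(i < n) \int[leb]_y psi i y)%:E)%E.
Proof.
elim: n psi => [|n IH] psi mpsi ipsi.
  have E : (fun x : 0.-tuple R => (\prod_(i < 0) psi i (tnth x i))%:E) = cst 1%:E.
    by apply/funext => x; rewrite big_ord0.
  rewrite E; split.
    apply/integrableP; split; first exact: measurable_cst.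
    by rewrite /= integral_dirac//= ?diracT ?mul1e normr1 ltry.
  by rewrite /= integral_dirac//= diracT mul1e big_ord0.
pose psi' (i : 'I_n) := psi (lift ord0 i).
have [I1 I2] := IH psi' (fun i => mpsi _) (fun i => ipsi _).
pose P (x : n.+1.-tuple R) := \prod_(i < n.+1) psi i (tnth x i).
have mP : measurable_fun setT P by exact: measurable_tuple_prod.
have mF : measurable_fun setT (EFin \o P) by exact/measurable_EFinP.
have mc := @measurable_tuple_cons R n.
have mFc : measurable_fun setT ((EFin \o P) \o @tuple_cons R n) by exact: measurableT_comp.
have iFc : (leb \x lebesgue_tuple R n)%E.-integrable setT ((EFin \o P) \o @tuple_cons R n).
  apply/(integrable12ltyP _ _ mFc).
  have [mI1 fI1] := integrableP _ _ _ I1.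
  have [mi0 fi0] := integrableP _ _ _ (ipsi ord0).
  pose A := (\int[lebesgue_tuple R n]_x `|(\prod_(i < n) psi' i (tnth x i))%:E|)%E.
  have A0 : (0 <= A)%E by exact: integral_ge0.
  have Afin : A \is a fin_num by rewrite ge0_fin_numE.
  rewrite (eq_integral (fun x : measurableTypeR R => (A * `|(EFin \o psi ord0) x|)%E)); last first.
    move=> x _; rewrite muleC -ge0_integralZl//.
    - apply: eq_integral => t _ /=.
      by rewrite /P prod_tuple_cons normrM EFinM.
    - exact: measurableT_comp.
  rewrite ge0_integralZl//; last exact: measurableT_comp.
  by apply: lte_mul_pinfty.
split.
  by apply: integrable_pushforward.
rewrite /= /lebesgue_step (integral_pushforward mc mF)//=.
rewrite -integral12_prod_meas1//.
pose c := \prod_(i < n) \int[leb]_y psi' i y.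
rewrite (eq_integral (fun x : measurableTypeR R => ((EFin \o psi ord0) x * c%:E)%E)); last first.
  move=> x _; rewrite /fubini_F /= -I2 -integralZl//.
  by apply: eq_integral => t _ /=; rewrite /P prod_tuple_cons EFinM.
rewrite integralZr// big_ord_recl EFinM; congr (_ * _)%E.
by rewrite /Rintegral fineK//; exact: (integrable_fin_num measurableT (ipsi ord0)).
Qed.

End ProductIntegrals.

(** * Orthonormality of the Hermite functions *)

Section GaussIntegrals.
Variable R : realType.
Local Notation leb := (@lebesgue_measure R).

Lemma integralT_oneDsqrV : (\int[leb]_x ((oneDsqr x)^-1)%:E = pi%:E)%E.
Proof.
rewrite ge0_symfun_integralT.
- rewrite (_ : [set x | _] = `[0, +oo[%classic); last first.
    by apply/seteqP; split => x/=; rewrite in_itv/= andbT.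
  by rewrite integral0y_oneDsqr -EFinM mulrC divfK.
- by move=> x; rewrite invr_ge0 (le_trans ler01)// oneDsqr_ge1.
- exact: continuous_oneDsqrV.
- by move=> x; rewrite /= /oneDsqr sqrrN.
Qed.

Lemma integrable_oneDsqrV : leb.-integrable setT (EFin \o (fun x => (oneDsqr x)^-1)).
Proof.
have m : measurable_fun setT (fun x : R => (oneDsqr x)^-1).
  by apply: continuous_measurable_fun; exact: continuous_oneDsqrV.
apply/integrableP; split; first exact/measurable_EFinP.
rewrite (eq_integral (fun x : measurableTypeR R => ((oneDsqr x)^-1)%:E)); last first.
  by move=> x _ /=; rewrite ger0_norm// invr_ge0 (le_trans ler01)// oneDsqr_ge1.
by rewrite integralT_oneDsqrV ltry.
Qed.

(** Comparison with the integrable function 1 / (1 + x^2), the majorant that is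
    used for all the integrals below. *)
Lemma integrable_of_decay (f : R -> R) (C : R) : measurable_fun setT f ->
  (forall x, `|f x| * (1 + x ^+ 2) <= C) -> leb.-integrable setT (EFin \o f).
Proof.
move=> mf fC.
have x1 (x : R) : 0 < 1 + x ^+ 2 by rewrite ltr_pwDl// sqr_ge0.
have C0 : 0 <= C by apply: le_trans (fC 0); rewrite mulr_ge0// ltW.
apply: (@le_integrable _ (measurableTypeR R) _ _ _ measurableT _ (fun x : measurableTypeR R => C%:E * ((oneDsqr x)^-1)%:E)%E).
- exact/measurable_EFinP.
- move=> x _ /=; rewrite lee_fin (ger0_norm (_ : 0 <= C / oneDsqr x)).
    by rewrite ler_pdivlMr ?fC// x1.
  by rewrite divr_ge0// ltW// x1.
- by apply: integrableZl => //; exact: integrable_oneDsqrV.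
Qed.

Lemma horner_gauss_decay (p : {poly R}) :
  exists C, forall x, `|p.[x]| * expR (- x ^+ 2) * (1 + x ^+ 2) <= C.
Proof.
pose A := \sum_(i < size p) `|p`_i| * i`!%:R.
have A0 : 0 <= A by apply: sumr_ge0 => i _; rewrite mulr_ge0.
exists (A * 2 * expR (1 / 2)) => x.
have pA : `|p.[x]| <= A * expR `|x|.
  rewrite horner_coef (le_trans (ler_norm_sum _ _ _))// mulr_suml.
  apply: ler_sum => i _; rewrite normrM -mulrA ler_wpM2l// normrX.
  have := pow_fact_le_expR i (normr_ge0 x).
  by rewrite ler_pdivrMr ?ltr0n ?fact_gt0// mulrC.
have h1 : 1 + x ^+ 2 <= 2 * expR (x ^+ 2 / 2).
  have := expR_ge1Dx (x ^+ 2 / 2); have := expR_ge0 (x ^+ 2 / 2).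
  lra.
have h2 : expR `|x| * expR (- x ^+ 2) * expR (x ^+ 2 / 2) <= expR (1 / 2).
  rewrite -!expRD ler_expR -(real_normK (num_real x)).
  have := sqr_ge0 (`|x| - 1); lra.
have x1 : 0 <= 1 + x ^+ 2 by rewrite addr_ge0// sqr_ge0.
apply: (@le_trans _ _ (A * expR `|x| * expR (- x ^+ 2) * (2 * expR (x ^+ 2 / 2)))).
  by apply: ler_pM => //; rewrite ler_wpM2r// expR_ge0.
rewrite (_ : _ * _ = A * 2 * (expR `|x| * expR (- x ^+ 2) * expR (x ^+ 2 / 2))); last by ring.
by rewrite ler_wpM2l// mulr_ge0.
Qed.

Lemma measurable_horner_gauss (p : {poly R}) :
  measurable_fun setT (fun x : R => p.[x] * expR (- x ^+ 2)).
Proof.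
apply: continuous_measurable_fun => x; apply: cvgM; first exact: continuous_horner.
apply: continuous_comp; last exact: continuous_expR.
by apply: cvgN; apply: exprn_continuous.
Qed.

Lemma integrable_horner_gauss (p : {poly R}) :
  leb.-integrable setT (EFin \o (fun x => p.[x] * expR (- x ^+ 2))).
Proof.
have [C HC] := horner_gauss_decay p.
apply: (@integrable_of_decay _ C); first exact: measurable_horner_gauss.
by move=> x; rewrite normrM (ger0_norm (expR_ge0 _)) HC.
Qed.

Definition gaussI (p : {poly R}) : R := \int[leb]_x (p.[x] * expR (- x ^+ 2)).

Lemma gaussID p q : gaussI (p + q) = gaussI p + gaussI q.
Proof.
rewrite /gaussI -RintegralD//; [|exact: integrable_horner_gauss..].
by apply: eq_Rintegral => x _; rewrite hornerD mulrDl.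
Qed.

Lemma gaussIZ c p : gaussI (c *: p) = c * gaussI p.
Proof.
rewrite /gaussI -RintegralZl//; last exact: integrable_horner_gauss.
by apply: eq_Rintegral => x _; rewrite hornerZ mulrA.
Qed.

Lemma gaussIMn p k : gaussI (p *+ k) = k%:R * gaussI p.
Proof. by rewrite -gaussIZ; congr gaussI; rewrite scaler_nat. Qed.

Lemma gaussI1 : gaussI 1 = Num.sqrt pi.
Proof.
rewrite /gaussI /Rintegral.
have := @integralT_gauss R; rewrite /gauss_fun => h.
rewrite (eq_integral (fun x : measurableTypeR R => (expR (- x ^+ 2))%:E)) ?h//.
by move=> x _; rewrite hornerC mul1r.
Qed.

(** The integrand is the derivative of p(x) exp(-x^2), which vanishes at
    infinity. *)
Lemma gaussI_deriv p : gaussI (p^`() - 'X * p *+ 2) = 0.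
Proof.
pose q := p^`() - 'X * p *+ 2.
pose F (x : R) := p.[x] * expR (- x ^+ 2).
pose f (x : R) := q.[x] * expR (- x ^+ 2).
have dF (x : R) : is_derive x (1 : R) F (f x).
  apply: is_derive_eq; rewrite /f /q hornerD hornerN hornerMn hornerM hornerX.
  set a := (p^`()).[x]; set b := p.[x]; set e := expR _.
  change (b * (e * - (x * 1 + x * 1)) + e * a = (a - x * b *+ 2) * e).
  by ring.
have cF : continuous F.
  by move=> x; apply/differentiable_continuous/derivable1_diffP; exact: ex_derive.
have cf : continuous f.
  move=> x; apply: cvgM; first exact: continuous_horner.
  apply: continuous_comp; last exact: continuous_expR.
  by apply: cvgN; apply: exprn_continuous.
have [C HC] := horner_gauss_decay p.
have C0 : 0 <= C by apply: le_trans (HC 0); rewrite !mulr_ge0 ?expR_ge0 ?addr_ge0 ?sqr_ge0.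
have FTC (n : nat) : (\int[leb]_(x in `[(- n.+1%:R)%R, n.+1%:R%R]) (f x)%:E =
   (F n.+1%:R%R)%:E - (F (- n.+1%:R)%R)%:E)%E.
  apply: continuous_FTC2.
  - by rewrite gtrN.
  - by apply: continuous_subspaceT.
  - split.
    + by move=> x _; exact: ex_derive.
    + by apply: cvg_at_right_filter; exact: cF.
    + by apply: cvg_at_left_filter; exact: cF.
  - by move=> x _; rewrite derive1E; exact: derive_val.
have if_ : leb.-integrable setT (EFin \o f) by exact: integrable_horner_gauss.
pose fn n := (EFin \o f) \_ `[(- n.+1%:R), n.+1%:R]%classic.
have [] := @dominated_convergence _ _ _ leb setT measurableT fn (EFin \o f) (abse \o (EFin \o f)).
- move=> n; rewrite /fn -measurable_restrictT//.
  by apply: measurable_funTS; exact: (measurable_int leb if_).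
- exact: (measurable_int leb if_).
- apply: aeW => x _; apply: cvg_near_cst; near=> n.
  rewrite /fn patchE mem_set//= in_itv/= -ler_norml.
  near: n; exists (Num.truncn `|x|) => // n /= xn.
  by apply: ltW; apply: lt_le_trans (truncnS_gt _) _; rewrite ler_nat.
- exact: integrable_abse.
- apply: aeW => x n _; rewrite /fn patchE; case: ifPn => // _.
  by rewrite abse0 abse_ge0.
move=> _ _ cI.
have : (\int[leb]_x fn n x)%E @[n --> \oo] --> 0%:E.
  under eq_fun do rewrite -integral_mkcond FTC.
  apply: cvg_EFin; first by apply: nearW.
  apply/cvgr0Pnorm_le => e e0; near=> n => /=.
  have b (y : R) : `|y| = n.+1%:R -> `|F y| <= C / n.+1%:R.
    move=> yn; rewrite /F normrM (ger0_norm (expR_ge0 _)) ler_pdivlMr//.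
    apply: le_trans (HC y); rewrite ler_wpM2l ?mulr_ge0 ?expR_ge0//.
    rewrite -yn -(real_normK (num_real y)) yn.
    have : 1 <= n.+1%:R :> R by rewrite ler1n.
    nra.
  rewrite (le_trans (ler_normB _ _))// (@le_trans _ _ (C / n.+1%:R + C / n.+1%:R))//.
    by rewrite lerD// b// ?normrN normr_nat.
  rewrite -mulr2n -mulrnAl ler_pdivrMr// mulrC -ler_pdivrMr//.
  near: n; exists (Num.truncn (C *+ 2 / e)) => // n /= xn.
  by apply: ltW; apply: lt_le_trans (truncnS_gt _) _; rewrite ler_nat.
move/(cvg_unique (@ereal_hausdorff R) cI).
by rewrite /gaussI /Rintegral => ->.
Unshelve. all: by end_near.
Qed.

(** Integration by parts, since hpoly (n+1) exp(-x^2) is minus the derivative of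
    hpoly n exp(-x^2). *)
Lemma gaussI_hpoly_succ p n : gaussI (p * hpoly R n.+1) = gaussI (p^`() * hpoly R n).
Proof.
have := gaussI_deriv (p * hpoly R n).
rewrite hpolyS (_ : _ - _ = p^`() * hpoly R n + (-1) *: (p * ('X * hpoly R n *+ 2 - (hpoly R n)^`()))).
  by rewrite gaussID gaussIZ mulN1r => /subr0_eq ->.
by rewrite derivM scaleN1r; ring.
Qed.

Lemma gaussI_hpoly m n :
  gaussI (hpoly R m * hpoly R n) = (m == n)%:R * (2 ^+ n * n`!%:R) * Num.sqrt pi.
Proof.
elim: m n => [|m IH] [|n].
- by rewrite hpoly0 mulr1 gaussI1 expr0 fact0 !mul1r.
- by rewrite gaussI_hpoly_succ hpoly0 derivC mul0r -(scale0r 0) gaussIZ !mul0r.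
- by rewrite mulrC gaussI_hpoly_succ hpoly0 derivC mul0r -(scale0r 0) gaussIZ !mul0r.
rewrite gaussI_hpoly_succ deriv_hpoly [_ * hpoly R n]mulrnAl gaussIMn IH eqSS.
by rewrite factS exprS !natrM; have [->|] := eqVneq m n; rewrite ?mul0r ?mulr0//; ring.
Qed.

Definition hf n (x : R) : R := hp n x * expR (- x ^+ 2 / 2).

Lemma hf_mulE m n x : hf m x * hf n x =
  ((pi `^ (- (1 / 4)) / Num.sqrt (2 ^+ m * m`!%:R) *
    (pi `^ (- (1 / 4)) / Num.sqrt (2 ^+ n * n`!%:R))) *: (hpoly R m * hpoly R n)).[x] *
    expR (- x ^+ 2).
Proof.
rewrite /hf /hp hornerZ hornerM [in RHS](_ : - x ^+ 2 = - x ^+ 2 / 2 + - x ^+ 2 / 2); last by lra.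
by rewrite expRD; ring.
Qed.

Lemma measurable_hf n : measurable_fun setT (hf n).
Proof.
apply: continuous_measurable_fun => x; apply: cvgM.
  by apply: cvgM; [exact: cvg_cst|exact: continuous_horner].
apply: continuous_comp; last exact: continuous_expR.
apply: cvgM; last exact: cvg_cst.
by apply: cvgN; apply: exprn_continuous.
Qed.

Lemma integrable_hf_mul m n : leb.-integrable setT (EFin \o (fun x => hf m x * hf n x)).
Proof.
rewrite (_ : (fun _ => _) = fun x => ((pi `^ (- (1 / 4)) / Num.sqrt (2 ^+ m * m`!%:R) *
    (pi `^ (- (1 / 4)) / Num.sqrt (2 ^+ n * n`!%:R))) *: (hpoly R m * hpoly R n)).[x] *
    expR (- x ^+ 2)); first exact: integrable_horner_gauss.
by apply/funext => x; exact: hf_mulE.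
Qed.

Lemma hf_orthonormal m n : \int[leb]_x (hf m x * hf n x) = (m == n)%:R.
Proof.
under eq_Rintegral do rewrite hf_mulE.
rewrite -/(gaussI _) gaussIZ gaussI_hpoly.
have [->|] := eqVneq m n; last by rewrite !mul0r mulr0.
have s0 := sqrt_norm_gt0 R n.
have -> : 2 ^+ n * n`!%:R = Num.sqrt (2 ^+ n * n`!%:R) ^+ 2 :> R.
  by rewrite sqr_sqrtr// mulr_ge0// exprn_ge0.
set s := Num.sqrt (_ * _) in s0 *; rewrite sqrtr_sqr gtr0_norm//.
rewrite -powR12_sqrt ?pi_ge0// (_ : true%:R = 1 :> R)//.
rewrite (_ : _ / s * _ * _ = pi `^ (- (1 / 4)) * pi `^ (- (1 / 4)) * pi `^ (2^-1) :> R); last first.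
  by field; rewrite gt_eqF.
have pi0 : (pi : R) != 0 by exact: lt0r_neq0 (pi_gt0 R).
rewrite -!powRD ?pi0 ?implybT//.
rewrite (_ : _ + _ + _ = 0); last by lra.
by rewrite powRr0.
Qed.

End GaussIntegrals.

(** * Hermite functions of several variables *)

Section HermiteProduct.
Variables (R : realType) (d : nat).
Implicit Types (x : d.-tuple R) (alpha : d.-tuple nat) (e : 'I_d -> nat).

Definition gauss_prod e x : R := \prod_(k < d) gaussD (e k) (tnth x k).

Lemma partial_gauss_prod j e :
  partial j (gauss_prod e) = gauss_prod (fun k => if k == j then (e k).+1 else e k).
Proof.
apply/funext => x; rewrite /partial.
pose c : R := \prod_(k < d | k != j) gaussD (e k) (tnth x k).
rewrite (_ : (fun y : R => _) = (fun y => c *: gaussD (e j) y)); last first.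
  apply/funext => y; rewrite /gauss_prod (bigD1 j)//= tnth_mktuple eqxx mulrC.
  congr (_ * _); apply: eq_bigr => k kj.
  by rewrite tnth_mktuple (negPf kj).
have dg := is_derive_gaussD (e j) (tnth x j).
rewrite derive1E deriveZ; last exact: ex_derive.
rewrite derive_val /gauss_prod (bigD1 j)//= eqxx mulrC; congr (_ * _).
by apply: eq_bigr => k kj; rewrite (negPf kj).
Qed.

Lemma iter_partial_gauss_prod m j e : iter m (partial j) (gauss_prod e) =
  gauss_prod (fun k => if k == j then e k + m else e k)%N.
Proof.
elim: m => [|m IH] /=.
  by congr gauss_prod; apply/funext => k; rewrite addn0 if_same.
rewrite IH partial_gauss_prod; congr gauss_prod; apply/funext => k.
by case: eqP => // _; rewrite addnS.
Qed.

(** The partial derivatives of the Gaussian are tensor products, and each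
    variable is differentiated independently of the others. *)
Lemma foldr_partial_gauss alpha (s : seq 'I_d) : uniq s ->
  foldr (fun j => iter (tnth alpha j) (partial j)) (gauss_prod (fun _ => 0%N)) s =
  gauss_prod (fun k => if k \in s then tnth alpha k else 0%N).
Proof.
elim: s => [|j s IH]/=; first by move=> _; congr gauss_prod.
move=> /andP[js us]; rewrite IH// iter_partial_gauss_prod.
congr gauss_prod; apply/funext => k; rewrite inE.
by case: eqP => [->|//]; rewrite (negPf js) add0n.
Qed.

Lemma enorm_sqr x : enorm x ^+ 2 = \sum_(j < d) tnth x j ^+ 2.
Proof. by rewrite sqr_sqrtr// sumr_ge0// => j _; rewrite sqr_ge0. Qed.

Lemma expR_enorm_sqr (c : R) x :
  expR (c * enorm x ^+ 2) = \prod_(j < d) expR (c * tnth x j ^+ 2).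
Proof. by rewrite enorm_sqr mulr_sumr expR_sum. Qed.

Lemma powR_prod (I : finType) (a : I -> R) (r : R) : (forall i, 0 <= a i) ->
  (\prod_i a i) `^ r = \prod_i a i `^ r.
Proof.
move=> a0.
suff [] : 0 <= \prod_i a i /\ (\prod_i a i) `^ r = \prod_i a i `^ r by [].
elim/big_ind2 : _ => [|y1 y2 z1 z2 [h1 <-] [h2 <-]|i _]; first by rewrite powR1.
  by rewrite mulr_ge0// powRM.
by rewrite a0.
Qed.

Lemma hf_gaussD n (y : R) :
  pi `^ (- (1 / 4)) * (-1) ^+ n * (2 ^+ n * n`!%:R) `^ (- (1 / 2)) *
    expR (1 / 2 * y ^+ 2) * gaussD n y = hf n y.
Proof.
rewrite /gaussD /hf /hp (_ : (_ * _) `^ _ = (Num.sqrt (2 ^+ n * n`!%:R))^-1); last first.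
  by rewrite powRN div1r powR12_sqrt ?mulr_ge0 ?exprn_ge0.
have -> : expR (- y ^+ 2) = expR (- y ^+ 2 / 2) * expR (- y ^+ 2 / 2) :> R.
  by rewrite -expRD; congr expR; lra.
have e1 : expR (1 / 2 * y ^+ 2) * expR (- y ^+ 2 / 2) = 1 :> R.
  by rewrite -expRD -[RHS]expR0; congr expR; lra.
have s1 : (-1) ^+ n * (-1) ^+ n = 1 :> R by rewrite -exprMn mulrN1 opprK expr1n.
move: (expR (1 / 2 * y ^+ 2)) (expR (- y ^+ 2 / 2)) e1 => a b e1.
transitivity ((a * b) * ((-1) ^+ n * (-1) ^+ n) * (pi `^ (- (1 / 4)) /
  Num.sqrt (2 ^+ n * n`!%:R) * (hpoly R n).[y] * b)); first by ring.
by rewrite e1 s1 !mul1r.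
Qed.

Lemma hermite_prodE alpha x :
  hermite alpha x = \prod_(j < d) hf (tnth alpha j) (tnth x j).
Proof.
rewrite /hermite /mpartial.
rewrite (_ : (fun y : d.-tuple R => _) = gauss_prod (fun _ => 0%N)); last first.
  apply/funext => y; rewrite /gauss_prod -mulN1r expR_enorm_sqr.
  by apply: eq_bigr => k _; rewrite /gaussD hpoly0 hornerC !mul1r mulN1r.
rewrite foldr_partial_gauss ?enum_uniq// /gauss_prod.
under eq_bigr do rewrite mem_enum inE/=.
rewrite mulrC (_ : enorm x ^+ 2 / 2 = 1 / 2 * enorm x ^+ 2); last by lra.
rewrite expR_enorm_sqr /mdegree /mfact -!prodrXr.
rewrite (_ : pi `^ (- (d%:R / 4)) = \prod_(j < d) pi `^ (- (1 / 4)) :> R); last first.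
  by rewrite prodr_const card_ord -powR_mulrn ?powR_ge0// -powRrM; congr (_ `^ _); ring.
rewrite natr_prod -!big_split/= powR_prod => [|j]; last by rewrite mulr_ge0// exprn_ge0.
rewrite -!big_split/=; apply: eq_bigr => j _.
by rewrite mulrC hf_gaussD.
Qed.

End HermiteProduct.

(** * Functions with prescribed Hermite coefficients *)

Section Synthesis.
Variables (R : realType) (d : nat).
Local Notation mu := (lebesgue_tuple R d).
Implicit Types (x : d.-tuple R) (alpha : d.-tuple nat).

Lemma Rintegral_sum_nat (F : nat -> d.-tuple R -> R) n :
  (forall k, mu.-integrable setT (EFin \o F k)) ->
  mu.-integrable setT (EFin \o (fun x => \sum_(0 <= k < n) F k x)) /\
  \int[mu]_x (\sum_(0 <= k < n) F k x) = \sum_(0 <= k < n) \int[mu]_x F k x.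
Proof.
move=> iF; elim: n => [|n [IH1 IH2]].
  have E : (fun x => \sum_(0 <= k < 0) F k x) = cst 0.
    by apply/funext => x; rewrite big_nil.
  by rewrite E Rintegral_cst// mul0r big_nil; split => //; exact: integrable0.
have E : (fun x => \sum_(0 <= k < n.+1) F k x) =
    (fun x => \sum_(0 <= k < n) F k x + F n x).
  by apply/funext => x; rewrite big_nat_recr.
rewrite E big_nat_recr//= RintegralD// IH2; split=> //.
have := integrableD measurableT IH1 (iF n).
by apply: eq_integrable => // x _ /=.
Qed.

Lemma measurable_hermite alpha : measurable_fun setT (hermite (R := R) alpha).
Proof.
rewrite (_ : hermite alpha = fun x => \prod_(j < d) hf (tnth alpha j) (tnth x j)).
  apply: (@measurable_tuple_prod _ _ (fun j => hf (tnth alpha j))) => j.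
  exact: measurable_hf.
by apply/funext => x; exact: hermite_prodE.
Qed.

Lemma hermite_orthonormal alpha beta :
  mu.-integrable setT (EFin \o (fun x => hermite alpha x * hermite beta x)) /\
  \int[mu]_x (hermite alpha x * hermite beta x) = (alpha == beta)%:R.
Proof.
pose psi j (y : R) := hf (tnth alpha j) y * hf (tnth beta j) y.
have E : (fun x => hermite alpha x * hermite beta x) =
    fun x => \prod_(j < d) psi j (tnth x j).
  by apply/funext => x; rewrite !hermite_prodE -big_split.
have mpsi j : measurable_fun setT (psi j).
  by apply: measurable_funM; exact: measurable_hf.
have [I1 I2] := lebesgue_tuple_prod mpsi (fun j => integrable_hf_mul R _ _).
rewrite E; split => //; rewrite /Rintegral I2 /=.
rewrite (eq_bigr (fun j => (tnth alpha j == tnth beta j)%:R)); last first.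
  by move=> j _; exact: hf_orthonormal.
have [->|ab] := eqVneq alpha beta; first by rewrite big1// => j _; rewrite eqxx.
have [j hj] : exists j, tnth alpha j != tnth beta j.
  apply/existsP; apply: contraNT ab; rewrite negb_exists => /forallP h.
  by apply/eqP/eq_from_tnth => j; have := h j; rewrite negbK => /eqP.
by rewrite (bigD1 j)//= (negPf hj) mul0r.
Qed.

(** A finite set of multi-indices is contained in a cube, over which the sum of
    the products is the product of the sums. *)
Lemma sum_tuples_le (w : 'I_d -> nat -> R) (S : seq (d.-tuple nat)) :
  (forall j n, 0 <= w j n) -> uniq S -> exists N,
  \sum_(alpha <- S) \prod_(j < d) w j (tnth alpha j) <=
  \prod_(j < d) \sum_(n < N) w j n.
Proof.
move=> w0 uS; pose N := \max_(alpha <- S) \max_(j < d) tnth alpha j.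
exists N.+1.
pose toF alpha : {ffun 'I_d -> 'I_N.+1} := [ffun j => inord (tnth alpha j)].
have toFE alpha j : alpha \in S -> (toF alpha j : nat) = tnth alpha j.
  move=> aS; rewrite ffunE inordK// ltnS.
  apply: leq_trans (@leq_bigmax_seq _ S xpredT (fun a => \max_(j < d) tnth a j)%N alpha aS isT).
  exact: (@leq_bigmax _ (fun j => tnth alpha j)).
have injF : {in S &, injective toF}.
  move=> a b aS bS ab; apply: eq_from_tnth => j.
  by rewrite -(toFE _ _ aS) ab toFE.
rewrite (eq_big_seq (fun a => \prod_(j < d) w j (toF a j))); last first.
  by move=> a aS; apply: eq_bigr => j _; rewrite toFE.
rewrite -(big_map toF xpredT (fun f => \prod_(j < d) w j (f j))).
rewrite big_uniq ?map_inj_in_uniq// bigA_distr_bigA/=.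
rewrite [leRHS](bigID (mem (map toF S)))/= lerDl.
by apply: sumr_ge0 => f _; exact: prodr_ge0.
Qed.

(** The formal series is summed along an enumeration of the multi-indices. The
    partial sums are dominated by the product of the G(x_j), so the coefficients
    of the sum are obtained by dominated convergence and orthonormality. *)
Lemma hermite_synthesis (c : d.-tuple nat -> R) (gam : nat -> R) (A : R) (G : R -> R) :
  0 <= A -> (forall n, 0 <= gam n) ->
  (forall alpha, `|c alpha| <= A * \prod_(j < d) gam (tnth alpha j)) ->
  (forall y N, \sum_(n < N) gam n * `|hf n y| <= G y) ->
  measurable_fun setT G ->
  (forall n, exists C, forall y, G y * `|hf n y| * (1 + y ^+ 2) <= C) ->
  exists g : d.-tuple R -> R, [/\ measurable_fun setT g,
    forall x, `|g x| <= A * \prod_(j < d) G (tnth x j) &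
    forall alpha, mu.-integrable setT (EFin \o (fun x => g x * hermite alpha x)) /\
      \int[mu]_x (g x * hermite alpha x) = c alpha].
Proof.
move=> A0 gam0 cb Gb mG Gdecay.
have G0 y : 0 <= G y by have := Gb y 0%N; rewrite big_ord0.
pose u k x := if pickle_inv k is Some alpha then c alpha * hermite alpha x else 0.
have mu_ k : measurable_fun setT (u k).
  rewrite /u; case: pickle_inv => [alpha|]; last exact: measurable_cst.
  by apply: measurable_funM; [exact: measurable_cst|exact: measurable_hermite].
pose B x := A * \prod_(j < d) G (tnth x j).
have ub n x : \sum_(0 <= k < n) `|u k x| <= B x.
  (* The first n terms run over a finite set of multi-indices. *)
  pose S := pmap (@pickle_inv (d.-tuple nat)) (index_iota 0 n).
  have uS : uniq S by apply: (pmap_uniq (g := pickle)) (iota_uniq _ _); exact: pickle_invK.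
  pose w j n := gam n * `|hf n (tnth x j)|.
  have w0 j m : 0 <= w j m by rewrite mulr_ge0.
  have [N HN] := sum_tuples_le w0 uS.
  apply: (@le_trans _ _ (A * \sum_(alpha <- S) \prod_(j < d) w j (tnth alpha j))).
    rewrite big_pmap/= mulr_sumr; apply: ler_sum => k _.
    rewrite /u; case: pickle_inv => [alpha|]/=; last by rewrite normr0 mulr0.
    rewrite normrM hermite_prodE normr_prod /w big_split/= mulrA.
    by rewrite ler_wpM2r ?cb// prodr_ge0.
  rewrite ler_wpM2l// (le_trans HN)//.
  by apply: ler_prod => j _; rewrite sumr_ge0//= Gb.
have cu x : cvgn (series (u ^~ x)).
  apply: normed_cvg; apply: nondecreasing_is_cvgn.
    move=> m n mn; rewrite /series/= [leRHS](@big_cat_nat _ _ _ m)//= lerDl.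
    by rewrite sumr_ge0.
  by exists (B x) => _ [n _ <-]; exact: ub.
pose g x := limn (series (u ^~ x)).
have mser n : measurable_fun setT (fun x => series (u ^~ x) n).
  exact: measurable_sum.
have mg : measurable_fun setT g.
  by apply: (measurable_fun_cvg (h := fun n x => series (u ^~ x) n)).
have serB n x : `|series (u ^~ x) n| <= B x.
  by rewrite (le_trans (ler_norm_sum _ _ _))// ub.
have gB x : `|g x| <= B x.
  have h : `|series (u ^~ x) n| @[n --> \oo] --> `|g x| by apply: cvg_norm; exact: cu.
  by apply: (cvgr_to_le h); apply: nearW => n; exact: serB.
exists g; split => // alpha.
have iB : mu.-integrable setT (EFin \o (fun x => B x * `|hermite alpha x|)).
  pose psi j (y : R) := G y * `|hf (tnth alpha j) y|.
  have mpsi j : measurable_fun setT (psi j).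
    apply: measurable_funM => //; apply: measurableT_comp => //; exact: measurable_hf.
  have ipsi j : (@lebesgue_measure R).-integrable setT (EFin \o psi j).
    have [C HC] := Gdecay (tnth alpha j).
    apply: (@integrable_of_decay _ _ C) => // y.
    by rewrite ger0_norm ?HC// mulr_ge0.
  have [I1 _] := lebesgue_tuple_prod mpsi ipsi.
  have := integrableZl measurableT A I1.
  apply: eq_integrable => // x _ /=.
  by rewrite /B hermite_prodE normr_prod -EFinM -mulrA -big_split.
have iu k : mu.-integrable setT (EFin \o (fun x => u k x * hermite alpha x)).
  rewrite /u; case: pickle_inv => [beta|].
    have [I1 _] := hermite_orthonormal beta alpha.
    have := integrableZl measurableT (c beta) I1.
    by apply: eq_integrable => // x _ /=; rewrite -EFinM mulrA.
  have E : (fun x => 0 * hermite alpha x) = cst (0 : R) by apply/funext => x; rewrite mul0r.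
  by rewrite E; exact: integrable0.
pose fn n x := (series (u ^~ x) n * hermite alpha x)%:E.
have [I1 _ I3] := @dominated_convergence _ _ _ mu setT measurableT fn
  (EFin \o (fun x => g x * hermite alpha x)) (EFin \o (fun x => B x * `|hermite alpha x|))
  (fun n => ltac:(by apply/measurable_EFinP; apply: measurable_funM => //; exact: measurable_hermite))
  (ltac:(by apply/measurable_EFinP; apply: measurable_funM => //; exact: measurable_hermite))
  (ltac:(by apply: aeW => x _; apply: cvg_EFin; [exact: nearW|apply: cvgM; [exact: cu|exact: cvg_cst]]))
  iB
  (ltac:(by apply: aeW => x n _; rewrite /fn /= lee_fin normrM ler_wpM2r)).
split => //.
have Efn n : (\int[mu]_x fn n x)%E = (\sum_(0 <= k < n) \int[mu]_x (u k x * hermite alpha x))%:E.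
  have [J1 J2] := Rintegral_sum_nat n iu.
  rewrite -J2 /Rintegral fineK; last exact: (integrable_fin_num measurableT J1).
  by apply: eq_integral => x _; rewrite /fn /series/= mulr_suml.
have Eu k : \int[mu]_x (u k x * hermite alpha x) = if k == pickle alpha then c alpha else 0.
  rewrite /u; case E : (pickle_inv k) => [beta|].
    have [J1 J2] := hermite_orthonormal beta alpha.
    under eq_Rintegral do rewrite -mulrA.
    rewrite RintegralZl// J2.
    have [ba|ba] := eqVneq beta alpha.
      have /(congr1 (fun o => oapp pickle k o)) /= := E.
      rewrite (pickle_invK k) ba => ->.
      by rewrite eqxx mulr1.
    rewrite mulr0; case: eqP => // ka; move: E; rewrite ka pickleK_inv => -[ab].
    by rewrite ab eqxx in ba.
  under eq_Rintegral do rewrite mul0r.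
  rewrite Rintegral_cst// mul0r.
  by case: eqP => // ka; move: E; rewrite ka pickleK_inv.
rewrite /Rintegral.
have : (\int[mu]_x fn n x)%E @[n --> \oo] --> (c alpha)%:E.
  apply: cvg_near_cst; near=> n; rewrite Efn; congr EFin.
  under eq_bigr do rewrite Eu.
  rewrite big_mkord -big_mkcond/=.
  have an : (pickle alpha < n)%N by near: n; exact: nbhs_infty_gt.
  by rewrite (big_pred1 (Ordinal an)).
by move/(cvg_unique (@ereal_hausdorff R) I3) => ->.
Unshelve. all: by end_near.
Qed.

End Synthesis.

Section ComplexSynthesis.
Variables (R : realType) (d : nat).
Implicit Types (c : hermite_series R d).

Lemma normc_le_ReIm (z : R[i]) : normc z <= `|complex.Re z| + `|complex.Im z|.
Proof.
rewrite -(@ler_pXn2r _ 2)// ?nnegrE ?normc_ge0 ?addr_ge0// sqr_normcE.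
rewrite -(real_normK (num_real (complex.Re z))) -(real_normK (num_real (complex.Im z))).
have := normr_ge0 (complex.Re z); have := normr_ge0 (complex.Im z); nra.
Qed.

Lemma normc_frac_fourier (t : d.-tuple R) c alpha :
  normc (frac_fourier t c alpha) = normc (c alpha).
Proof.
rewrite /frac_fourier normcM normc_ReIm /=.
by rewrite sqrrN cos2Dsin2 sqrtr1 mul1r.
Qed.

Lemma hermite_synthesis_complex c (gam : nat -> R) (A : R) (G : R -> R) :
  0 <= A -> (forall n, 0 <= gam n) ->
  (forall alpha, normc (c alpha) <= A * \prod_(j < d) gam (tnth alpha j)) ->
  (forall y N, \sum_(n < N) gam n * `|hf n y| <= G y) ->
  measurable_fun setT G ->
  (forall n, exists C, forall y, G y * `|hf n y| * (1 + y ^+ 2) <= C) ->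
  exists2 g, represents g c & forall x, normc (g x) <= 2 * A * \prod_(j < d) G (tnth x j).
Proof.
move=> A0 g0 cb Gb mG Gd.
have [gr [mr br cr]] := hermite_synthesis A0 g0
  (fun alpha => le_trans (ler_Re_normc _) (cb alpha)) Gb mG Gd.
have [gi [mi bi ci]] := hermite_synthesis A0 g0
  (fun alpha => le_trans (ler_Im_normc _) (cb alpha)) Gb mG Gd.
exists (fun x => Complex (gr x) (gi x)).
  split => //= alpha; have [ir er] := cr alpha; have [ii ei] := ci alpha.
  split; [exact: ir|exact: ii|].
  by rewrite er ei; case: (c alpha).
move=> x; apply: le_trans (normc_le_ReIm _) _ => /=.
by rewrite -mulrA mulr2n mulrDl mul1r lerD.
Qed.

End ComplexSynthesis.

(** * Pairings with Hermite functions and Bargmann kernels *)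

Section ProductFunctional.
Variables (R : realType) (d : nat).
Local Notation mu := (lebesgue_tuple R d).
Local Notation leb := (@lebesgue_measure R).
Variable v : R -> R.
Hypothesis v0 : forall y, 0 <= v y.
Implicit Types (x : d.-tuple R) (phi : 'I_d -> R -> R).

Definition tensor phi x : R := \prod_(j < d) phi j (tnth x j).

(** The factor 1 + y^2 leaves an integrable majorant in the pairing with a
    function of size v(y) exp(-y^2/2). *)
Definition wbound (f : R -> R) (C : R) :=
  forall y, (1 + y ^+ 2) * v y * expR (- y ^+ 2 / 2) * `|f y| <= C.

Lemma wbound_ge0 f C : wbound f C -> 0 <= C.
Proof.
move/(_ 0); apply: le_trans.
by rewrite !mulr_ge0 ?expR_ge0 ?addr_ge0 ?sqr_ge0.
Qed.

Definition wdecay (M : R) (G : d.-tuple R -> R) :=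
  \forall x \ae mu, `|G x| <= M * \prod_(j < d) (v (tnth x j) * expR (- tnth x j ^+ 2 / 2)).

Lemma tensor_functional (M : R) (G : d.-tuple R -> R) phi (C : 'I_d -> R) :
  0 <= M -> measurable_fun setT G -> wdecay M G ->
  (forall j, measurable_fun setT (phi j)) -> (forall j, wbound (phi j) (C j)) ->
  mu.-integrable setT (EFin \o (fun x => G x * tensor phi x)) /\
  `|\int[mu]_x (G x * tensor phi x)| <= M * pi ^+ d * \prod_(j < d) C j.
Proof.
move=> M0 mG Gb mphi phib.
have C0 j : 0 <= C j by exact: wbound_ge0.
pose psi (j : 'I_d) (y : R) := C j / oneDsqr y.
have mpsi j : measurable_fun setT (psi j).
  apply: measurable_funM; first exact: measurable_cst.
  by apply: continuous_measurable_fun; exact: continuous_oneDsqrV.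
have ipsi j : leb.-integrable setT (EFin \o psi j).
  by have := integrableZl measurableT (C j) (integrable_oneDsqrV R).
have [I1 I2] := lebesgue_tuple_prod mpsi ipsi.
have one0 (y : R) : 0 < oneDsqr y by rewrite ltr_pwDl// sqr_ge0.
have psi0 j y : 0 <= psi j y by rewrite divr_ge0// ltW.
have mten : measurable_fun setT (tensor phi) by exact: measurable_tuple_prod.
have mF : measurable_fun setT (fun x => G x * tensor phi x) by exact: measurable_funM.
have pw : \forall x \ae mu, `|G x * tensor phi x| <= M * \prod_(j < d) psi j (tnth x j).
  apply: filterS Gb => x Gx; rewrite normrM.
  apply: le_trans (ler_wpM2r (normr_ge0 _) Gx) _.
  rewrite -mulrA ler_wpM2l// /tensor normr_prod -big_split/=.
  apply: ler_prod => j _; rewrite !mulr_ge0 ?expR_ge0//=.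
  rewrite /psi ler_pdivlMr// mulrC /oneDsqr !mulrA; exact: phib.
have le1 : (\int[mu]_x `|(G x * tensor phi x)%:E| <= (M * pi ^+ d * \prod_(j < d) C j)%:E)%E.
  apply: (@le_trans _ _ (\int[mu]_x (M%:E * (\prod_(j < d) psi j (tnth x j))%:E))%E).
    apply: ae_ge0_le_integral => //.
    - by apply/measurable_EFinP; exact: measurableT_comp.
    - by move=> x _; rewrite -EFinM lee_fin mulr_ge0// prodr_ge0.
    - by apply/measurable_EFinP; apply: measurable_funM => //; exact: measurable_tuple_prod.
    - by apply: filterS pw => x h _; rewrite -EFinM lee_fin.
  rewrite integralZl// I2 -EFinM lee_fin -mulrA ler_wpM2l//.
  rewrite (eq_bigr (fun j => C j * pi)); last first.
    move=> j _; rewrite /psi RintegralZl//; last exact: integrable_oneDsqrV.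
    by rewrite /Rintegral integralT_oneDsqrV.
  by rewrite big_split/= prodr_const card_ord mulrC.
have iF : mu.-integrable setT (EFin \o (fun x => G x * tensor phi x)).
  apply/integrableP; split; first exact/measurable_EFinP.
  by rewrite (le_lt_trans le1)// ltry.
split=> //.
have := le_normr_Rintegral measurableT iF => /le_trans; apply.
rewrite -lee_fin (le_trans _ le1)// /Rintegral fineK// ge0_fin_numE ?integral_ge0//.
by rewrite (le_lt_trans le1)// ?ltry.
Qed.

End ProductFunctional.

Section Update.
Variables (d : nat).

Definition upd T (s : 'I_d -> T) (j : 'I_d) (a : T) : 'I_d -> T :=
  fun k => if k == j then a else s k.

Lemma upd_id T (s : 'I_d -> T) j : upd s j (s j) = s.
Proof. by apply/funext => k; rewrite /upd; case: eqP => [->|]. Qed.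

Lemma upd_comp T U (f : T -> U) (s : 'I_d -> T) j a :
  (fun k => f (upd s j a k)) = upd (fun k => f (s k)) j (f a).
Proof. by apply/funext => k; rewrite /upd; case: eqP. Qed.

Lemma prod_upd (R : comPzRingType) (s : 'I_d -> R) j a :
  \prod_k upd s j a k = a * \prod_(k | k != j) s k.
Proof.
rewrite (bigD1 j)//= {1}/upd eqxx; congr (_ * _).
by apply: eq_bigr => k kj; rewrite /upd (negPf kj).
Qed.

End Update.

Section Symbols.
Variable R : realType.
Implicit Types (y : R) (s : nat + R).

(** The two kinds of factors in a slot of a pairing: Hermite functions give the
    coefficients, and at the Bargmann kernels of real points the majorants of
    the weight take effect. *)
Definition sym_fun s : R -> R :=
  match s with
  | inl n => hf n
  | inr x => fun y => bargmann x y * expR (- y ^+ 2 / 2)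
  end.

Lemma measurable_sym_fun s : measurable_fun setT (sym_fun s).
Proof.
case: s => [n|x]; first exact: measurable_hf.
apply: continuous_measurable_fun => y; apply: cvgM.
  apply: cvgM; first exact: cvg_cst.
  apply: continuous_comp; last exact: continuous_expR.
  apply: cvgB; last exact: cvg_cst.
  apply: cvgM; last exact: cvg_cst.
  by apply: cvgM; [exact: cvg_cst|exact: cvg_id].
apply: continuous_comp; last exact: continuous_expR.
apply: cvgM; last exact: cvg_cst.
by apply: cvgN; apply: exprn_continuous.
Qed.

Variable v : R -> R.
Hypothesis v0 : forall y, 0 <= v y.

Lemma wbound_mul_gauss (Y : R) (p : R -> R) (C : R) :
  (forall y, (1 + y ^+ 2) * v y <= Y * expR (y ^+ 2 / 2)) ->
  (forall y, expR (- y ^+ 2 / 2) * `|p y| <= C) ->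
  wbound v (fun y => p y * expR (- y ^+ 2 / 2)) (Y * C).
Proof.
move=> vY pC y.
have Y0 : 0 <= Y.
  have := vY 0; rewrite expr0n/= mul0r expR0 mulr1; apply: le_trans.
  by rewrite mulr_ge0// addr0.
have C0 : 0 <= C by apply: le_trans (pC 0); rewrite mulr_ge0// expR_ge0.
rewrite normrM (ger0_norm (expR_ge0 _)).
apply: (@le_trans _ _ (Y * expR (y ^+ 2 / 2) * expR (- y ^+ 2 / 2) * (`|p y| * expR (- y ^+ 2 / 2)))).
  by rewrite ler_wpM2r ?mulr_ge0 ?expR_ge0// ler_wpM2r ?expR_ge0.
rewrite -[_ * _ * expR _]mulrA -expRD mulNr addrN expR0 mulr1.
by rewrite ler_wpM2l// mulrC -mulNr.
Qed.

Lemma wbound_hf (Y : R) n :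
  (forall y, (1 + y ^+ 2) * v y <= Y * expR (y ^+ 2 / 2)) ->
  wbound v (sym_fun (inl n)) (Y * (2 * Kh R ^+ n)).
Proof.
move=> vY; apply: wbound_mul_gauss => // y.
exact: expR_gauss_hp_bound.
Qed.

(** Completing the square: the exponent
    b y^2 - y^2/2 + (sqrt 2 x y - x^2/2 - y^2/2) is at most b x^2 if b <= 1/2. *)
Lemma wbound_bargmann (Y b : R) x : 0 <= b <= 1 / 2 ->
  (forall y, (1 + y ^+ 2) * v y <= Y * expR (b * y ^+ 2)) ->
  wbound v (sym_fun (inr x)) (Y * expR (b * x ^+ 2)).
Proof.
move=> /andP[b0 b2] vY y /=.
have Y0 : 0 <= Y.
  have := vY 0; rewrite expr0n/= mulr0 expR0 mulr1; apply: le_trans.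
  by rewrite mulr_ge0// addr0.
rewrite normrM !ger0_norm ?expR_ge0 ?mulr_ge0 ?powR_ge0 ?expR_ge0//.
apply: (@le_trans _ _ (Y * expR (b * y ^+ 2) * expR (- y ^+ 2 / 2) *
    (expR (Num.sqrt 2 * y * x - x ^+ 2 / 2) * expR (- y ^+ 2 / 2)))).
  apply: ler_pM; rewrite ?mulr_ge0 ?expR_ge0 ?powR_ge0 ?addr_ge0 ?sqr_ge0//.
    by rewrite ler_wpM2r ?expR_ge0.
  rewrite ler_wpM2r ?expR_ge0// ler_piMl ?expR_ge0//; exact: pi_powR_le1.
have s2 : Num.sqrt 2 ^+ 2 = 2 :> R by rewrite sqr_sqrtr.
have sn : Num.sqrt 2 != 0 :> R by rewrite gt_eqF// sqrtr_gt0.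
(* The substitution x = sqrt 2 w removes the square root from the exponent. *)
have [w ->] : exists w : R, x = Num.sqrt 2 * w.
  by exists (x / Num.sqrt 2); rewrite mulrC divfK.
rewrite exprMn s2 (_ : Num.sqrt 2 * y * (Num.sqrt 2 * w) = 2 * y * w); last first.
  by rewrite -[in RHS]s2; ring.
have key (T1 T2 T3 : R) : Y * expR T3 * expR T2 * (expR T1 * expR T2) =
    Y * expR (T3 + T2 + (T1 + T2)) by rewrite !expRD; ring.
rewrite key ler_wpM2l// ler_expR.
(* The difference of the exponents is a combination of squares, with
   coefficients that are nonnegative for b <= 1/2. *)
rewrite -subr_ge0.
have e : b * (2 * w ^+ 2) - (b * y ^+ 2 + - y ^+ 2 / 2 + (2 * y * w - 2 * w ^+ 2 / 2 + - y ^+ 2 / 2))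
  = (1 - b) * (y - w / (1 - b)) ^+ 2 + b * (1 - 2 * b) / (1 - b) * w ^+ 2.
  by field; apply/negP => /eqP h; move: b2; lra.
rewrite e addr_ge0// mulr_ge0 ?sqr_ge0//; first by lra.
by rewrite divr_ge0 ?mulr_ge0//; lra.
Qed.

(** The tail of the expansion of the Bargmann kernel in Hermite functions is
    small in the norm that controls the pairings. *)
Lemma wbound_bargmann_remainder (Y : R) x N :
  (forall y, (1 + y ^+ 2) * v y <= Y * expR (y ^+ 2 / 2)) ->
  wbound v (fun y => sym_fun (inr x) y -
       \sum_(n < N) (x ^+ n / Num.sqrt n`!%:R) * sym_fun (inl (n : nat)) y)
     (Y * (4 * 2 ^- N * expR (2 * (Kh R * `|x|) ^+ 2))).
Proof.
move=> vY.
rewrite (_ : (fun y => _) = fun y =>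
  (bargmann x y - \sum_(n < N) hp n y * (x ^+ n / Num.sqrt n`!%:R)) * expR (- y ^+ 2 / 2)).
  by apply: wbound_mul_gauss => // y; exact: bargmann_remainder.
apply/funext => y; rewrite /= mulrBl mulr_suml; congr (_ - _).
by apply: eq_bigr => n _; rewrite /hf; ring.
Qed.

End Symbols.

Section Pairing.
Variables (R : realType) (d : nat).
Local Notation mu := (lebesgue_tuple R d).
Variables (v : R -> R) (Y0 : R).
Hypothesis v0 : forall y, 0 <= v y.
Hypothesis vY0 : forall y, (1 + y ^+ 2) * v y <= Y0 * expR (y ^+ 2 / 2).
Implicit Types (sg : 'I_d -> nat + R).

Definition pairingR (G : d.-tuple R -> R) sg : R :=
  \int[mu]_x (G x * tensor (fun j => sym_fun (sg j)) x).

Section RealPairing.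
Variables (M : R) (G : d.-tuple R -> R).
Hypotheses (M0 : 0 <= M) (mG : measurable_fun setT G) (dG : wdecay v M G).

Lemma pairingR_bound sg (C : 'I_d -> R) :
  (forall j, wbound v (sym_fun (sg j)) (C j)) ->
  `|pairingR G sg| <= M * pi ^+ d * \prod_(j < d) C j.
Proof.
move=> HC.
by have [] := tensor_functional v0 M0 mG dG (fun j => measurable_sym_fun (sg j)) HC.
Qed.

Lemma pairingR_expansion sg j x (C : 'I_d -> R) N :
  (forall k, k != j -> wbound v (sym_fun (sg k)) (C k)) ->
  `|pairingR G (upd sg j (inr x)) -
    \sum_(n < N) (x ^+ n / Num.sqrt n`!%:R) * pairingR G (upd sg j (inl (n : nat)))|
  <= M * pi ^+ d * ((Y0 * (4 * 2 ^- N * expR (2 * (Kh R * `|x|) ^+ 2))) *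
        \prod_(k < d | k != j) C k).
Proof.
move=> HC.
pose phi k := sym_fun (sg k).
have E s : (fun k => sym_fun (upd sg j s k)) = upd phi j (sym_fun s) by exact: upd_comp.
have mupd (f : R -> R) : measurable_fun setT f -> forall k, measurable_fun setT (upd phi j f k).
  by move=> mf k; rewrite /upd; case: eqP => // _; exact: measurable_sym_fun.
have bupd (f : R -> R) c : wbound v f c -> forall k, wbound v (upd phi j f k) (upd C j c k).
  by move=> fc k; rewrite /upd; case: eqP => // /eqP kj; exact: HC.
pose psi (y : R) := sym_fun (inr x) y -
       \sum_(n < N) (x ^+ n / Num.sqrt n`!%:R) * sym_fun (inl (n : nat)) y.
have mpsi : measurable_fun setT psi.
  apply: measurable_funB; first exact: (measurable_sym_fun (inr x)).
  apply: measurable_sum => n; apply: measurable_funM; first exact: measurable_cst.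
  exact: measurable_sym_fun.
have tE (f : R -> R) (z : d.-tuple R) : tensor (upd phi j f) z =
    f (tnth z j) * \prod_(k < d | k != j) phi k (tnth z k).
  rewrite /tensor (bigD1 j)//= {1}/upd eqxx; congr (_ * _).
  by apply: eq_bigr => k kj; rewrite /upd (negPf kj).
have int s c : wbound v (sym_fun s) c ->
    mu.-integrable setT (EFin \o (fun z => G z * tensor (upd phi j (sym_fun s)) z)).
  move=> sc.
  by have [] := tensor_functional v0 M0 mG dG (mupd _ (measurable_sym_fun s)) (bupd _ _ sc).
have bx : wbound v (sym_fun (inr x)) (Y0 * expR (1 / 2 * x ^+ 2)).
  apply: wbound_bargmann => //; first by rewrite lexx andbT divr_ge0.
  by move=> y; rewrite mulrC div1r mulrC [2^-1 * _]mulrC.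
have [_] := tensor_functional v0 M0 mG dG (mupd _ mpsi) (bupd _ _ (wbound_bargmann_remainder v0 x N vY0)).
rewrite prod_upd; congr (`| _ | <= _).
rewrite /pairingR E.
pose w n := x ^+ n / Num.sqrt n`!%:R.
have intw n : mu.-integrable setT (EFin \o (fun z => w n * (G z * tensor (upd phi j (sym_fun (inl n))) z))).
  have := integrableZl measurableT (w n) (int _ _ (wbound_hf v0 n vY0)).
  by apply: eq_integrable => // z _ /=; rewrite -EFinM.
have [S1 S2] := Rintegral_sum_nat N intw.
transitivity (\int[mu]_z (G z * tensor (upd phi j (sym_fun (inr x))) z -
   \sum_(0 <= n < N) w n * (G z * tensor (upd phi j (sym_fun (inl n))) z))).
  apply: eq_Rintegral => z _; rewrite !tE /psi mulrBl mulrBr; congr (_ - _).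
  rewrite big_mkord mulr_suml mulr_sumr; apply: eq_bigr => n _.
  by rewrite tE /w; ring.
rewrite RintegralB//; last exact: int bx.
congr (_ - _); rewrite S2 big_mkord; apply: eq_bigr => n _.
rewrite RintegralZl//; first by rewrite E.
exact: int (wbound_hf v0 n vY0).
Qed.

End RealPairing.

Definition pairing (g : d.-tuple R -> R[i]) sg : R[i] :=
  Complex (pairingR (fun x => complex.Re (g x)) sg) (pairingR (fun x => complex.Im (g x)) sg).

Variables (M : R) (g : d.-tuple R -> R[i]).
Hypotheses (M0 : 0 <= M) (mr : measurable_fun setT (fun x => complex.Re (g x)))
  (mi : measurable_fun setT (fun x => complex.Im (g x)))
  (dg : wdecay v M (fun x => normc (g x))).

Let dr : wdecay v M (fun x => complex.Re (g x)).
Proof.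
apply: filterS dg => x; apply: le_trans.
by rewrite (ger0_norm (normc_ge0 _)) ler_Re_normc.
Qed.

Let di : wdecay v M (fun x => complex.Im (g x)).
Proof.
apply: filterS dg => x; apply: le_trans.
by rewrite (ger0_norm (normc_ge0 _)) ler_Im_normc.
Qed.

Lemma pairing_bound sg (C : 'I_d -> R) :
  (forall j, wbound v (sym_fun (sg j)) (C j)) ->
  normc (pairing g sg) <= 2 * M * pi ^+ d * \prod_(j < d) C j.
Proof.
move=> HC; apply: le_trans (normc_le_ReIm _) _ => /=.
have := lerD (pairingR_bound M0 mr dr HC) (pairingR_bound M0 mi di HC).
by rewrite -!mulrA -mulr2n mulr_natl.
Qed.

Lemma pairing_expansion sg j x (C : 'I_d -> R) N :
  (forall k, k != j -> wbound v (sym_fun (sg k)) (C k)) ->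
  normc (pairing g (upd sg j (inr x)) -
    \sum_(n < N) (x ^+ n / Num.sqrt n`!%:R)%:C * pairing g (upd sg j (inl (n : nat))))
  <= 2 * M * pi ^+ d * ((Y0 * (4 * 2 ^- N * expR (2 * (Kh R * `|x|) ^+ 2))) *
        \prod_(k < d | k != j) C k).
Proof.
move=> HC; apply: le_trans (normc_le_ReIm _) _.
have ReS (F : 'I_N -> R[i]) : complex.Re (\sum_n F n) = \sum_n complex.Re (F n).
  by apply: (big_morph (@complex.Re R)) => // -[a b] [e f].
have ImS (F : 'I_N -> R[i]) : complex.Im (\sum_n F n) = \sum_n complex.Im (F n).
  by apply: (big_morph (@complex.Im R)) => // -[a b] [e f].
have h (z1 z2 : R[i]) : complex.Re (z1 - z2) = complex.Re z1 - complex.Re z2 /\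
    complex.Im (z1 - z2) = complex.Im z1 - complex.Im z2 by case: z1 z2 => a b [].
rewrite !(h _ _).1 !(h _ _).2 ReS ImS /=.
have Hr := pairingR_expansion M0 mr dr x N HC.
have Hi := pairingR_expansion M0 mi di x N HC.
rewrite (_ : 2 * M * _ * _ = M * pi ^+ d * ((Y0 * (4 * 2 ^- N * expR (2 * (Kh R * `|x|) ^+ 2))) *
  \prod_(k < d | k != j) C k) *+ 2); last first.
  by rewrite -[RHS]mulr_natl !mulrA.
rewrite mulr2n; apply: lerD.
  apply: le_trans Hr; rewrite le_eqVlt; apply/orP; left; apply/eqP.
  by congr (`|_ - _|); apply: eq_bigr => n _; rewrite mul0r subr0.
apply: le_trans Hi; rewrite le_eqVlt; apply/orP; left; apply/eqP.
by congr (`|_ - _|); apply: eq_bigr => n _; rewrite mul0r addr0.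
Qed.

End Pairing.

(** * Coefficients of a series whose transforms are bounded on the lattice *)

Section Lattice.
Variables (R : realType) (d : nat) (t0 u : d.-tuple R).
Local Notation mu := (lebesgue_tuple R d).

(** Two pairings are shown to be equal by comparing truncated expansions up to
    an error of size 2^-N. *)
Lemma eq0_of_geom_bound (z : R[i]) (K : R) :
  (forall N, normc z <= K * 2 ^- N) -> z = 0.
Proof.
move=> H; apply/eqP/negPn/negP; rewrite -normc_gt0 => c0.
pose N := (Num.truncn (K / normc z)).+1.
have := H N; rewrite leNgt => /negP; apply.
rewrite ltr_pdivrMr ?exprn_gt0// mulrC -ltr_pdivrMr//.
apply: lt_le_trans (truncnS_gt _) _.
by rewrite -natrX ler_nat ltnW// ltn_expl.
Qed.

Definition set_coord (t : d.-tuple R) (j : 'I_d) (tau : R) : d.-tuple R :=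
  [tuple if k == j then tau else tnth t k | k < d].

Lemma Lambda_set_coord t j (k : int) : Lambda t0 u t -> 0 <= k%:~R * tnth u j < 2 ->
  Lambda t0 u (set_coord t j (tnth t0 j + k%:~R * tnth u j)).
Proof.
move=> [ks /= Hks <-] kj.
exists [tuple if i == j then k else tnth ks i | i < d] => /=.
  by move=> i; rewrite tnth_mktuple; case: eqP => [->|_].
apply: eq_from_tnth => i; rewrite !tnth_mktuple.
by case: eqP => [->|_].
Qed.

Lemma Lambda_base : Lambda t0 u t0.
Proof.
exists [tuple 0 | i < d] => /=.
  by move=> i; rewrite tnth_mktuple mul0r lexx ltr0n.
by apply: eq_from_tnth => i; rewrite !tnth_mktuple mul0r addr0.
Qed.

Lemma pairing_pure (g : d.-tuple R -> R[i]) c sg alpha : represents g c ->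
  (forall j, sg j = inl (tnth alpha j)) -> pairing g sg = c alpha.
Proof.
move=> [_ _ /(_ alpha)[_ _ ->]] sgE.
have E (x : d.-tuple R) : tensor (fun j => sym_fun (sg j)) x = hermite alpha x.
  by rewrite hermite_prodE; apply: eq_bigr => j _; rewrite sgE.
by rewrite /pairing /pairingR; congr Complex; apply: eq_Rintegral => x _; rewrite E.
Qed.

Lemma frac_fourier_cis t (f : hermite_series R d) alpha : frac_fourier t f alpha =
  cis (- (pi / 2 * \sum_(j < d) tnth t j * (tnth alpha j)%:R)) * f alpha.
Proof. by rewrite /frac_fourier /cis cosN sinN. Qed.

Variables (f : hermite_series R d) (v : R -> R) (M Y0 : R).
Variable g : d.-tuple R -> d.-tuple R -> R[i].
Hypothesis v0 : forall y, 0 <= v y.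
Hypothesis vY0 : forall y, (1 + y ^+ 2) * v y <= Y0 * expR (y ^+ 2 / 2).
Hypothesis M0 : 0 <= M.
Hypothesis gf : forall t, Lambda t0 u t -> represents (g t) (frac_fourier t f).
Hypothesis gM : forall t, Lambda t0 u t -> wdecay v M (fun x => normc (g t x)).

Definition sym_bound (s : nat + R) : R :=
  match s with
  | inl n => Y0 * (2 * Kh R ^+ n)
  | inr x => Y0 * expR (1 / 2 * x ^+ 2)
  end.

Lemma wbound_sym s : wbound v (sym_fun s) (sym_bound s).
Proof.
case: s => [n|x]; first exact: wbound_hf.
apply: wbound_bargmann => //; first by rewrite lexx andbT divr_ge0.
by move=> y; rewrite mul1r [2^-1 * _]mulrC.
Qed.

Lemma lattice_bound t sg (C : 'I_d -> R) : Lambda t0 u t ->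
  (forall j, wbound v (sym_fun (sg j)) (C j)) ->
  normc (pairing (g t) sg) <= 2 * M * pi ^+ d * \prod_(j < d) C j.
Proof.
move=> Lt; have [mr mi _] := gf Lt.
by apply: pairing_bound => //; exact: gM.
Qed.

Lemma lattice_expansion t sg j x (C : 'I_d -> R) N : Lambda t0 u t ->
  (forall k, k != j -> wbound v (sym_fun (sg k)) (C k)) ->
  normc (pairing (g t) (upd sg j (inr x)) -
    \sum_(n < N) (x ^+ n / Num.sqrt n`!%:R)%:C * pairing (g t) (upd sg j (inl (n : nat))))
  <= 2 * M * pi ^+ d * ((Y0 * (4 * 2 ^- N * expR (2 * (Kh R * `|x|) ^+ 2))) *
        \prod_(k < d | k != j) C k).
Proof.
move=> Lt; have [mr mi _] := gf Lt.
by apply: pairing_expansion => //; exact: gM.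
Qed.

(** If all the slots carry Hermite functions, both pairings are coefficients of
    transforms of f and the assertion is the definition of the transform. The
    Bargmann kernels in the other slots are expanded in Hermite functions one
    after the other, by induction on their number. *)
Lemma pairing_phase t j tau n sg : Lambda t0 u t -> Lambda t0 u (set_coord t j tau) ->
  sg j = inl n ->
  pairing (g (set_coord t j tau)) sg =
  cis (- (pi / 2 * ((tau - tnth t j) * n%:R))) * pairing (g t) sg.
Proof.
move=> Lt Lt'; set ph := cis _.
pose isR (s : nat + R) := if s is inr _ then true else false.
have [m mE] := ubnP (\sum_(k < d) isR (sg k))%N.
elim: m sg mE => // m IH sg mE sgj.
have [/existsP[k sgk]|] := boolP [exists k, isR (sg k)]; last first.
  rewrite negb_exists => /forallP h.
  pose alpha := [tuple if sg k is inl n then n else 0%N | k < d].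
  have E k : sg k = inl (tnth alpha k).
    by rewrite tnth_mktuple; have := h k; case: (sg k).
  rewrite (pairing_pure (gf Lt') E) (pairing_pure (gf Lt) E) !frac_fourier_cis mulrA.
  congr (_ * _); rewrite /ph -cisD; congr cis.
  rewrite -opprD -mulrDr; congr (- (_ * _)).
  rewrite (bigD1 j)//= [in RHS](bigD1 j)//= tnth_mktuple eqxx.
  have -> : tnth alpha j = n by have := E j; rewrite sgj => -[].
  rewrite addrA -mulrDl subrK; congr (_ + _).
  by apply: eq_bigr => i ij; rewrite tnth_mktuple (negPf ij).
have kj : j != k by apply/eqP => jk; move: sgk; rewrite -jk sgj.
case E : (sg k) => [//|x]; first by rewrite E in sgk.
have sgx : upd sg k (inr x) = sg by rewrite -E upd_id.
have IHn i : pairing (g (set_coord t j tau)) (upd sg k (inl i)) =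
    ph * pairing (g t) (upd sg k (inl i)).
  apply: IH; last by rewrite /upd (negPf kj).
  rewrite -ltnS; apply: leq_trans mE; rewrite ltnS.
  rewrite [leqRHS](bigD1 k)//= sgk add1n ltnS (bigD1 k)//= {1}/upd eqxx/= add0n.
  apply: leq_sum => l lk; by rewrite /upd (negPf lk).
pose K := 2 * (2 * M * pi ^+ d * ((Y0 * (4 * expR (2 * (Kh R * `|x|) ^+ 2))) *
        \prod_(i < d | i != k) sym_bound (sg i))).
apply/eqP; rewrite -subr_eq0; apply/eqP; apply: (@eq0_of_geom_bound _ K) => N.
have wb i : i != k -> wbound v (sym_fun (sg i)) (sym_bound (sg i)) by move=> _; exact: wbound_sym.
have h1 := lattice_expansion x N Lt' wb.
have h2 := lattice_expansion x N Lt wb.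
rewrite sgx in h1 h2.
set S1 := (\sum_(_ < N) _) in h1; set S2 := (\sum_(_ < N) _) in h2.
have S12 : S1 = ph * S2.
  by rewrite mulr_sumr; apply: eq_bigr => i _; rewrite IHn mulrCA.
rewrite (_ : _ - _ = (pairing (g (set_coord t j tau)) sg - S1) - ph * (pairing (g t) sg - S2)); last first.
  by rewrite S12; ring.
rewrite (le_trans (normcD_le _ _))// normc_opp normcM normc_cis mul1r.
rewrite (le_trans (lerD h1 h2))//.
by rewrite le_eqVlt; apply/orP; left; apply/eqP; rewrite /K; ring.
Qed.


(** The property of a constant kap in [coef_bound_of_lattice] for the step w. *)
Definition lattice_const (w kap : R) := 0 < kap /\
  forall (t1 : R) (a : nat -> R[i]) (A B Y b : R),
    0 <= A -> 0 <= B -> 0 <= Y -> 0 <= b ->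
    (forall N z, normc (\sum_(n < N) a n * z ^+ n) <= A * expR (B * normc z ^+ 2)) ->
    (forall k : int, 0 <= k%:~R * w < 2 -> forall N (x : R),
      normc (\sum_(n < N) a n * (x%:C * cis (- (pi / 2 * (t1 + k%:~R * w)))) ^+ n)
      <= Y * expR (b * x ^+ 2) + 2 ^- N * (A * expR (B * x ^+ 2))) ->
    forall n (S : R), 0 < S -> normc (a n) * S ^+ n <= Y * expR (kap * b * S ^+ 2).

Variable K : 'I_d -> R.
Hypothesis HK : forall j, lattice_const (tnth u j) (K j).
Variables Y b S : nat -> R.
Hypothesis S0 : forall n, 0 < S n.
Hypothesis b2 : forall n, 0 <= b n <= 1 / 2.
Hypothesis vY : forall n y, (1 + y ^+ 2) * v y <= Y n * expR (b n * y ^+ 2).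

(** The Cauchy estimate for the n-th coefficient in the j-th coordinate, with a
    radius and a Gaussian majorant of v that may depend on n. *)
Definition coord_bound (j : 'I_d) (n : nat) : R :=
  Num.sqrt n`!%:R * (Y n * expR (K j * b n * S n ^+ 2)) / S n ^+ n.

Lemma vY_ge0 n : 0 <= Y n.
Proof.
have := vY n 0; rewrite expr0n/= mulr0 expR0 mulr1; apply: le_trans.
by rewrite mulr_ge0// addr0.
Qed.

Lemma coord_bound_ge0 j n : 0 <= coord_bound j n.
Proof.
apply: divr_ge0; last by rewrite exprn_ge0// ltW.
by rewrite !mulr_ge0 ?sqrtr_ge0 ?vY_ge0 ?expR_ge0.
Qed.

(** The first m coordinates have been treated: they carry Hermite functions, and
    contribute a Cauchy estimate instead of a norm. In the step, the pairing is
    viewed as a function of the variable of the Bargmann kernel in the slot m;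
    the induction hypothesis bounds it on the lines of the lattice. *)
Lemma pairing_coord_bound m : (m <= d)%N -> forall t sg (C : 'I_d -> R), Lambda t0 u t ->
  (forall k : 'I_d, (k < m)%N -> exists2 n, sg k = inl n & C k = coord_bound k n) ->
  (forall k : 'I_d, (m <= k)%N -> wbound v (sym_fun (sg k)) (C k)) ->
  normc (pairing (g t) sg) <= 2 * M * pi ^+ d * \prod_(j < d) C j.
Proof.
elim: m => [_ t sg C Lt _ HC|m IH md t sg C Lt Hlo Hhi].
  by apply: lattice_bound => // k; exact: HC.
have Ct k : 0 <= C k.
  have [km|mk] := ltnP k m.+1; last exact: (wbound_ge0 v0 (Hhi k mk)).
  by have [n _ ->] := Hlo k km; exact: coord_bound_ge0.
pose j := Ordinal md.
have [n sgj Cj] := Hlo j (leqnn _).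
move M'E : (2 * M * pi ^+ d) => M'.
have M'0 : 0 <= M' by rewrite -M'E mulr_ge0 ?exprn_ge0 ?pi_ge0// mulr_ge0.
have Y00 : 0 <= Y0.
  have := vY0 0; rewrite expr0n/= mul0r expR0 mulr1; apply: le_trans.
  by rewrite mulr_ge0// addr0.
pose P := \prod_(k < d | k != j) sym_bound (sg k).
have P0 : 0 <= P by apply: prodr_ge0 => k _; apply: (wbound_ge0 v0 (wbound_sym _)).
pose A := 4 * M' * Y0 * P.
have A0 : 0 <= A by rewrite !mulr_ge0.
pose B := 2 * Kh R ^+ 2.
have Kh0 : 0 <= Kh R by apply: le_trans (Kh_ge1 R).
have B0 : 0 <= B by rewrite mulr_ge0// exprn_ge0.
(* The Taylor coefficients of the function of the j-th variable. The phase
   normalizes the order of the transform in this coordinate to 0. *)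
pose a (i : nat) := pairing (g t) (upd sg j (inl i)) * cis (pi / 2 * (tnth t j * i%:R)) * ((Num.sqrt i`!%:R)^-1)%:C.
have anorm i : normc (a i) = normc (pairing (g t) (upd sg j (inl i))) / Num.sqrt i`!%:R.
  rewrite /a !normcM normc_cis mulr1 normc_real ger0_norm// invr_ge0 sqrtr_ge0 //.
pose Y' := M' * Y n * \prod_(k < d | k != j) C k.
have Y'0 : 0 <= Y' by rewrite !mulr_ge0 ?vY_ge0// prodr_ge0.
have H1 N z : normc (\sum_(i < N) a i * z ^+ i) <= A * expR (B * normc z ^+ 2).
  apply: le_trans (normc_sum _ _ _) _.
  apply: (@le_trans _ _ (\sum_(i < N) (2 * M' * Y0 * P) * (2 ^- i * expR (B * normc z ^+ 2)))).
    apply: ler_sum => i _; rewrite normcM normcX anorm.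
    have := lattice_bound Lt (fun k => wbound_sym (upd sg j (inl (i : nat)) k)); rewrite M'E.
    rewrite (_ : \prod_k _ = Y0 * (2 * Kh R ^+ i) * P); last first.
      rewrite -[RHS](prod_upd (fun k => sym_bound (sg k))).
      by apply: eq_bigr => k _; rewrite /upd; case: ifP.
    move=> h; rewrite mulrAC ler_pdivrMr ?sqrt_fact_gt0//.
    apply: (le_trans (ler_wpM2r (exprn_ge0 _ (normc_ge0 _)) h)).
    have := pow_sqrt_fact_geom i (mulr_ge0 Kh0 (normc_ge0 z)).
    rewrite ler_pdivrMr ?sqrt_fact_gt0// !(exprMn _ (Kh R)) [2 * (_ * _)]mulrA -/B => h2.
    rewrite (_ : M' * (Y0 * (2 * Kh R ^+ i) * P) * normc z ^+ i =
      2 * M' * Y0 * P * (Kh R ^+ i * normc z ^+ i)); last by ring.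
    by rewrite -[leRHS]mulrA ler_wpM2l// !mulr_ge0.
  rewrite -mulr_sumr -mulr_suml.
  have : \sum_(i < N) 2 ^- i <= 2 :> R.
    by have := sum_geom_half R 0 N; rewrite big_mkord expr0 invr1 mulr1.
  move=> h; rewrite (_ : A * _ = 2 * M' * Y0 * P * (2 * expR (B * normc z ^+ 2))); last by rewrite /A; ring.
  by rewrite ler_wpM2l ?mulr_ge0// ler_wpM2r ?expR_ge0.
(* On a line of the lattice, the value is a pairing with the transform of
   order t0 + k u in the j-th coordinate and a Bargmann kernel at x. *)
have H2 (k : int) : 0 <= k%:~R * tnth u j < 2 -> forall N (x : R),
      normc (\sum_(i < N) a i * (x%:C * cis (- (pi / 2 * (tnth t0 j + k%:~R * tnth u j)))) ^+ i)
      <= Y' * expR (b n * x ^+ 2) + 2 ^- N * (A * expR (B * x ^+ 2)).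
  move=> ku N x.
  set tau := tnth t0 j + _.
  have Lt' := Lambda_set_coord Lt ku; rewrite -/tau in Lt'.
  have E i : a i * (x%:C * cis (- (pi / 2 * tau))) ^+ i =
      (x ^+ i / Num.sqrt i`!%:R)%:C * pairing (g (set_coord t j tau)) (upd sg j (inl i)).
    rewrite (pairing_phase Lt Lt' (n := i)); last by rewrite /upd eqxx.
    rewrite /a exprMn cisX -rmorphXn rmorphM /=.
    rewrite (_ : - (pi / 2 * ((tau - tnth t j) * i%:R)) =
       pi / 2 * (tnth t j * i%:R) + - (pi / 2 * tau) * i%:R); last first.
      by move: (pi : R) => p; ring.
    by rewrite cisD; ring.
  under eq_bigr => i _ do rewrite E.
  have h1 := lattice_expansion x N Lt' (fun (k : 'I_d) (_ : k != j) => wbound_sym (sg k)).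
  have h2 : normc (pairing (g (set_coord t j tau)) (upd sg j (inr x))) <= Y' * expR (b n * x ^+ 2).
    have := IH (ltnW md) _ (upd sg j (inr x)) (upd C j (Y n * expR (b n * x ^+ 2))) Lt'.
    rewrite prod_upd M'E => h.
    rewrite (_ : Y' * _ = M' * (Y n * expR (b n * x ^+ 2) * \prod_(k0 | k0 != j) C k0)); last first.
      by rewrite /Y'; ring.
    apply: h => l.
      move=> lm; have lj : l != j by rewrite -val_eqE /= ltn_eqF.
      by rewrite /upd (negPf lj); apply: Hlo; exact: ltnW.
    move=> ml; rewrite /upd; case: eqVneq => [_|lj]; first exact: wbound_bargmann.
    by apply: Hhi; rewrite ltn_neqAle ml andbT eq_sym.
  set s := \sum_(_ < N) _ in h1 *.
  have -> : s = pairing (g (set_coord t j tau)) (upd sg j (inr x)) -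
     (pairing (g (set_coord t j tau)) (upd sg j (inr x)) - s) by rewrite opprB addrC subrK.
  apply: le_trans (normcD_le _ _) _; rewrite normc_opp; apply: lerD h2 _.
  apply: le_trans h1 _; rewrite le_eqVlt; apply/orP; left; apply/eqP.
  by rewrite (exprMn _ (Kh R)) real_normK ?num_real// [2 * (_ * _)]mulrA -/B M'E -/P /A; ring.
have := (HK j).2 (tnth t0 j) a A B Y' (b n) A0 B0 Y'0 (andP (b2 n)).1 H1 H2 n (S n) (S0 n).
rewrite anorm -sgj upd_id => h.
rewrite (bigD1 j)//= Cj /coord_bound.
move: h; rewrite mulrAC ler_pdivrMr ?sqrt_fact_gt0// -ler_pdivlMr ?exprn_gt0//.
move/le_trans; apply; rewrite le_eqVlt; apply/orP; left; apply/eqP.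
by rewrite /Y'; ring.
Qed.

Lemma coef_bound_of_transforms alpha :
  normc (f alpha) <= 2 * M * pi ^+ d * \prod_(j < d) coord_bound j (tnth alpha j).
Proof.
have L0 := Lambda_base.
have E : pairing (g t0) (fun j => inl (tnth alpha j)) = frac_fourier t0 f alpha.
  exact: pairing_pure (gf L0) _.
rewrite -(normc_frac_fourier t0) -E.
apply: (pairing_coord_bound (leqnn d)) => // k; first by exists (tnth alpha k).
by move=> dk; have := leq_trans (ltn_ord k) dk; rewrite ltnn.
Qed.

End Lattice.

(** * Weighted essential suprema *)

Section WeightedNorm.
Variables (R : realType) (d : nat).
Local Notation mu := (lebesgue_tuple R d).
Implicit Types (f : hermite_series R d) (W : d.-tuple R -> R).

Lemma lebesgue_tuple_setT_gt0 : (0 < mu setT)%E.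
Proof.
have -> : [set: d.-tuple R] = [set x | forall i, (fun=> setT : set R) (i : 'I_d) (tnth x i)].
  by apply/seteqP; split.
rewrite (@lebesgue_tuple_box R d (fun=> setT))//; apply: (big_ind (fun x => 0 < x)%E) => [//|x y|i _]; first exact: mule_gt0.
by rewrite -set_itvNyy lebesgue_measure_itv/= ltry.
Qed.

Lemma Lnorm_oo_le (h : d.-tuple R -> R) (L : R) :
  ('N[mu]_+oo[(fun x => (h x)%:E)] <= L%:E)%E <-> \forall x \ae mu, `|h x| <= L.
Proof.
rewrite unlock lebesgue_tuple_setT_gt0.
split.
  by move/ess_supP; apply: filterS => x; rewrite /= lee_fin.
by move=> hL; apply/ess_supP; apply: filterS hL => x; rewrite /= lee_fin.
Qed.

Lemma weighted_Linfty_norm_le W f g (L : R) : represents g f ->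
  (forall x, normc (g x) * `|W x| <= L) -> (weighted_Linfty_norm W f <= L%:E)%E.
Proof.
move=> gf gL; apply: (@le_trans _ _ ('N[mu]_+oo[(fun x => (normc (g x) * W x)%:E)])%E).
  by apply: ereal_inf_lbound; exists g.
apply/Lnorm_oo_le; apply: aeW => x.
by rewrite normrM ger0_norm ?normc_ge0.
Qed.

Lemma weighted_Linfty_norm_lt W f (L : R) : (weighted_Linfty_norm W f < L%:E)%E ->
  exists2 g, represents g f & \forall x \ae mu, `|normc (g x) * W x| <= L.
Proof.
move=> /ereal_inf_lt[_ [g gf <-] gL]; exists g => //.
by apply/Lnorm_oo_le; exact: ltW.
Qed.

End WeightedNorm.

Section Weight.
Variables (R : realType) (d : nat).
Local Notation mu := (lebesgue_tuple R d).
Variables (phi : R -> R) (Phi : d.-tuple R -> R) (c1 c2 : R).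
Hypothesis c10 : 0 <= c1.
Hypothesis c20 : 0 <= c2.
Hypothesis phi_ge0 : forall y, 0 <= phi y.
Hypothesis mphi : measurable_fun setT phi.
Hypothesis gauss_dom : forall r, 0 <= r ->
  exists Y, forall y, (1 + y ^+ 2) * expR (r * phi y) <= Y * expR (y ^+ 2 / 2).
Hypothesis Phi_le : forall x, Phi x <= c1 * \sum_(j < d) phi (tnth x j).
Hypothesis Phi_ge : forall x, \sum_(j < d) phi (tnth x j) <= c2 * Phi x.

Definition gauss_weight (r : R) (x : d.-tuple R) : R :=
  expR (1 / 2 * enorm x ^+ 2) * expR (- r * Phi x).

(** The constant L does not depend on t, because the moduli of the coefficients
    are the same for all the transforms. *)
Lemma weighted_norm_of_coef (f : hermite_series R d) (gam : nat -> R) (A K r : R) :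
  0 <= A -> (forall n, 0 <= gam n) -> 0 <= r ->
  (forall alpha, normc (f alpha) <= A * \prod_(j < d) gam (tnth alpha j)) ->
  (forall n y, gam n * `|hp n y| <= K * 2 ^- n * expR (r * phi y)) ->
  exists L, forall t,
    (weighted_Linfty_norm (gauss_weight (r * c2)) (frac_fourier t f) <= L%:E)%E.
Proof.
move=> A0 gam0 r0 fA gamK.
have K0 : 0 <= K.
  have := gamK 0%N 0; rewrite expr0 invr1 mulr1 => h.
  have : 0 <= K * expR (r * phi 0) by apply: le_trans h; rewrite mulr_ge0.
  by rewrite pmulr_lge0// expR_gt0.
pose G y := 2 * K * expR (r * phi y) * expR (- y ^+ 2 / 2).
have sumG y N : \sum_(n < N) gam n * `|hf n y| <= G y.
  apply: (@le_trans _ _ (\sum_(n < N) (K * 2 ^- n * expR (r * phi y)) * expR (- y ^+ 2 / 2))).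
    apply: ler_sum => n _; rewrite /hf normrM (ger0_norm (expR_ge0 _)) mulrA.
    by rewrite ler_wpM2r ?expR_ge0.
  rewrite -!mulr_suml -mulr_sumr ler_wpM2r ?expR_ge0// ler_wpM2r ?expR_ge0//.
  rewrite mulrC ler_wpM2r//.
  by have := sum_geom_half R 0 N; rewrite big_mkord expr0 invr1 mulr1.
have mG : measurable_fun setT G.
  apply: measurable_funM.
    apply: measurable_funM; first exact: measurable_cst.
    apply: measurableT_comp; first exact: measurable_expR.
    by apply: measurable_funM; first exact: measurable_cst.
  apply: continuous_measurable_fun => y.
  apply: continuous_comp; last exact: continuous_expR.
  apply: cvgM; last exact: cvg_cst.
  by apply: cvgN; apply: exprn_continuous.
have [Y HY] := gauss_dom r0.
have decG n : exists C, forall y, G y * `|hf n y| * (1 + y ^+ 2) <= C.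
  exists (2 * K * Y * (2 * Kh R ^+ n)) => y.
  have h := expR_gauss_hp_bound n y.
  rewrite /G /hf normrM (ger0_norm (expR_ge0 _)).
  rewrite (_ : _ * (1 + _) = 2 * K * (((1 + y ^+ 2) * expR (r * phi y)) * expR (- y ^+ 2 / 2) *
     (expR (- y ^+ 2 / 2) * `|hp n y|))); last by ring.
  rewrite -[leRHS]mulrA ler_wpM2l ?mulr_ge0//.
  apply: ler_pM => //; rewrite ?mulr_ge0 ?expR_ge0 ?addr_ge0 ?sqr_ge0//.
  apply: (@le_trans _ _ (Y * expR (y ^+ 2 / 2) * expR (- y ^+ 2 / 2))).
    by rewrite ler_wpM2r ?expR_ge0.
  by rewrite -mulrA -expRD mulNr addrN expR0 mulr1.
exists (2 * A * (2 * K) ^+ d) => t.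
have fA' alpha : normc (frac_fourier t f alpha) <= A * \prod_(j < d) gam (tnth alpha j).
  by rewrite normc_frac_fourier.
have [g gf gG] := hermite_synthesis_complex A0 gam0 fA' sumG mG decG.
apply: weighted_Linfty_norm_le gf _ => x.
rewrite /gauss_weight normrM !(ger0_norm (expR_ge0 _)).
apply: (@le_trans _ _ (2 * A * \prod_(j < d) G (tnth x j) * (expR (1 / 2 * enorm x ^+ 2) * expR (- (r * c2) * Phi x)))).
  by rewrite ler_wpM2r// mulr_ge0 ?expR_ge0.
rewrite -[leLHS]mulrA ler_wpM2l ?mulr_ge0// expR_enorm_sqr.
rewrite mulrA -big_split/=.
rewrite (eq_bigr (fun j => 2 * K * expR (r * phi (tnth x j)))); last first.
  move=> j _; rewrite /G -[LHS]mulrA -expRD mulNr mul1r [2^-1 * _]mulrC addNr.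
  by rewrite expR0 mulr1.
rewrite big_split/= prodr_const card_ord -mulrA ler_piMr ?exprn_ge0 ?mulr_ge0//.
rewrite -expR_sum -expRD -expR0 ler_expR -mulr_sumr mulNr -mulrA -mulrBr.
by rewrite mulr_ge0_le0// subr_le0.
Qed.

Lemma wdecay_of_weighted_norm (f : hermite_series R d) (r L : R) : 0 <= r ->
  (weighted_Linfty_norm (gauss_weight r) f < L%:E)%E ->
  exists2 g, represents g f &
    wdecay (fun y => expR (r * c1 * phi y)) L (fun x => normc (g x)).
Proof.
move=> r0 /weighted_Linfty_norm_lt[g gf gL]; exists g => //.
apply: filterS gL => x.
rewrite /gauss_weight !normrM !(ger0_norm (normc_ge0 _)) !(ger0_norm (expR_ge0 _)) => gL.
have L0 : 0 <= L by apply: le_trans gL; rewrite !mulr_ge0 ?normc_ge0 ?expR_ge0.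
rewrite -expRD -ler_pdivlMr ?expR_gt0// -expRN in gL.
apply: le_trans gL _; rewrite ler_wpM2l//.
rewrite (eq_bigr (fun j => expR (r * c1 * phi (tnth x j)) * expR (- (1 / 2) * tnth x j ^+ 2))); last first.
  by move=> j _; congr (_ * expR _); rewrite !mulNr mul1r [2^-1 * _]mulrC.
rewrite big_split/= -(expR_enorm_sqr (- (1 / 2)) x) -expR_sum -expRD -mulr_sumr.
have := ler_wpM2l r0 (Phi_le x).
move: (Phi x) (\sum_(_ < d) _) (enorm x ^+ 2) => P Sg E h.
by rewrite ler_expR; lra.
Qed.

End Weight.

(** * Inequalities between powers, logarithms and exponentials *)

Section PowerInequalities.
Variable R : realType.
Implicit Types (a b p q r x y : R).

Lemma ler_powR2 p x y : 0 <= p -> 0 <= x -> x <= y -> x `^ p <= y `^ p.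
Proof. by move=> p0 x0 xy; rewrite ge0_ler_powR// nnegrE// (le_trans x0). Qed.

Lemma powR_sum_le d (F : 'I_d -> R) q : (0 < d)%N -> 0 <= q -> (forall j, 0 <= F j) ->
  (\sum_j F j) `^ q <= d%:R `^ q * \sum_j F j `^ q.
Proof.
move=> d0 q0 F0.
case: (Order.TotalTheory.arg_maxP (i0 := Ordinal d0) F (P := xpredT) isT) => j _ Fj.
apply: (@le_trans _ _ ((d%:R * F j) `^ q)).
  apply: ler_powR2 => //; first by apply: sumr_ge0.
  apply: (@le_trans _ _ (\sum_(i < d) F j)).
    by apply: ler_sum => i _; exact: Fj.
  by rewrite sumr_const card_ord mulr_natl.
rewrite powRM// ler_wpM2l ?powR_ge0// (bigD1 j)//= lerDl.
by apply: sumr_ge0 => i _; exact: powR_ge0.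
Qed.

Lemma powRD_le a b q : 0 <= q -> 0 <= a -> 0 <= b ->
  (a + b) `^ q <= 2 `^ q * (a `^ q + b `^ q).
Proof.
move=> q0 a0 b0.
have := @powR_sum_le 2 (fun i => if i == ord0 then a else b) q isT q0.
rewrite !big_ord_recl !big_ord0/= !addr0; apply => j.
by case: ifP.
Qed.

(** The two terms on the right take over according to the size of x. *)
Lemma powR_le_eps a p e : 0 <= a -> a < p -> 0 < e ->
  exists2 C, 0 <= C & forall x, 0 <= x -> x `^ a <= e * x `^ p + C.
Proof.
move=> a0 ap e0; pose T := e^-1 `^ (p - a)^-1.
have pa : 0 < p - a by rewrite subr_gt0.
have T0 : 0 < T by rewrite powR_gt0// invr_gt0.
exists (T `^ a); first exact: powR_ge0.
move=> x x0; have [xT|Tx] := leP x T.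
  by rewrite -[leLHS]add0r lerD ?ler_powR2// mulr_ge0 ?powR_ge0// ltW.
have x0' : 0 < x by exact: lt_trans Tx.
rewrite ler_wpDr ?powR_ge0//.
have -> : x `^ p = x `^ (p - a) * x `^ a.
  by rewrite -powRD ?subrK// (gt_eqF x0') implybT.
rewrite mulrA ler_peMl ?powR_ge0//.
have : T `^ (p - a) <= x `^ (p - a) by rewrite ler_powR2 ?ltW.
rewrite /T -powRrM mulVf ?gt_eqF// powRr1 ?invr_ge0 ?(ltW e0)// => h.
by rewrite -(ler_pM2l e0) mulfV ?gt_eqF// in h.
Qed.

(** From log(x^p) <= x^p - 1. *)
Lemma ln_le_powR p x : 0 < p -> 0 < x -> ln x <= x `^ p / p.
Proof.
move=> p0 x0; rewrite ler_pdivlMr// mulrC -ln_powR.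
have xp : 0 < x `^ p by exact: powR_gt0.
have := @le_ln1Dx R (x `^ p - 1).
rewrite [1 + _]addrC subrK => h; apply: (le_trans (h _)); first by lra.
by lra.
Qed.

Lemma powR_absorbed_by_expR q r : 0 <= q -> 0 <= r ->
  exists2 C, 0 <= C & forall x, 0 <= x -> 2 * x + r * x `^ q <= C + (expR (2 * x) - 1).
Proof.
move=> q0 r0; pose m := (Num.truncn q).+1; pose c := 2 + r * (m`!%:R + 1).
have c0 : 0 <= c by rewrite addr_ge0// mulr_ge0// addr_ge0.
exists (c ^+ 2 + 1); first by rewrite addr_ge0 ?sqr_ge0.
move=> x x0.
have e1 : 1 <= expR x by rewrite -expR0 ler_expR.
have ex : x <= expR x by apply: le_trans (expR_ge1Dx x); rewrite lerDr.
have xq : x `^ q <= (m`!%:R + 1) * expR x.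
  rewrite mulrDl mul1r; have [x1|x1] := leP x 1.
    rewrite -[leLHS]add0r lerD ?mulr_ge0 ?expR_ge0//.
    by apply: le_trans e1; have := ler_powR2 q0 x0 x1; rewrite powR1.
  apply: (@le_trans _ _ (x ^+ m)).
    by rewrite -powR_mulrn// ler_powR ?ltW// truncnS_gt.
  have := pow_fact_le_expR m x0; rewrite ler_pdivrMr ?ltr0n ?fact_gt0// mulrC => h.
  by rewrite -[leLHS]addr0 lerD ?expR_ge0.
have e2 : expR (2 * x) = expR x ^+ 2 by rewrite mulrC expRM_natr.
have h : 2 * x + r * x `^ q <= c * expR x.
  by rewrite /c [leRHS]mulrDl lerD ?ler_wpM2l// -[leRHS]mulrA ler_wpM2l.
apply: (le_trans h); rewrite e2; have := sqr_ge0 (c - expR x); nra.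
Qed.

End PowerInequalities.

(** * Brackets and norms in terms of the coordinates *)

Section LogBracket.
Variable R : realType.
Implicit Types (y S : R).

(** The logarithm of the Japanese bracket of a real number. *)
Definition lbr y : R := ln (1 + y ^+ 2) / 2.

Lemma addsqr_ge1 y : 1 <= 1 + y ^+ 2.
Proof. by rewrite lerDl sqr_ge0. Qed.

Lemma addsqr_gt0 y : 0 < 1 + y ^+ 2.
Proof. exact: lt_le_trans (addsqr_ge1 y). Qed.

Lemma expR_lbr2 y : expR (2 * lbr y) = 1 + y ^+ 2.
Proof. by rewrite /lbr mulrC divfK// lnK// posrE addsqr_gt0. Qed.

Lemma lbr_ge0 y : 0 <= lbr y.
Proof. by rewrite divr_ge0// ln_ge0// addsqr_ge1. Qed.

Lemma normr_le_expR_lbr y : `|y| <= expR (lbr y).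
Proof.
rewrite -(ler_pXn2r (n := 2)) ?nnegrE ?expR_ge0// -expRM_natr mulrC expR_lbr2.
by rewrite real_normK ?num_real// lerDr.
Qed.

(** From <y> <= S <y/S>. *)
Lemma lbr_scale y S : 1 <= S -> lbr y <= ln S + lbr (y / S).
Proof.
move=> S1; have S0 : 0 < S by exact: lt_le_trans S1.
rewrite -(ler_pM2l (ltr0n R 2)) -ler_expR expR_lbr2 mulrDr expRD expR_lbr2.
rewrite [2 * ln S]mulrC expRM_natr lnK ?posrE// mulrDr mulr1 -exprMn [S * _]mulrC divfK ?gt_eqF//.
by rewrite lerD2r -[leLHS](expr1n _ 2) ler_pXn2r ?nnegrE// ltW.
Qed.

Lemma measurable_lbr : measurable_fun setT lbr.
Proof.
apply: measurable_funM; last exact: measurable_cst.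
apply: measurableT_comp; first exact: measurable_ln.
apply: measurable_funD; first exact: measurable_cst.
by apply: continuous_measurable_fun; exact: exprn_continuous.
Qed.

Variable d : nat.
Implicit Types x : d.-tuple R.

Lemma ln_bracket x : ln (bracket x) = ln (1 + enorm x ^+ 2) / 2.
Proof.
have h : 0 < 1 + enorm x ^+ 2 by exact: addsqr_gt0.
by rewrite /bracket -powR12_sqrt ?ltW// ln_powR mulrC.
Qed.

Lemma lbr_le_ln_bracket x j : lbr (tnth x j) <= ln (bracket x).
Proof.
rewrite ln_bracket ler_wpM2r// ler_ln ?posrE ?addsqr_gt0// lerD2l enorm_sqr.
by rewrite (bigD1 j)//= lerDl sumr_ge0// => i _; rewrite sqr_ge0.
Qed.

Lemma ln_bracket_le x : ln (bracket x) <= \sum_(j < d) lbr (tnth x j).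
Proof.
rewrite ln_bracket ler_pdivrMr// mulrC -ler_expR lnK ?posrE ?addsqr_gt0//.
rewrite enorm_sqr mulr_sumr expR_sum.
suff [_] : 0 <= \sum_(j < d) tnth x j ^+ 2 /\
  1 + \sum_(j < d) tnth x j ^+ 2 <= \prod_(j < d) expR (2 * lbr (tnth x j)) by [].
apply: (big_ind2 (fun s p => 0 <= s /\ 1 + s <= p)).
- by rewrite addr0.
- move=> s p s' p' [s0 sp] [s0' sp']; split; first exact: addr_ge0.
  apply: (@le_trans _ _ ((1 + s) * (1 + s'))); last by rewrite ler_pM ?addr_ge0.
  by have := mulr_ge0 s0 s0'; nra.
- by move=> j _; rewrite expR_lbr2 sqr_ge0.
Qed.

Lemma normr_le_enorm x j : `|tnth x j| <= enorm x.
Proof.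
rewrite -sqrtr_sqr ler_wsqrtr// (bigD1 j)//= lerDl.
by apply: sumr_ge0 => i _; exact: sqr_ge0.
Qed.

Lemma enorm_le x : enorm x <= \sum_(j < d) `|tnth x j|.
Proof.
rewrite -(ler_pXn2r (n := 2)) ?nnegrE ?sqrtr_ge0 ?sumr_ge0// enorm_sqr.
suff [_] : 0 <= \sum_(j < d) `|tnth x j| /\
  \sum_(j < d) tnth x j ^+ 2 <= (\sum_(j < d) `|tnth x j|) ^+ 2 by [].
apply: (big_ind2 (fun s p => 0 <= s /\ p <= s ^+ 2)).
- by rewrite expr0n.
- move=> s p s' p' [s0 sp] [s0' sp']; split; first exact: addr_ge0.
  by have := mulr_ge0 s0 s0'; nra.
- by move=> j _; rewrite real_normK ?num_real.
Qed.

End LogBracket.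

(** * Gaussian majorants of the weights *)

Section Growth.
Variable R : realType.
Implicit Types (phi psi : R -> R) (q k y S r kap : R).

(** The trade-off on which the decay of the coefficients rests: the weight has a
    Gaussian majorant Y exp(b y^2) whose contribution Y exp(kap b S^2) to the
    Cauchy estimate at the radius S is of the size exp(r1 psi(S)), up to S^2. *)
Definition gauss_growth phi psi := forall r kap, 0 <= r -> 0 <= kap ->
  exists C r1 S0, [/\ 0 <= C, 0 <= r1, 1 <= S0 & forall S, S0 <= S -> exists Y b,
    [/\ 0 <= b <= 1 / 2,
        forall y, (1 + y ^+ 2) * expR (r * phi y) <= Y * expR (b * y ^+ 2) &
        Y * expR (kap * b * S ^+ 2) <= C * S ^+ 2 * expR (r1 * psi S)]].

Lemma gauss_growth_dom phi psi r : gauss_growth phi psi -> 0 <= r ->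
  exists Y, forall y, (1 + y ^+ 2) * expR (r * phi y) <= Y * expR (y ^+ 2 / 2).
Proof.
move=> H r0; have [C [r1 [S0 [_ _ _ /(_ S0 (lexx _))]]]] := H r 0 r0 (lexx _).
move=> [Y [b [/andP[b0 b2] h _]]]; exists Y => y.
have Y0 : 0 <= Y.
  have := h 0; rewrite expr0n/= mulr0 expR0 mulr1; apply: le_trans.
  by rewrite mulr_ge0 ?expR_ge0 ?addr_ge0.
apply: le_trans (h y) _; rewrite ler_wpM2l// ler_expR [leRHS]mulrC.
by rewrite -div1r ler_wpM2r ?sqr_ge0.
Qed.

(** Write y = S z. Then log <y> <= log S + log <z>, and the powers of log <z>
    are absorbed by exp(z^2); so b = S^-2. *)
Lemma log_gauss_growth q : 0 <= q ->
  gauss_growth (fun y => lbr y `^ q) (fun S => ln S `^ q).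
Proof.
move=> q0 r kap r0 kap0.
have r20 : 0 <= r * 2 `^ q by rewrite mulr_ge0 ?powR_ge0.
have [C C0 HC] := powR_absorbed_by_expR q0 r20.
exists (expR C * expR kap), (r * 2 `^ q), 2; split; rewrite ?mulr_ge0 ?expR_ge0//.
- by rewrite ler1n.
move=> S S2; have S1 : 1 <= S by apply: le_trans S2; rewrite ler1n.
have S0 : 0 < S by apply: lt_le_trans S1.
exists (S ^+ 2 * expR (C + r * 2 `^ q * ln S `^ q)), (S ^- 2); split.
- rewrite invr_ge0 exprn_ge0 ?(ltW S0)//= -[leLHS]mul1r ler_pdivrMr ?exprn_gt0//.
  by nra.
- move=> y.
  have lS := ln_ge0 S1.
  have l0 := lbr_ge0 (y / S).
  have e1 : 1 + y ^+ 2 <= S ^+ 2 * expR (2 * lbr (y / S)).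
    rewrite -[leLHS]expR_lbr2 -[X in X ^+ 2](lnK (x := S)) ?posrE// -expRM_natr -expRD ler_expR.
    by rewrite [_ * 2]mulrC -mulrDr ler_wpM2l// lbr_scale.
  have e2 : r * lbr y `^ q <= r * 2 `^ q * (ln S `^ q + lbr (y / S) `^ q).
    rewrite -mulrA ler_wpM2l//; apply: le_trans (powRD_le _ _ _) => //.
    by rewrite ler_powR2 ?lbr_ge0 ?lbr_scale.
  apply: (@le_trans _ _ (S ^+ 2 * expR (2 * lbr (y / S)) * expR (r * 2 `^ q * (ln S `^ q + lbr (y / S) `^ q)))).
    by apply: ler_pM; rewrite ?expR_ge0 ?addr_ge0 ?sqr_ge0 ?ler_expR.
  rewrite -[leLHS]mulrA -[leRHS]mulrA ler_wpM2l ?sqr_ge0// -!expRD ler_expR.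
  have := HC _ l0; rewrite expR_lbr2.
  have -> : (y / S) ^+ 2 = S ^- 2 * y ^+ 2 by rewrite exprMn exprVn mulrC.
  by rewrite -!mulrA => h; lra.
rewrite -[kap * _ * _]mulrA mulVf ?expf_neq0 ?gt_eqF// mulr1 expRD.
by rewrite le_eqVlt; apply/orP; left; apply/eqP; ring.
Qed.

(** If |y| <= S then |y|^k <= S^k, and otherwise |y|^k <= S^(k-2) y^2; so b is
    of the order of S^(k-2), which is small for large S because k < 2. *)
Lemma pow_gauss_growth k : 0 < k < 2 ->
  gauss_growth (fun y => `|y| `^ k) (fun S => S `^ k).
Proof.
move=> /andP[k0 k2] r kap r0 kap0.
have c0 : 0 < 2 - k by rewrite subr_gt0.
have r10 : 0 <= r + 1 by rewrite addr_ge0.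
pose S0 := Num.max 1 ((2 * (r + 1)) `^ (2 - k)^-1).
exists 1, (r + kap * (r + 1)), S0; split=> //.
- by rewrite addr_ge0// mulr_ge0.
- by rewrite le_max lexx.
move=> S; rewrite ge_max => /andP[S1 Sr].
have Sp : 0 < S by apply: lt_le_trans S1.
have s0 : 0 <= S by exact: ltW.
pose P := S `^ (2 - k).
have P0 : 0 < P by exact: powR_gt0.
have S2 : S ^+ 2 = S `^ k * P.
  by rewrite /P -powRD ?(gt_eqF Sp) ?implybT// addrC subrK powR_mulrn.
have Sk : 1 <= S `^ k by have := ler_powR2 (ltW k0) ler01 S1; rewrite powR1.
have P1 : 1 <= P by have := ler_powR2 (ltW c0) ler01 S1; rewrite powR1.
have Pr : 2 * (r + 1) <= P.
  have := ler_powR2 (ltW c0) (powR_ge0 _ _) Sr.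
  by rewrite -powRrM mulVf ?(gt_eqF c0)// powRr1// mulr_ge0.
exists (S ^+ 2 * expR (r * S `^ k)), ((r + 1) / P); split.
- by rewrite divr_ge0 ?(ltW P0)//= ler_pdivrMr//; lra.
- move=> y.
  have yk : `|y| `^ k <= S `^ k + y ^+ 2 / P.
    have [yS|Sy] := leP `|y| S.
      rewrite -[leLHS]addr0 lerD ?ler_powR2 ?(ltW k0)// divr_ge0 ?sqr_ge0 ?(ltW P0)//.
    rewrite -[leLHS]add0r lerD ?powR_ge0// ler_pdivlMr//.
    have y0 : 0 < `|y| by exact: lt_trans Sy.
    apply: (@le_trans _ _ (`|y| `^ k * `|y| `^ (2 - k))).
      by rewrite ler_wpM2l ?powR_ge0// ler_powR2 ?(ltW c0)// ltW.
    rewrite -powRD ?(gt_eqF y0) ?implybT// addrC subrK powR_mulrn//.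
    by rewrite real_normK ?num_real.
  have e1 : 1 + y ^+ 2 <= S ^+ 2 * expR (y ^+ 2 / P).
    apply: (@le_trans _ _ (P * expR (y ^+ 2 / P))).
      apply: (@le_trans _ _ (P * (1 + y ^+ 2 / P))).
        by rewrite mulrDr mulr1 mulrC divfK ?(gt_eqF P0)// lerD2r.
      by rewrite ler_wpM2l ?(ltW P0)// expR_ge1Dx.
    by rewrite ler_wpM2r ?expR_ge0// S2 ler_peMl// ltW.
  apply: (@le_trans _ _ (S ^+ 2 * expR (y ^+ 2 / P) * expR (r * (S `^ k + y ^+ 2 / P)))).
    by apply: ler_pM; rewrite ?expR_ge0 ?addr_ge0 ?sqr_ge0// ler_expR ler_wpM2l.
  rewrite -[leLHS]mulrA -[leRHS]mulrA ler_wpM2l ?sqr_ge0// -!expRD ler_expR.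
  by rewrite le_eqVlt; apply/orP; left; apply/eqP; ring.
rewrite mul1r -[leLHS]mulrA ler_wpM2l ?sqr_ge0// -expRD ler_expR.
rewrite [in X in _ + X]S2 le_eqVlt; apply/orP; left; apply/eqP.
have Pn : P != 0 by exact: lt0r_neq0.
by clear -Pn; move: P (S `^ k) Pn => p w pn; field.
Qed.

End Growth.

(** * From the lattice to a bound of the coefficients *)

Section CoefficientDecay.
Variables (R : realType) (d : nat) (t0 u : d.-tuple R).
Hypothesis hu : forall j, 0 < tnth u j < 1.
Variables (phi psi : R -> R) (Phi : d.-tuple R -> R) (c1 : R).
Hypothesis c10 : 0 <= c1.
Hypothesis Phi_le : forall x, Phi x <= c1 * \sum_(j < d) phi (tnth x j).
Hypothesis growth : gauss_growth phi psi.

(** The factor that a coordinate with index n contributes to the bound of a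
    coefficient, for the radius S. *)
Definition cauchy_factor (C r1 S : R) n : R :=
  Num.sqrt n`!%:R * (C * S ^+ 2 * expR (r1 * psi S)) / S ^+ n.

(** The radius may be chosen separately for each index: this is what allows one
    to optimize it, and to let it tend to infinity when s = 0. *)
Lemma coef_bound_of_norms (f : hermite_series R d) (r L : R) : 0 <= r -> 0 <= L ->
  (forall t, Lambda t0 u t ->
    (weighted_Linfty_norm (gauss_weight Phi r) (frac_fourier t f) < L%:E)%E) ->
  exists M C r1 S0, [/\ 0 <= M, 0 <= C, 0 <= r1, 1 <= S0 &
    forall S : nat -> R, (forall n, S0 <= S n) -> forall alpha,
    normc (f alpha) <= M * \prod_(j < d) cauchy_factor C r1 (S (tnth alpha j)) (tnth alpha j)].
Proof.
move=> r0 L0 fL.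
have /choice[K HK] : forall j, exists k, lattice_const (tnth u j) k.
  by move=> j; have [k k0 h] := coef_bound_of_lattice (hu j); exists k.
have /choice[g Hg] : forall t, exists g, Lambda t0 u t ->
    represents g (frac_fourier t f) /\
    wdecay (fun y => expR (r * c1 * phi y)) L (fun x => normc (g x)).
  move=> t; have [Lt|nLt] := pselect (Lambda t0 u t); last by exists (fun=> 0).
  by have [g ? ?] := wdecay_of_weighted_norm Phi_le r0 (fL t Lt); exists g.
have rc : 0 <= r * c1 by exact: mulr_ge0.
have K0 j : 0 <= K j by apply: ltW; exact: (HK j).1.
have kap0 : 0 <= \sum_j K j by apply: sumr_ge0.
have [Y0 HY0] := gauss_growth_dom growth rc.
have [C [r1 [S0 [C0 r10 S01 H]]]] := growth rc kap0.
exists (2 * L * pi ^+ d), C, r1, S0; split=> //.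
  by rewrite !mulr_ge0 ?exprn_ge0 ?pi_ge0.
move=> S HS alpha.
have /choice[Yb HYb] : forall n, exists Yb : R * R,
    [/\ 0 <= Yb.2 <= 1 / 2,
        forall y, (1 + y ^+ 2) * expR (r * c1 * phi y) <= Yb.1 * expR (Yb.2 * y ^+ 2) &
        Yb.1 * expR ((\sum_j K j) * Yb.2 * S n ^+ 2) <= C * S n ^+ 2 * expR (r1 * psi (S n))].
  by move=> n; have [Y [b h]] := H _ (HS n); exists (Y, b).
have Sp n : 0 < S n by apply: lt_le_trans (HS n); apply: lt_le_trans S01.
have b2 n : 0 <= (Yb n).2 <= 1 / 2 by case: (HYb n).
have vY n y : (1 + y ^+ 2) * expR (r * c1 * phi y) <= (Yb n).1 * expR ((Yb n).2 * y ^+ 2).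
  by case: (HYb n).
have Ybn0 n : 0 <= (Yb n).1.
  have := vY n 0; rewrite [0 ^+ 2]expr0n/= mulr0 expR0 mulr1; apply: le_trans.
  by rewrite mulr_ge0 ?expR_ge0 ?addr_ge0.
have := coef_bound_of_transforms (fun y => expR_ge0 (r * c1 * phi y)) HY0 L0
  (fun t Lt => (Hg t Lt).1) (fun t Lt => (Hg t Lt).2) HK Sp b2 vY alpha.
move=> h; apply: (le_trans h); rewrite ler_wpM2l//.
  by rewrite !mulr_ge0 ?exprn_ge0 ?pi_ge0.
apply: ler_prod => j _; set n := tnth alpha j.
rewrite /coord_bound /cauchy_factor; apply/andP; split.
  by rewrite !mulr_ge0 ?sqrtr_ge0 ?Ybn0 ?expR_ge0// invr_ge0 exprn_ge0// ltW.
rewrite ler_wpM2r ?invr_ge0 ?exprn_ge0 ?(ltW (Sp _))// ler_wpM2l ?sqrtr_ge0//.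
have [_ _] := HYb n; apply: le_trans; rewrite ler_wpM2l// ler_expR.
have /andP[b0 _] := b2 n.
rewrite ler_wpM2r ?sqr_ge0// ler_wpM2r// (bigD1 j)//= lerDl.
by apply: sumr_ge0.
Qed.

End CoefficientDecay.

(** * Weighted sums of Hermite functions *)

Section HermiteWeights.
Variable R : realType.
Implicit Types (rho p q y a k B : R) (n N : nat).

(** This form of [hp_bound] is linear in log <y> once the logarithm is taken. *)
Lemma hp_lbr_bound n y :
  `|hp n y| <= 2 * 2 ^- n * expR (n%:R * (ln (2 * Kh R) + lbr y)).
Proof.
have K1 := Kh_ge1 R; have K0 : 0 < Kh R by exact: lt_le_trans K1.
have e1 : 1 <= expR (lbr y) by rewrite -expR0 ler_expR lbr_ge0.
rewrite [n%:R * _]mulrC expRM_natr expRD lnK ?posrE ?mulr_gt0//.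
apply: (le_trans (hp_bound n y)).
have s1 : 1 <= Num.sqrt n`!%:R :> R.
  by rewrite -[leLHS](sqrtr1 R) ler_wsqrtr// ler1n fact_gt0.
have h : 1 + `|y| ^+ n / Num.sqrt n`!%:R <= expR (lbr y) ^+ n * 2.
  rewrite mulr_natr mulr2n lerD ?exprn_ege1//.
  apply: (@le_trans _ _ (`|y| ^+ n)).
    by rewrite ler_pdivrMr ?sqrt_fact_gt0// ler_peMr ?exprn_ge0.
  by rewrite lerXn2r ?nnegrE ?expR_ge0// normr_le_expR_lbr.
have -> : 2 * 2 ^- n * (2 * Kh R * expR (lbr y)) ^+ n =
   Kh R ^+ n * (expR (lbr y) ^+ n * 2) * (2 ^+ n / 2 ^+ n).
  by move: (Kh R) => K; rewrite !exprMn; ring.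
by rewrite mulfV ?expf_neq0 ?pnatr_eq0// mulr1 ler_wpM2l// exprn_ge0// ltW.
Qed.

Lemma ln_2Kh_ge0 : 0 <= ln (2 * Kh R).
Proof. by rewrite ln_ge0//; have := Kh_ge1 R; lra. Qed.

Lemma hermite_weight_finite N : exists K r, 0 <= r /\ forall n y,
  (n <= N)%N%:R * `|hp n y| <= K * 2 ^- n * expR (r * lbr y `^ 1).
Proof.
exists (2 * expR (N%:R * ln (2 * Kh R))), N%:R; split=> // n y.
rewrite powRr1 ?lbr_ge0//; have [nN|nN] := leqP n N; last first.
  by rewrite mul0r !mulr_ge0 ?expR_ge0 ?invr_ge0 ?exprn_ge0.
rewrite mul1r; apply: (le_trans (hp_lbr_bound n y)).
rewrite [X in X * expR (N%:R * lbr y)]mulrAC -[leRHS]mulrA -expRD -mulrDr.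
rewrite ler_wpM2l ?divr_ge0 ?exprn_ge0// ler_expR ler_wpM2r ?ler_nat//.
by rewrite addr_ge0 ?ln_2Kh_ge0 ?lbr_ge0.
Qed.

(** Young's inequality for the conjugate exponents p and q, up to the constant.
    If L <= rho x^(p-1) the left-hand side is nonpositive; otherwise x is
    bounded by a power of L. *)
Lemma young_le rho p q x L : 0 < rho -> 1 < p -> (p - 1) * q = p -> 0 <= x -> 0 <= L ->
  x * L - rho * x `^ p <= rho `^ (- (p - 1)^-1) * L `^ q.
Proof.
move=> rho0 p1 pq x0 L0.
have pp : 0 < p - 1 by rewrite subr_gt0.
have xp : x `^ p = x * x `^ (p - 1).
  rewrite -{2}(powRr1 x0) -powRD ?[1 + _]addrC ?subrK//.
  by rewrite (gt_eqF (lt_trans ltr01 p1)).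
have [Lx|xL] := leP L (rho * x `^ (p - 1)).
  apply: (@le_trans _ _ 0); last by rewrite mulr_ge0 ?powR_ge0.
  by rewrite subr_le0 xp mulrCA ler_wpM2l.
apply: (@le_trans _ _ (x * L)); first by rewrite gerBl mulr_ge0 ?powR_ge0 ?(ltW rho0).
have Lp : 0 < L by apply: le_lt_trans xL; rewrite mulr_ge0 ?powR_ge0 ?(ltW rho0).
have xle : x <= (L / rho) `^ (p - 1)^-1.
  have : (x `^ (p - 1)) `^ (p - 1)^-1 <= (L / rho) `^ (p - 1)^-1.
    rewrite ler_powR2 ?invr_ge0 ?powR_ge0 ?(ltW pp)//.
    by rewrite ler_pdivlMr// mulrC ltW.
  by rewrite -powRrM mulfV ?(gt_eqF pp)// powRr1.
apply: (le_trans (ler_wpM2r L0 xle)).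
rewrite powRM ?invr_ge0 ?(ltW rho0)// -(powR_inv1 (ltW rho0)) -powRrM mulN1r.
have -> : L `^ q = L `^ (p - 1)^-1 * L.
  rewrite -{3}(powRr1 L0) -powRD ?(gt_eqF Lp) ?implybT//; congr powR.
  apply: (mulfI (lt0r_neq0 pp)); rewrite pq mulrDr mulfV ?(gt_eqF pp)//; lra.
by rewrite -mulrA mulrCA.
Qed.

(** With L = log(2K) + log <y> the left-hand side is of the size
    exp(n L - rho n^p). *)
Lemma hermite_weight_exp rho p q : 0 < rho -> 1 < p -> (p - 1) * q = p ->
  exists K r, 0 <= r /\ forall n y,
  expR (- (rho * n%:R `^ p)) * `|hp n y| <= K * 2 ^- n * expR (r * lbr y `^ q).
Proof.
move=> rho0 p1 pq.
have q0 : 0 <= q.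
  have pp : 0 < p - 1 by rewrite subr_gt0.
  by rewrite -(pmulr_rge0 _ pp) pq ltW// (lt_trans _ p1).
pose c := rho `^ (- (p - 1)^-1).
have c0 : 0 <= c by exact: powR_ge0.
exists (2 * expR (c * 2 `^ q * ln (2 * Kh R) `^ q)), (c * 2 `^ q); split.
  by rewrite mulr_ge0 ?powR_ge0.
move=> n y; apply: (le_trans (ler_wpM2l (expR_ge0 _) (hp_lbr_bound n y))).
have L0 : 0 <= ln (2 * Kh R) + lbr y by rewrite addr_ge0 ?ln_2Kh_ge0 ?lbr_ge0.
rewrite mulrCA [X in _ <= X * expR (_ * lbr y `^ q)]mulrAC -[leRHS]mulrA.
rewrite ler_wpM2l ?divr_ge0 ?exprn_ge0// -!expRD ler_expR addrC -mulrDr.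
apply: (le_trans (young_le rho0 p1 pq (ler0n _ n) L0)); rewrite -/c -mulrA ler_wpM2l//.
by rewrite powRD_le ?ln_2Kh_ge0 ?lbr_ge0.
Qed.

(** The left-hand side is the power a of the general term of the exponential
    series at X^(1/a). *)
Lemma pow_div_fact_powR (X a : R) n : 0 <= X -> 0 < a ->
  X ^+ n * n`!%:R `^ (- a) <= expR (a * X `^ a^-1).
Proof.
move=> X0 a0; have f0 : 0 < n`!%:R :> R by rewrite ltr0n fact_gt0.
have -> : X ^+ n * n`!%:R `^ (- a) = ((X `^ a^-1) ^+ n / n`!%:R) `^ a.
  rewrite powRM ?exprn_ge0 ?powR_ge0 ?invr_ge0 ?(ltW f0)//.
  rewrite -[in RHS](powR_inv1 (ltW f0)) -powRrM mulN1r; congr (_ * _).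
  rewrite -(powR_mulrn n (powR_ge0 X a^-1)) -!powRrM -(powR_mulrn n X0).
  by congr (X `^ _); field; exact: lt0r_neq0.
rewrite [a * _]mulrC expRM ler_powR2 ?(ltW a0) ?divr_ge0 ?exprn_ge0 ?powR_ge0 ?(ltW f0)//.
by rewrite pow_fact_le_expR ?powR_ge0.
Qed.

(** By [pow_div_fact_powR], the terms of the series behave like those of the
    exponential series raised to the power a or 1/k. *)
Lemma hermite_weight_fact B a k : 0 <= B -> 0 < a -> 0 < k -> k^-1 = 1 / 2 + a ->
  exists K r, 0 <= r /\ forall n y,
  B ^+ n * n`!%:R `^ (- a) * `|hp n y| <= K * 2 ^- n * expR (r * `|y| `^ k).
Proof.
move=> B0 a0 k0 ka.
have K1 := Kh_ge1 R; have K0 : 0 <= Kh R by exact: le_trans K1.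
pose X := 2 * Kh R * B.
have X0 : 0 <= X by rewrite !mulr_ge0.
have ki0 : 0 < k^-1 by rewrite invr_gt0.
exists (2 * expR (a * X `^ a^-1)), (k^-1 * X `^ k); split.
  by rewrite mulr_ge0 ?powR_ge0 ?ltW.
move=> n y; have f0 : 0 < n`!%:R :> R by rewrite ltr0n fact_gt0.
have h1 := pow_div_fact_powR n X0 a0.
have h2 := pow_div_fact_powR n (mulr_ge0 X0 (normr_ge0 y)) ki0.
rewrite invrK powRM// mulrA in h2.
have fk : n`!%:R `^ (- k^-1) = n`!%:R `^ (- a) / Num.sqrt n`!%:R :> R.
  rewrite ka opprD addrC powRD ?(gt_eqF f0) ?implybT//; congr (_ * _).
  by rewrite powRN div1r powR12_sqrt// ltW.
rewrite -(ler_pM2r (x := 2 ^+ n)) ?exprn_gt0//.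
rewrite [leRHS]mulrAC divfK ?expf_neq0 ?pnatr_eq0//.
apply: (@le_trans _ _ (X ^+ n * n`!%:R `^ (- a) + (X * `|y|) ^+ n * n`!%:R `^ (- k^-1))).
  have -> : X ^+ n * n`!%:R `^ (- a) + (X * `|y|) ^+ n * n`!%:R `^ (- k^-1) =
     B ^+ n * n`!%:R `^ (- a) * (Kh R ^+ n * (1 + `|y| ^+ n / Num.sqrt n`!%:R)) * 2 ^+ n.
    by rewrite fk /X !exprMn; ring.
  by rewrite ler_wpM2r ?exprn_ge0// ler_wpM2l ?hp_bound// mulr_ge0 ?exprn_ge0 ?powR_ge0.
apply: (le_trans (lerD h1 h2)).
have e1 : 1 <= expR (a * X `^ a^-1) by rewrite -expR0 ler_expR mulr_ge0 ?powR_ge0 ?ltW.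
have e2 : 1 <= expR (k^-1 * X `^ k * `|y| `^ k).
  by rewrite -expR0 ler_expR !mulr_ge0 ?powR_ge0 ?ltW.
move: (expR _) (expR _) e1 e2 => e f e1 e2; nra.
Qed.

End HermiteWeights.

(** * Choice of the radius in the Cauchy inequality *)

Section Radii.
Variable R : realType.
Implicit Types (p q k C r S : R) (n : nat).

Lemma cauchy_factor_ge0 (psi : R -> R) C r S n : 0 <= C -> 0 <= S -> 0 <= cauchy_factor psi C r S n.
Proof. by move=> C0 S0; rewrite !mulr_ge0 ?sqrtr_ge0 ?expR_ge0 ?invr_ge0 ?exprn_ge0. Qed.

(** When q = 1 the factor exp(r log S) is a power of S, which S^n beats for large
    n; then the estimate tends to 0 as S tends to infinity. *)
Lemma cauchy_factor_large C r S0 : 0 <= C -> 0 <= r -> 1 <= S0 ->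
  exists N, forall n, (N <= n)%N -> forall S, S0 <= S ->
    cauchy_factor (fun S => ln S `^ 1) C r S n <= Num.sqrt n`!%:R * C / S.
Proof.
move=> C0 r0 S01; pose m := (Num.truncn r).+1; exists m.+3 => n mn S SS.
have S1 : 1 <= S by exact: le_trans SS.
have Sp : 0 < S by exact: lt_le_trans S1.
rewrite /cauchy_factor -[leLHS]mulrA -[leRHS]mulrA ler_wpM2l ?sqrtr_ge0//.
rewrite -[_ / S ^+ n]mulrA -[leLHS]mulrA ler_wpM2l// powRr1 ?ln_ge0//.
have e : expR (r * ln S) <= S ^+ m.
  rewrite -powR_mulrn ?(ltW Sp)// /powR (gt_eqF Sp) ler_expR ler_wpM2r ?ln_ge0//.
  by rewrite ltW// truncnS_gt.
rewrite mulrA -[leLHS](mulfK (lt0r_neq0 Sp)) -[leRHS]mul1r ler_wpM2r ?invr_ge0 ?(ltW Sp)//.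
rewrite mulrAC ler_pdivrMr ?exprn_gt0// mul1r.
apply: (@le_trans _ _ (S ^+ 2 * S ^+ m * S)).
  by rewrite ler_wpM2r ?(ltW Sp)// ler_wpM2l ?sqr_ge0.
by rewrite -exprD -exprSr add2n ler_weXn2l.
Qed.

Lemma fact_le_expn n m : (n <= m)%N -> (n`! <= m ^ n)%N.
Proof. by elim: n => // n IH nm; rewrite factS expnS leq_mul// IH// ltnW. Qed.

(** From n! <= n^n, since log n is smaller than any power of n. *)
Lemma sqrt_fact_le_expR (delta : R) n : 0 < delta ->
  Num.sqrt n`!%:R <= expR (n%:R `^ (1 + delta) / (2 * delta)).
Proof.
move=> d0; case: n => [|n].
  by rewrite fact0 sqrtr1 -expR0 ler_expR divr_ge0 ?powR_ge0// mulr_ge0// ltW.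
have n0 : 0 < n.+1%:R :> R by rewrite ltr0n.
rewrite -(ler_pXn2r (n := 2)) ?nnegrE ?sqrtr_ge0 ?expR_ge0// sqr_sqrtr// -expRM_natr.
apply: (@le_trans _ _ (expR (n.+1%:R * ln n.+1%:R))).
  rewrite mulrC expRM_natr lnK ?posrE// -natrX ler_nat.
  exact: fact_le_expn.
rewrite ler_expR; apply: (@le_trans _ _ (n.+1%:R * (n.+1%:R `^ delta / delta))).
  by rewrite ler_wpM2l// ln_le_powR.
rewrite powRD ?(gt_eqF n0) ?implybT// powRr1// le_eqVlt; apply/orP; left; apply/eqP.
by field; exact: lt0r_neq0.
Qed.

(** With log S = L0 + lam n^(p-1), the gain S^-n is exp(-lam n^p), while the loss
    exp(r (log S)^q) is about exp(r lam^q n^p), as (p-1) q = p. Since q > 1 the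
    gain is larger for small lam, and the other factors are of lower order. *)
Lemma cauchy_factor_exp p q C r S0 : 1 < p -> (p - 1) * q = p ->
  0 <= C -> 0 <= r -> 1 <= S0 ->
  exists S : nat -> R, (forall n, S0 <= S n) /\ exists C' rho, [/\ 0 <= C', 0 < rho & forall n,
    cauchy_factor (fun S => ln S `^ q) C r (S n) n <= C' * expR (- (rho * n%:R `^ p))].
Proof.
move=> p1 pq C0 r0 S01.
have pp : 0 < p - 1 by rewrite subr_gt0.
have p0 : 0 < p by exact: lt_trans p1.
have q0 : 0 < q by rewrite -(pmulr_rgt0 _ pp) pq.
have q1 : 0 < q - 1.
  by rewrite -(pmulr_rgt0 _ pp) mulrBr pq mulr1 opprB addrC subrK.
pose r2 := r * 2 `^ q.
have r20 : 0 <= r2 by rewrite mulr_ge0 ?powR_ge0.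
pose lam := (4 * (r2 + 1))^-1 `^ (q - 1)^-1.
have b0 : 0 < 4 * (r2 + 1) by rewrite mulr_gt0// ltr_wpDl.
have lam0 : 0 < lam by rewrite powR_gt0// invr_gt0.
have lamq : r2 * lam `^ q <= lam / 4.
  have -> : lam `^ q = lam * (4 * (r2 + 1))^-1.
    rewrite -{2}(powRr1 (ltW lam0)) (_ : q = 1 + (q - 1)); last by rewrite addrC subrK.
    rewrite powRD ?(gt_eqF lam0) ?implybT//; congr (_ * _).
    by rewrite /lam -powRrM mulVf ?(gt_eqF q1)// powRr1// invr_ge0 ltW.
  rewrite mulrCA ler_wpM2l ?(ltW lam0)// ler_pdivrMr//; lra.
(* Any delta in (0, p - 1) makes n^(1 + delta) negligible against n^p. *)
pose delta := (p - 1) / 2.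
have de0 : 0 < delta by rewrite divr_gt0.
have [C1 C10 H1] : exists2 C, 0 <= C & forall x, 0 <= x ->
    x `^ (1 + delta) <= (lam * delta / 4) * x `^ p + C.
  by apply: powR_le_eps; rewrite ?addr_ge0 ?(ltW de0)// ?divr_gt0 ?mulr_gt0// /delta; lra.
have [C2 C20 H2] : exists2 C, 0 <= C & forall x, 0 <= x ->
    x `^ (p - 1) <= (1 / 16) * x `^ p + C.
  by apply: powR_le_eps; rewrite ?(ltW pp)//; lra.
pose L0 := ln S0; have L00 : 0 <= L0 by exact: ln_ge0.
pose L n := L0 + lam * n%:R `^ (p - 1).
have Ln n : 0 <= L n by rewrite addr_ge0// mulr_ge0 ?powR_ge0 ?ltW.
exists (fun n => expR (L n)); split.
  move=> n; rewrite -[leLHS](lnK (x := S0)) ?posrE ?(lt_le_trans ltr01)// ler_expR.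
  by rewrite lerDl mulr_ge0 ?powR_ge0 ?ltW.
pose D := C1 / (2 * delta) + 2 * L0 + 2 * lam * C2 + r2 * L0 `^ q.
exists (C * expR D), (lam / 2); split; rewrite ?mulr_ge0 ?expR_ge0 ?divr_gt0// => n.
rewrite /cauchy_factor expRK -!expRM_natr -expRN.
set np := n%:R `^ p.
have npE : n%:R * n%:R `^ (p - 1) = np.
  rewrite /np; clear np; case: n => [|n]; first by rewrite mul0r powR0 ?gt_eqF.
  rewrite -{1}(@powRr1 R n.+1%:R)// -powRD ?[1 + _]addrC ?subrK//.
  by rewrite pnatr_eq0 implybT.
apply: (@le_trans _ _ (expR (n%:R `^ (1 + delta) / (2 * delta)) *
   (C * expR (L n * 2%:R) * expR (r * L n `^ q)) * expR (- (L n * n%:R)))).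
  rewrite ler_wpM2r ?expR_ge0// ler_wpM2r ?sqrt_fact_le_expR//.
  by rewrite !mulr_ge0 ?expR_ge0.
rewrite (_ : _ * _ * _ = C * expR (n%:R `^ (1 + delta) / (2 * delta) + L n * 2 + r * L n `^ q - L n * n%:R)); last first.
  by rewrite !expRD; ring.
rewrite -mulrA -expRD ler_wpM2l// ler_expR.
have h1 : n%:R `^ (1 + delta) / (2 * delta) <= lam / 8 * np + C1 / (2 * delta).
  apply: (le_trans (ler_wpM2r _ (H1 n%:R _))) => //.
    by rewrite invr_ge0 mulr_ge0// ltW.
  rewrite -/np le_eqVlt; apply/orP; left; apply/eqP.
  by clear -de0; move: delta np de0 => w z w0; field; exact: lt0r_neq0.
have h2 : L n * 2 <= lam / 8 * np + 2 * L0 + 2 * lam * C2.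
  have := ler_wpM2l (ltW lam0) (H2 n%:R (ler0n _ _)); rewrite -/np /L => h; lra.
have h3 : r * L n `^ q <= lam / 4 * np + r2 * L0 `^ q.
  have n1 : 0 <= lam * n%:R `^ (p - 1) by rewrite mulr_ge0 ?powR_ge0 ?ltW.
  apply: (le_trans (ler_wpM2l r0 (powRD_le (ltW q0) L00 n1))).
  rewrite powRM ?powR_ge0 ?(ltW lam0)// -powRrM pq -/np mulrA -/r2 mulrDr addrC.
  by rewrite lerD2r mulrA ler_wpM2r ?powR_ge0.
have h4 : lam * np <= L n * n%:R.
  by rewrite /L -npE mulrDl -mulrA [_ `^ _ * n%:R]mulrC lerDr mulr_ge0.
rewrite /D; move: (C1 / _) (r2 * _) h1 h3 => c3 c4 h1 h3; lra.
Qed.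

(** With S^k = n + n0, the loss exp(r S^k) is geometric in n, and the gain S^-n
    is at most (n!)^(-1/k) by n! <= n^n. *)
Lemma cauchy_factor_fact a k C r S0 : 0 < a -> 0 < k -> k^-1 = 1 / 2 + a ->
  0 <= C -> 0 <= r -> 1 <= S0 ->
  exists S : nat -> R, (forall n, S0 <= S n) /\ exists C' B, [/\ 0 <= C', 0 < B & forall n,
    cauchy_factor (fun S => S `^ k) C r (S n) n <= C' * (B ^+ n * n`!%:R `^ (- a))].
Proof.
move=> a0 k0 ka C0 r0 S01.
have S0p : 0 < S0 by exact: lt_le_trans S01.
have ki : 0 < k^-1 by rewrite invr_gt0.
pose n0 := (Num.truncn (S0 `^ k)).+1.
have n0p (n : nat) : 0 < (n + n0)%:R :> R by rewrite ltr0n /n0 addnS.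
have Sk n : ((n + n0)%:R `^ k^-1) `^ k = (n + n0)%:R :> R.
  by rewrite -powRrM mulVf ?(gt_eqF k0)// powRr1.
exists (fun n => (n + n0)%:R `^ k^-1); split.
  have S0E : S0 = (S0 `^ k) `^ k^-1 by rewrite -powRrM mulfV ?(gt_eqF k0)// powRr1// ltW.
  move=> n; rewrite [leLHS]S0E.
  rewrite ler_powR2 ?powR_ge0 ?(ltW ki)//.
  by apply: (@le_trans _ _ n0%:R); [rewrite ltW// truncnS_gt|rewrite ler_nat leq_addl].
pose c := 2 / k + r; exists (C * expR (c * n0%:R)), (expR c).
split; rewrite ?mulr_ge0 ?expR_ge0 ?expR_gt0// => n.
have f0 : 0 < n`!%:R :> R by rewrite ltr0n fact_gt0.
rewrite /cauchy_factor Sk.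
have S2 : ((n + n0)%:R `^ k^-1) ^+ 2 <= expR (2 / k * (n + n0)%:R).
  rewrite -powR_mulrn ?powR_ge0// -powRrM /powR (gt_eqF (n0p n)) ler_expR [k^-1 * _]mulrC.
  rewrite ler_wpM2l ?divr_ge0 ?(ltW k0)//.
  have := ln_le_powR ltr01 (n0p n); rewrite divr1 powRr1//.
have Sn : n`!%:R `^ k^-1 <= ((n + n0)%:R `^ k^-1) ^+ n.
  rewrite -[leRHS]powR_mulrn ?powR_ge0// -powRrM mulrC powRrM ler_powR2 ?(ltW ki) ?(ltW f0)//.
  rewrite powR_mulrn// -natrX ler_nat.
  by rewrite fact_le_expn// leq_addr.
apply: (@le_trans _ _ (Num.sqrt n`!%:R * (C * expR (2 / k * (n + n0)%:R) * expR (r * (n + n0)%:R)) / n`!%:R `^ k^-1)).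
  apply: ler_pM; rewrite ?invr_ge0 ?exprn_ge0 ?powR_ge0 ?mulr_ge0 ?sqrtr_ge0 ?expR_ge0//.
    by rewrite ler_wpM2l ?sqrtr_ge0// ler_wpM2r ?expR_ge0// ler_wpM2l.
  by rewrite lef_pV2 ?posrE ?exprn_gt0 ?powR_gt0.
have -> : Num.sqrt n`!%:R = n`!%:R `^ (1 / 2) :> R by rewrite div1r powR12_sqrt ?ltW.
rewrite -powRN.
have -> : n`!%:R `^ (- a) = n`!%:R `^ (1 / 2) * n`!%:R `^ (- k^-1) :> R.
  by rewrite -powRD ?(gt_eqF f0) ?implybT//; congr powR; rewrite ka; lra.
rewrite -expRM_natr le_eqVlt; apply/orP; left; apply/eqP.
have E : expR (2 / k * (n + n0)%:R) * expR (r * (n + n0)%:R) = expR (c * n0%:R) * expR (c * n%:R).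
  by rewrite -!expRD; congr expR; rewrite natrD /c; move: (2 / k) => w; ring.
by rewrite -[C * _ * _]mulrA E; ring.
Qed.

End Radii.

(** * The equivalence *)

Section PilipovicSpaces.
Variables (R : realType) (d : nat).
Hypothesis hd : (0 < d)%N.
Implicit Types (f : hermite_series R d) (alpha : d.-tuple nat).

Lemma ereal_sup_lt_bound (S : set (\bar R)) : (ereal_sup S < +oo)%E ->
  exists2 L : R, 0 <= L & forall y, S y -> (y < L%:E)%E.
Proof.
case E : (ereal_sup S) => [x||]// _.
  exists (`|x| + 1); first by rewrite addr_ge0.
  move=> y /ereal_sup_ubound; rewrite E => /le_lt_trans; apply.
  by rewrite lte_fin (le_lt_trans (ler_norm x))// ltrDl.
exists 0 => // y /ereal_sup_ubound; rewrite E => /le_lt_trans; apply.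
exact: ltNyr.
Qed.

Lemma ereal_sup_range_finP (T : Type) (F : T -> R) :
  (ereal_sup (range (fun x => (F x)%:E)) < +oo)%E <->
  exists2 A, 0 <= A & forall x, F x <= A.
Proof.
split.
  move=> /ereal_sup_lt_bound[A A0 h]; exists A => // x.
  by apply: ltW; rewrite -lte_fin; apply: h; exists x.
move=> [A _ h]; apply: (@le_lt_trans _ _ A%:E); last exact: ltry.
by apply: ub_ereal_sup => _ [x _ <-]; rewrite lee_fin.
Qed.

Section Equivalence.
Variables (t0 u : d.-tuple R).
Hypothesis hu : forall j, 0 < tnth u j < 1.
Variables (phi psi : R -> R) (Phi : d.-tuple R -> R) (c1 c2 : R).
Hypothesis c10 : 0 <= c1.
Hypothesis c20 : 0 < c2.
Hypothesis phi_ge0 : forall y, 0 <= phi y.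
Hypothesis mphi : measurable_fun setT phi.
Hypothesis growth : gauss_growth phi psi.
Hypothesis Phi_le : forall x, Phi x <= c1 * \sum_(j < d) phi (tnth x j).
Hypothesis Phi_ge : forall x, \sum_(j < d) phi (tnth x j) <= c2 * Phi x.
Variables (f : hermite_series R d) (P : Prop).

Hypothesis P_coef : P -> exists A gam K r,
  [/\ 0 <= A, forall n, 0 <= gam n, 0 <= r,
      forall alpha, normc (f alpha) <= A * \prod_(j < d) gam (tnth alpha j) &
      forall n y, gam n * `|hp n y| <= K * 2 ^- n * expR (r * phi y)].

Hypothesis coef_P : forall M C r1 S0, 0 <= M -> 0 <= C -> 0 <= r1 -> 1 <= S0 ->
  (forall S : nat -> R, (forall n, S0 <= S n) -> forall alpha,
    normc (f alpha) <= M * \prod_(j < d) cauchy_factor psi C r1 (S (tnth alpha j)) (tnth alpha j)) ->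
  P.

(** Everything that distinguishes the cases of the theorem is contained in the
    hypotheses P_coef and coef_P. *)
Lemma equivalence_of_growth :
  [<-> P;
       exists2 r : R, 0 < r &
         (ereal_sup [set weighted_Linfty_norm (gauss_weight Phi r)
             (frac_fourier t f) | t in Lambda t0 u] < +oo)%E;
       exists2 r : R, 0 < r &
         (ereal_sup [set weighted_Linfty_norm (gauss_weight Phi r)
             (frac_fourier t f) | t in [set: d.-tuple R]] < +oo)%E].
Proof.
have P2 : P -> exists2 r : R, 0 < r &
    (ereal_sup [set weighted_Linfty_norm (gauss_weight Phi r)
       (frac_fourier t f) | t in [set: d.-tuple R]] < +oo)%E.
  move=> /P_coef[A [gam [K [r [A0 gam0 r0 fA gamK]]]]].
  have gamK' n y : gam n * `|hp n y| <= K * 2 ^- n * expR ((r + 1) * phi y).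
    have K0 : 0 <= K.
      have : 0 <= K * expR (r * phi 0).
        apply: le_trans (_ : gam 0%N * `|hp 0 0| <= _); first by rewrite mulr_ge0.
        by apply: le_trans (gamK _ _) _; rewrite expr0 invr1 mulr1.
      by rewrite pmulr_lge0// expR_gt0.
    apply: (le_trans (gamK n y)); rewrite ler_wpM2l ?mulr_ge0 ?invr_ge0 ?exprn_ge0//.
    by rewrite ler_expR ler_wpM2r// lerDl.
  have r10 : 0 <= r + 1 by rewrite addr_ge0.
  have [L HL] := weighted_norm_of_coef mphi
    (fun r => gauss_growth_dom growth) Phi_ge A0 gam0 r10 fA gamK'.
  exists ((r + 1) * c2); first by rewrite mulr_gt0// ltr_wpDl.
  apply: (@le_lt_trans _ _ L%:E); last exact: ltry.
  by apply: ub_ereal_sup => _ [t _ <-].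
have P21 : (exists2 r : R, 0 < r &
    (ereal_sup [set weighted_Linfty_norm (gauss_weight Phi r)
       (frac_fourier t f) | t in [set: d.-tuple R]] < +oo)%E) ->
    exists2 r : R, 0 < r &
    (ereal_sup [set weighted_Linfty_norm (gauss_weight Phi r)
       (frac_fourier t f) | t in Lambda t0 u] < +oo)%E.
  move=> [r r0 h]; exists r => //; apply: le_lt_trans h.
  by apply: ereal_sup_le => _ [t _ <-]; exists t.
have P1 : (exists2 r : R, 0 < r &
    (ereal_sup [set weighted_Linfty_norm (gauss_weight Phi r)
       (frac_fourier t f) | t in Lambda t0 u] < +oo)%E) -> P.
  move=> [r r0 /ereal_sup_lt_bound[L L0 h]].
  have fL t : Lambda t0 u t ->
      (weighted_Linfty_norm (gauss_weight Phi r) (frac_fourier t f) < L%:E)%E.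
    by move=> Lt; apply: h; exists t.
  have [M [C [r1 [S0 [M0 C0 r10 S01 H]]]]] :=
    coef_bound_of_norms hu c10 Phi_le growth (ltW r0) L0 fL.
  exact: (coef_P M0 C0 r10 S01 H).
tfae; [by move=> /P2/P21|by move=> /P1/P2|by move=> /P21/P1].
Qed.

End Equivalence.

Lemma sum_le_card (F : 'I_d -> R) (c : R) : (forall j, F j <= c) ->
  \sum_j F j <= d%:R * c.
Proof.
move=> Fc; apply: (@le_trans _ _ (\sum_(j < d) c)); first by apply: ler_sum => j _.
by rewrite sumr_const card_ord mulr_natl.
Qed.

Lemma tnth_le_mdegree alpha j : (tnth alpha j <= mdegree alpha)%N.
Proof. by rewrite /mdegree (bigD1 j)//= leq_addr. Qed.

Lemma sum_powR_degree_le alpha (p : R) : 0 <= p ->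
  \sum_(j < d) (tnth alpha j)%:R `^ p <= d%:R * (mdegree alpha)%:R `^ p.
Proof.
by move=> p0; apply: sum_le_card => j; rewrite ler_powR2// ler_nat tnth_le_mdegree.
Qed.

Lemma degree_powR_le alpha (p : R) : 0 <= p ->
  (mdegree alpha)%:R `^ p <= d%:R `^ p * \sum_(j < d) (tnth alpha j)%:R `^ p.
Proof. by move=> p0; rewrite /mdegree natr_sum powR_sum_le. Qed.

Lemma prod_pow_fact alpha (B c : R) :
  \prod_(j < d) (B ^+ tnth alpha j * (tnth alpha j)`!%:R `^ c) =
  B ^+ mdegree alpha * (mfact alpha)%:R `^ c.
Proof.
rewrite big_split/= -powR_prod// natr_prod; congr (_ * _).
by rewrite -expr_sum.
Qed.

Lemma enorm_weight_le (k : R) (x : d.-tuple R) : 0 <= k ->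
  enorm x `^ k <= d%:R `^ k * \sum_(j < d) `|tnth x j| `^ k.
Proof.
move=> k0; apply: le_trans (powR_sum_le hd k0 (fun j => normr_ge0 (tnth x j))).
by rewrite ler_powR2 ?enorm_le ?sqrtr_ge0.
Qed.

Lemma enorm_weight_ge (k : R) (x : d.-tuple R) : 0 <= k ->
  \sum_(j < d) `|tnth x j| `^ k <= d%:R * enorm x `^ k.
Proof.
by move=> k0; apply: sum_le_card => j; rewrite ler_powR2 ?normr_le_enorm.
Qed.

Lemma bracket_weight_le (q : R) (x : d.-tuple R) : 0 <= q ->
  ln (bracket x) `^ q <= d%:R `^ q * \sum_(j < d) lbr (tnth x j) `^ q.
Proof.
move=> q0; apply: le_trans (powR_sum_le hd q0 (fun j => lbr_ge0 (tnth x j))).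
by rewrite ler_powR2 ?ln_bracket_le// ln_bracket divr_ge0// ln_ge0// addsqr_ge1.
Qed.

Lemma bracket_weight_ge (q : R) (x : d.-tuple R) : 0 <= q ->
  \sum_(j < d) lbr (tnth x j) `^ q <= d%:R * ln (bracket x) `^ q.
Proof.
by move=> q0; apply: sum_le_card => j; rewrite ler_powR2 ?lbr_ge0 ?lbr_le_ln_bracket.
Qed.

Lemma pilipovic_zero_bound f : finite_set [set alpha | f alpha != 0] ->
  exists A N, 0 <= A /\ forall alpha,
    normc (f alpha) <= A * \prod_(j < d) (tnth alpha j <= N)%N%:R.
Proof.
move=> /finite_seqP[s fs].
exists (\sum_(alpha <- s) normc (f alpha)), (\sum_(alpha <- s) mdegree alpha)%N.
have S0 (r : seq (d.-tuple nat)) : 0 <= \sum_(alpha <- r) normc (f alpha).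
  by apply: sumr_ge0 => i _; exact: normc_ge0.
split=> // alpha.
have [->|fa] := eqVneq (f alpha) 0.
  by rewrite normc0 mulr_ge0// prodr_ge0.
have as_ : alpha \in s by have : [set` s] alpha by rewrite -fs.
rewrite [X in _ * X]big1 ?mulr1; last first.
  move=> j _; rewrite (leq_trans (tnth_le_mdegree alpha j))//.
  by rewrite (big_rem _ as_)/= leq_addr.
by rewrite (big_rem _ as_)/= lerDl.
Qed.

(** If alpha_j is large, take a large radius T for the large indices and the
    fixed radius S0 for the others. The bound is then at most D / T for all
    T >= S0, and the coefficient vanishes. *)
Lemma finite_support_of_cauchy f M C r1 S0 : 0 <= M -> 0 <= C -> 0 <= r1 -> 1 <= S0 ->
  (forall S : nat -> R, (forall n, S0 <= S n) -> forall alpha,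
    normc (f alpha) <= M * \prod_(j < d)
      cauchy_factor (fun S => ln S `^ 1) C r1 (S (tnth alpha j)) (tnth alpha j)) ->
  finite_set [set alpha | f alpha != 0].
Proof.
move=> M0 C0 r10 S01 H.
have S0p : 0 < S0 by exact: lt_le_trans S01.
have [N HN] := cauchy_factor_large C0 r10 S01.
suff f0 alpha j : (N <= tnth alpha j)%N -> f alpha = 0.
  apply: (@sub_finite_set _ _ (range (fun t : d.-tuple 'I_N => [tuple (tnth t j : nat) | j < d]))).
    move=> alpha /= fa.
    have lN j : (tnth alpha j < N)%N.
      by rewrite ltnNge; apply/negP => /f0 fa0; rewrite fa0 eqxx in fa.
    exists [tuple Ordinal (lN j) | j < d] => //.
    by apply: eq_from_tnth => j; rewrite !tnth_mktuple.
  by apply: finite_image; exact: finite_finset.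
move=> Nj; apply/eqP/negPn/negP; rewrite -normc_gt0 => fa.
pose E n := if (N <= n)%N then Num.sqrt n`!%:R * C
  else cauchy_factor (fun S => ln S `^ 1) C r1 S0 n.
have E0 n : 0 <= E n.
  by rewrite /E; case: ifP => _; rewrite ?cauchy_factor_ge0 ?(ltW S0p)// mulr_ge0 ?sqrtr_ge0.
pose D := M * \prod_(k < d) E (tnth alpha k).
have D0 : 0 <= D by rewrite mulr_ge0// prodr_ge0.
(* The j-th factor gains 1 / T and the other ones stay bounded. *)
have key T : S0 <= T -> normc (f alpha) <= D / T.
  move=> S0T; have T1 : 1 <= T by exact: le_trans S0T.
  have T0 : 0 < T by exact: lt_le_trans T1.
  have HS n : S0 <= (if (N <= n)%N then T else S0) by case: ifP.
  apply: (le_trans (H _ HS alpha)); rewrite /D -[leRHS]mulrA ler_wpM2l//.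
  rewrite (bigD1 j)//= [in leRHS](bigD1 j)//= Nj [leRHS]mulrAC.
  apply: ler_pM.
  - by rewrite cauchy_factor_ge0 ?(ltW T0).
  - by apply: prodr_ge0 => k _; rewrite cauchy_factor_ge0// (le_trans _ (HS _))// ltW.
  - by rewrite /E Nj; exact: HN.
  apply: ler_prod => k _; rewrite cauchy_factor_ge0 ?(le_trans _ (HS _)) ?(ltW S0p)//=.
  rewrite /E; case: ifP => [Nk|//]; apply: (le_trans (HN _ Nk _ S0T)).
  by rewrite ler_piMr ?mulr_ge0 ?sqrtr_ge0// invf_le1.
have := key (S0 + D / normc (f alpha)).
rewrite lerDl divr_ge0 ?(ltW fa)// => /(_ isT).
rewrite ler_pdivlMr; last by rewrite ltr_wpDr// divr_ge0// ltW.
by rewrite mulrDr mulrCA mulfV ?(gt_eqF fa)// mulr1 gerDr leNgt mulr_gt0.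
Qed.

Lemma pilipovic_exp_bound f (r p : R) : 0 < r -> 0 <= p ->
  (ereal_sup (range (fun alpha =>
     (normc (f alpha) * expR (r * (mdegree alpha)%:R `^ p))%:E)) < +oo)%E ->
  exists2 A, 0 <= A & forall alpha,
    normc (f alpha) <= A * \prod_(j < d) expR (- (r / d%:R * (tnth alpha j)%:R `^ p)).
Proof.
move=> r0 p0 /ereal_sup_range_finP[A A0 fA]; exists A => // alpha.
have d0 : 0 < d%:R :> R by rewrite ltr0n.
have := fA alpha; rewrite -ler_pdivlMr ?expR_gt0// -expRN => h; apply: (le_trans h).
rewrite ler_wpM2l// -expR_sum ler_expR sumrN lerN2 -mulr_sumr -mulrA ler_wpM2l ?(ltW r0)//.
by rewrite mulrC ler_pdivrMr// mulrC sum_powR_degree_le.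
Qed.

Lemma pilipovic_of_exp_bound f (A rho p : R) : 0 <= A -> 0 < rho -> 0 <= p ->
  (forall alpha, normc (f alpha) <=
     A * \prod_(j < d) expR (- (rho * (tnth alpha j)%:R `^ p))) ->
  exists2 r, 0 < r & (ereal_sup (range (fun alpha =>
     (normc (f alpha) * expR (r * (mdegree alpha)%:R `^ p))%:E)) < +oo)%E.
Proof.
move=> A0 rho0 p0 fA.
have d0 : 0 < d%:R `^ p :> R by rewrite powR_gt0// ltr0n.
exists (rho / d%:R `^ p); first by rewrite divr_gt0.
apply/ereal_sup_range_finP; exists A => // alpha.
rewrite -ler_pdivlMr ?expR_gt0// -expRN; apply: (le_trans (fA alpha)).
rewrite ler_wpM2l// -expR_sum ler_expR sumrN lerN2 -mulr_sumr -mulrA ler_wpM2l ?(ltW rho0)//.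
by rewrite mulrC ler_pdivrMr// mulrC degree_powR_le.
Qed.

Lemma prod_inv_pow_fact alpha (B c : R) :
  \prod_(j < d) (B^-1 ^+ tnth alpha j * (tnth alpha j)`!%:R `^ (- c)) =
  (B ^+ mdegree alpha * (mfact alpha)%:R `^ c)^-1.
Proof. by rewrite prod_pow_fact exprVn powRN invfM. Qed.

Lemma pilipovic_fact_bound f (r c : R) : 0 < r ->
  (ereal_sup (range (fun alpha =>
     (normc (f alpha) * (r ^+ mdegree alpha * (mfact alpha)%:R `^ c))%:E)) < +oo)%E ->
  exists2 A, 0 <= A & forall alpha, normc (f alpha) <=
    A * \prod_(j < d) (r^-1 ^+ tnth alpha j * (tnth alpha j)`!%:R `^ (- c)).
Proof.
move=> r0 /ereal_sup_range_finP[A A0 fA]; exists A => // alpha.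
rewrite prod_inv_pow_fact ler_pdivlMr// mulr_gt0 ?exprn_gt0// powR_gt0// ltr0n.
by apply: prodn_gt0 => j; exact: fact_gt0.
Qed.

Lemma pilipovic_of_fact_bound f (A B c : R) : 0 <= A -> 0 < B ->
  (forall alpha, normc (f alpha) <=
    A * \prod_(j < d) (B ^+ tnth alpha j * (tnth alpha j)`!%:R `^ (- c))) ->
  exists2 r, 0 < r & (ereal_sup (range (fun alpha =>
     (normc (f alpha) * (r ^+ mdegree alpha * (mfact alpha)%:R `^ c))%:E)) < +oo)%E.
Proof.
move=> A0 B0 fA; exists B^-1; first by rewrite invr_gt0.
apply/ereal_sup_range_finP; exists A => // alpha.
rewrite -ler_pdivlMr; last first.
  rewrite mulr_gt0 ?exprn_gt0 ?invr_gt0// powR_gt0// ltr0n.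
  by apply: prodn_gt0 => j; exact: fact_gt0.
by rewrite -prod_inv_pow_fact invrK.
Qed.

Lemma coef_bound_split f M C (gam : nat -> R) (F : nat -> R) : 0 <= M -> 0 <= C ->
  (forall n, 0 <= F n <= C * gam n) ->
  (forall alpha, normc (f alpha) <= M * \prod_(j < d) F (tnth alpha j)) ->
  forall alpha, normc (f alpha) <= M * C ^+ d * \prod_(j < d) gam (tnth alpha j).
Proof.
move=> M0 C0 Fg fF alpha; apply: (le_trans (fF alpha)); rewrite -mulrA ler_wpM2l//.
apply: (@le_trans _ _ (\prod_(j < d) (C * gam (tnth alpha j)))).
  by apply: ler_prod => j _; exact: Fg.
by rewrite big_split/= prodr_const card_ord.
Qed.

End PilipovicSpaces.

Theorem theorem3p2 (R : realType) (d : nat) (hd : (1 <= d)%N)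
    (s : flat_index R) (hs : flat_lt s (Exponent (1 / 2)%:nng))
    (t0 u : d.-tuple R) (hu : forall j, 0 < tnth u j < 1)
    (f : hermite_series R d) :
  [<-> pilipovic_space s f;
       exists2 r : R, 0 < r &
         (ereal_sup [set weighted_Linfty_norm
             (fun x => expR (1 / 2 * enorm x ^+ 2) * omega r s x)%R
             (frac_fourier t f) | t in Lambda t0 u] < +oo)%E;
       exists2 r : R, 0 < r &
         (ereal_sup [set weighted_Linfty_norm
             (fun x => expR (1 / 2 * enorm x ^+ 2) * omega r s x)%R
             (frac_fourier t f) | t in [set: d.-tuple R]] < +oo)%E].
Proof.
have d0 : 0 < d%:R :> R by rewrite ltr0n.
case: s hs => [s|sigma] hs.
  pose q := 1 / (1 - 2 * s%:num).
  have s2 : 0 < 1 - 2 * s%:num by move: hs; rewrite /flat_lt/= => hs; lra.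
  have q0 : 0 < q by rewrite divr_gt0.
  have growth := log_gauss_growth (R := R) (ltW q0).
  have mphi : measurable_fun setT (fun y : R => lbr y `^ q).
    exact: (measurableT_comp (measurable_powR q) (@measurable_lbr R)).
  apply: (@equivalence_of_growth R d t0 u hu _ _ (fun x => ln (bracket x) `^ q)
    (d%:R `^ q) d%:R (powR_ge0 _ _) d0 (fun y => powR_ge0 _ _) mphi growth
    (fun x => bracket_weight_le hd x (ltW q0)) (fun x => bracket_weight_ge x (ltW q0))).
    rewrite /pilipovic_space/=; case: ifPn => [/eqP s0|s0].
      move=> /pilipovic_zero_bound[A [N [A0 fA]]].
      have [K [r [r0 HK]]] := hermite_weight_finite R N.
      have q1 : q = 1 by rewrite /q s0 mulr0 subr0 divr1.
      by exists A, (fun n => (n <= N)%N%:R), K, r; rewrite q1; split.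
    have sp : 0 < s%:num by rewrite lt_neqAle eq_sym s0 ge0.
    pose p := 1 / (2 * s%:num).
    have p0 : 0 <= p by rewrite divr_ge0// mulr_ge0.
    have p1 : 1 < p by rewrite /p ltr_pdivlMr ?mulr_gt0//; lra.
    have pq : (p - 1) * q = p.
      by rewrite /p /q; field; rewrite !lt0r_neq0.
    move=> [r r0 /(pilipovic_exp_bound hd r0 p0)[A A0 fA]].
    have [K [r' [r'0 HK]]] := hermite_weight_exp (divr_gt0 r0 d0) p1 pq.
    by exists A, (fun n => expR (- (r / d%:R * n%:R `^ p))), K, r'; split.
  move=> M C r1 S0 M0 C0 r10 S01 H.
  rewrite /pilipovic_space/=; case: ifPn => [/eqP s0|s0].
    have q1 : q = 1 by rewrite /q s0 mulr0 subr0 divr1.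
    by rewrite q1 in H; exact: finite_support_of_cauchy H.
  have sp : 0 < s%:num by rewrite lt_neqAle eq_sym s0 ge0.
  pose p := 1 / (2 * s%:num).
  have p0 : 0 <= p by rewrite divr_ge0// mulr_ge0.
  have p1 : 1 < p by rewrite /p ltr_pdivlMr ?mulr_gt0//; lra.
  have pq : (p - 1) * q = p.
    by rewrite /p /q; field; rewrite !lt0r_neq0.
  have [S [HS [C' [rho [C'0 rho0 HF]]]]] := cauchy_factor_exp p1 pq C0 r10 S01.
  apply: (pilipovic_of_exp_bound hd (A := M * C' ^+ d) (rho := rho)) => //.
    by rewrite mulr_ge0// exprn_ge0.
  apply: (coef_bound_split (F := fun n => cauchy_factor _ C r1 (S n) n) (gam := fun n => expR (- (rho * n%:R `^ p))) M0 C'0 _ (H S HS)) => n.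
  by rewrite HF andbT cauchy_factor_ge0// (le_trans _ (HS n))// (le_trans _ S01).
(* The coefficients decay like (n!)^-a, and 1/k = 1/2 + a: the half comes from
   the normalization sqrt(n!) of the Hermite functions. *)
pose k := 2 * sigma%:num / (sigma%:num + 1).
pose a := 1 / (2 * sigma%:num).
have sg : 0 < sigma%:num by [].
have k0 : 0 < k by rewrite divr_gt0// ?mulr_gt0// addr_gt0.
have k2 : k < 2 by rewrite /k ltr_pdivrMr ?addr_gt0//; lra.
have a0 : 0 < a by rewrite divr_gt0// mulr_gt0.
have ka : k^-1 = 1 / 2 + a.
  by rewrite /k /a; field; rewrite !lt0r_neq0// addr_gt0.
have k02 : 0 < k < 2 by rewrite k0 k2.
have growth := pow_gauss_growth k02.
have mphi : measurable_fun setT (fun y : R => `|y| `^ k).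
  exact: (measurableT_comp (measurable_powR k) (@normr_measurable R setT)).
apply: (@equivalence_of_growth R d t0 u hu _ _ (fun x => enorm x `^ k)
    (d%:R `^ k) d%:R (powR_ge0 _ _) d0 (fun y => powR_ge0 _ _) mphi growth
    (fun x => enorm_weight_le hd x (ltW k0)) (fun x => enorm_weight_ge x (ltW k0))).
  move=> [r r0 /(pilipovic_fact_bound r0)[A A0 fA]].
  have ri : 0 <= r^-1 by rewrite invr_ge0 ltW.
  have [K [r' [r'0 HK]]] := hermite_weight_fact ri a0 k0 ka.
  exists A, (fun n => r^-1 ^+ n * n`!%:R `^ (- a)), K, r'; split=> // n.
  by rewrite mulr_ge0 ?exprn_ge0 ?powR_ge0.
move=> M C r1 S0 M0 C0 r10 S01 H.
have [S [HS [C' [B [C'0 B0 HF]]]]] := cauchy_factor_fact a0 k0 ka C0 r10 S01.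
apply: (pilipovic_of_fact_bound (A := M * C' ^+ d) (B := B)) => //.
  by rewrite mulr_ge0// exprn_ge0.
apply: (coef_bound_split (F := fun n => cauchy_factor _ C r1 (S n) n) (gam := fun n => B ^+ n * n`!%:R `^ (- a)) M0 C'0 _ (H S HS)) => n.
by rewrite HF andbT cauchy_factor_ge0// (le_trans _ (HS n))// (le_trans _ S01).
Qed.
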